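(* Let $\vec p=(p_1,1)$ and $\vec q=(q_1,q_2)$ satisfy $1<p_1\le q_-\le q_+<\infty$, and let $\vec a,\vec b,\vec c\in\mathbb{R}^2$, $\vec\alpha,\vec\beta\in(-1,\infty)^2$. Then the following are equivalent: (1) $S_{\vec a,\vec b,\vec c}$ is bounded from $L^{\vec p}_{\vec\alpha}(T_B\times T_B)$ to $L^{\vec q}_{\vec\beta}(T_B\times T_B)$; (2) $T_{\vec a,\vec b,\vec c}$ is bounded from $L^{\vec p}_{\vec\alpha}(T_B\times T_B)$ to $L^{\vec q}_{\vec\beta}(T_B\times T_B)$; (3) $\alpha_1+1<p_1(b_1+1)$, $\alpha_2<b_2$, and for each $i\in\{1,2\}$: $-q_ia_i<\beta_i+1$ and $c_i=n+1+a_i+b_i+\lambda_i$, where $\lambda_1=\frac{n+1+\beta_1}{q_1}-\frac{n+1+\alpha_1}{p_1}$ and $\lambda_2=\frac{n+1+\beta_2}{q_2}-(n+1+\alpha_2)$.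
   Context: Let $n$ be a positive integer. For $z=(z_1,\dots,z_n)\in\mathbb{C}^n$ write $z=x+iy$ with $x,y\in\mathbb{R}^n$, $z'=(z_1,\dots,z_{n-1})$, $y'=(y_1,\dots,y_{n-1})$. Let $B=\{y\in\mathbb{R}^n: |y'|^2<y_n\}$ and $T_B=\{x+iy: x\in\mathbb{R}^n, y\in B\}$. For $z\in T_B$ put $\rho(z)=y_n-|y'|^2>0$, and for $z,u\in T_B$ put $\rho(z,u)=\frac14\big(\sum_{j=1}^{n-1}(z_j-\overline{u_j})^2-2i(z_n-\overline{u_n})\big)$; this has positive real part, and complex powers $\rho(z,u)^c$ are taken with the principal branch. $dV$ is Lebesgue measure on $\mathbb{C}^n$ and $dV_\alpha(z)=\rho(z)^\alpha dV(z)$. For $\vec p=(p_1,p_2)\in[1,\infty]^2$ and $\vec\alpha=(\alpha_1,\alpha_2)$, $L^{\vec p}_{\vec\alpha}(T_B\times T_B)$ is the space of measurable $f$ on $T_B\times T_B$ with finite mixed norm $\|f\|_{\vec p,\vec\alpha}=\big\{\int_{T_B}\big(\int_{T_B}|f(z,w)|^{p_1}dV_{\alpha_1}(z)\big)^{p_2/p_1}dV_{\alpha_2}(w)\big\}^{1/p_2}$, with the inner (resp. outer) integral replaced by an essential supremum in $z$ (resp. $w$) when $p_1=\infty$ (resp. $p_2=\infty$); when $\vec p=(\infty,\infty)$ this is $L^\infty(T_B\times T_B)$. Write $p_-=\min\{p_1,p_2\}$, $p_+=\max\{p_1,p_2\}$, and similarly $q_\pm$. For $\vec a=(a_1,a_2),\vec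 b=(b_1,b_2),\vec c=(c_1,c_2)\in\mathbb{R}^2$, $T_{\vec a,\vec b,\vec c}f(z,w)=\rho(z)^{a_1}\rho(w)^{a_2}\int_{T_B}\int_{T_B}\frac{\rho(u)^{b_1}\rho(\eta)^{b_2}}{\rho(z,u)^{c_1}\rho(w,\eta)^{c_2}}f(u,\eta)\,dV(u)\,dV(\eta)$ and $S_{\vec a,\vec b,\vec c}f(z,w)=\rho(z)^{a_1}\rho(w)^{a_2}\int_{T_B}\int_{T_B}\frac{\rho(u)^{b_1}\rho(\eta)^{b_2}}{|\rho(z,u)|^{c_1}|\rho(w,\eta)|^{c_2}}f(u,\eta)\,dV(u)\,dV(\eta)$. An operator is bounded from $X$ to $Y$ if for every $f\in X$ the defining integral converges for a.e. $(z,w)$ and $\|Tf\|_Y\le C\|f\|_X$ with $C$ independent of $f$. *)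

(* Defs.v *)
From HB Require Import structures.
From mathcomp Require Import all_boot all_order all_algebra.
From mathcomp Require Import all_classical all_reals all_analysis.
From mathcomp Require Import complex.

Set Implicit Arguments.
Unset Strict Implicit.
Unset Printing Implicit Defensive.
Import Order.TTheory GRing.Theory Num.Theory.
Import numFieldNormedType.Exports.

Local Open Scope classical_set_scope.
Local Open Scope ring_scope.

Fixpoint RnM (R : realType) (k : nat) : {d : measure_display & measurableType d} :=
  match k with
  | 0 => existT (fun d => measurableType d) _ unit
  | k'.+1 => existT (fun d => measurableType d) _
               ((measurableTypeR R) * projT2 (RnM R k'))%type
  end.

Definition Rn (R : realType) (k : nat) : measurableType (projT1 (RnM R k)) :=
  projT2 (RnM R k).

(** Lebesgue measure on R^k : iterated product of 1-dimensional Lebesgue measures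
    (as a set function; on measurable sets it is the product measure). *)
Fixpoint lebn (R : realType) (k : nat) : set (Rn R k) -> \bar R :=
  match k return set (Rn R k) -> \bar R with
  | 0 => (dirac tt : set unit -> \bar R)
  | k'.+1 => (@lebesgue_measure R \x @lebn R k')%E
  end.

(** the i-th coordinate (0-based) of a point of R^k (0 if i >= k) *)
Fixpoint coord (R : realType) (k : nat) : Rn R k -> nat -> R :=
  match k return Rn R k -> nat -> R with
  | 0 => fun _ _ => 0
  | k'.+1 => fun x i => match i with
                        | 0 => x.1
                        | i'.+1 => coord x.2 i'
                        end
  end.

(** * C^n = R^n x R^n, a point z = x + i y is the pair (x, y) *)
Definition Cn (R : realType) (n : nat) := (Rn R n * Rn R n)%type.

Definition volC (R : realType) (n : nat) : set (Cn R n) -> \bar R :=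
  (@lebn R n \x @lebn R n)%E.

Definition volCC (R : realType) (n : nat) : set (Cn R n * Cn R n) -> \bar R :=
  (@volC R n \x @volC R n)%E.

(** coordinates z_j = x_j + i y_j (0-based: the paper's z_j is zc z (j-1)) *)
Definition xc (R : realType) (n : nat) (z : Cn R n) (j : nat) : R := coord z.1 j.
Definition yc (R : realType) (n : nat) (z : Cn R n) (j : nat) : R := coord z.2 j.
Definition zc (R : realType) (n : nat) (z : Cn R n) (j : nat) : R[i] :=
  Complex (xc z j) (yc z j).

Definition rho (R : realType) (n : nat) (z : Cn R n) : R :=
  yc z n.-1 - \sum_(j < n.-1) yc z j ^+ 2.

(** the tube domain T_B over B = {y : |y'|^2 < y_n} *)
Definition TB (R : realType) (n : nat) : set (Cn R n) := [set z | 0 < rho z].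

Definition rho2 (R : realType) (n : nat) (z u : Cn R n) : R[i] :=
  (Complex (4^-1) 0) *
  (\sum_(j < n.-1) (zc z j - conjc (zc u j)) ^+ 2
   - (Complex 0 2) * (zc z n.-1 - conjc (zc u n.-1))).

Definition cabs (R : realType) (w : R[i]) : R :=
  Num.sqrt (@complex.Re R w ^+ 2 + @complex.Im R w ^+ 2).

(** principal argument, with values in (-pi, pi] *)
Definition Arg (R : realType) (w : R[i]) : R :=
  let a := @complex.Re R w in let b := @complex.Im R w in
  if 0 < a then atan (b / a)
  else if a < 0 then (if 0 <= b then atan (b / a) + pi else atan (b / a) - pi)
  else if 0 < b then pi / 2 else if b < 0 then - (pi / 2) else 0.

(** principal branch of w^c = exp(c Log w), c real, w <> 0 (0 for w = 0) *)
Definition cpow (R : realType) (w : R[i]) (c : R) : R[i] :=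
  if w == 0 then 0
  else Complex (expR (c * ln (cabs w))) 0 *
       Complex (cos (c * Arg w)) (sin (c * Arg w)).

Definition cint d (T : measurableType d) (R : realType) (mu : set T -> \bar R)
  (D : set T) (h : T -> R[i]) : R[i] :=
  Complex (fine (\int[mu]_(x in D) (@complex.Re R (h x))%:E)%E)
          (fine (\int[mu]_(x in D) (@complex.Im R (h x))%:E)%E).

Definition cintegrable d (T : measurableType d) (R : realType)
  (mu : set T -> \bar R) (D : set T) (h : T -> R[i]) : Prop :=
  mu.-integrable D (fun x => (@complex.Re R (h x))%:E) /\
  mu.-integrable D (fun x => (@complex.Im R (h x))%:E).

(** functions on T_B x T_B *)
Definition cfun (R : realType) (n : nat) := Cn R n * Cn R n -> R[i].

Definition mixnorm (R : realType) (n : nat) (p1 p2 al1 al2 : R) (f : cfun R n)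
  : \bar R :=
  ((\int[@volC R n]_(w in @TB R n)
     ((\int[@volC R n]_(z in @TB R n)
         ((cabs (f (z, w))) `^ p1 * rho z `^ al1)%:E) `^ (p2 / p1)
      * (rho w `^ al2)%:E))%E `^ (p2^-1))%E.

Definition inLp (R : realType) (n : nat) (p1 p2 al1 al2 : R) (f : cfun R n) : Prop :=
  measurable_fun (@TB R n `*` @TB R n) (fun x => @complex.Re R (f x)) /\
  measurable_fun (@TB R n `*` @TB R n) (fun x => @complex.Im R (f x)) /\
  (mixnorm p1 p2 al1 al2 f < +oo)%E.

Definition Tintegrand (R : realType) (n : nat) (b1 b2 c1 c2 : R) (f : cfun R n)
  (z w : Cn R n) : Cn R n * Cn R n -> R[i] :=
  fun ue => Complex (rho ue.1 `^ b1 * rho ue.2 `^ b2) 0 * f ue /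
            (cpow (rho2 z ue.1) c1 * cpow (rho2 w ue.2) c2).

Definition Sintegrand (R : realType) (n : nat) (b1 b2 c1 c2 : R) (f : cfun R n)
  (z w : Cn R n) : Cn R n * Cn R n -> R[i] :=
  fun ue => Complex (rho ue.1 `^ b1 * rho ue.2 `^ b2) 0 * f ue /
            Complex (cabs (rho2 z ue.1) `^ c1 * cabs (rho2 w ue.2) `^ c2) 0.

Definition intop (R : realType) (n : nat) (a1 a2 : R)
  (K : cfun R n -> Cn R n -> Cn R n -> Cn R n * Cn R n -> R[i])
  (f : cfun R n) : cfun R n :=
  fun zw => Complex (rho zw.1 `^ a1 * rho zw.2 `^ a2) 0 *
            cint (@volCC R n) (@TB R n `*` @TB R n) (K f zw.1 zw.2).

Definition bounded_op (R : realType) (n : nat) (a1 a2 : R)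
  (K : cfun R n -> Cn R n -> Cn R n -> Cn R n * Cn R n -> R[i])
  (p1 p2 al1 al2 q1 q2 be1 be2 : R) : Prop :=
  exists C : R, forall f : cfun R n, inLp p1 p2 al1 al2 f ->
    (@volCC R n).-negligible
       [set zw | (@TB R n `*` @TB R n) zw /\
                 ~ cintegrable (@volCC R n) (@TB R n `*` @TB R n) (K f zw.1 zw.2)] /\
    (mixnorm q1 q2 be1 be2 (intop a1 a2 K f) <= C%:E * mixnorm p1 p2 al1 al2 f)%E.

(* Main.v *)
Require Import Defs.
From HB Require Import structures.
From mathcomp Require Import all_boot all_order all_algebra.
From mathcomp Require Import all_classical all_reals all_analysis.
From mathcomp Require Import measurable_realfun complex ring lra.
Import Order.TTheory GRing.Theory Num.Theory.
Import numFieldNormedType.Exports.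

Set Implicit Arguments.
Unset Strict Implicit.
Unset Printing Implicit Defensive.

Local Open Scope classical_set_scope.
Local Open Scope ring_scope.

(* Everything reduces to the exact integral of [rho(u)^a |rho(z,u)|^c], a constant times
   [rho(z)^(a+c+n+1)], the constant being finite iff [a > -1] and [a+c+n+1 < 0].

   Sufficiency. In the first variable a Schur test with a power weight gives
   L^p1 -> L^q1; Minkowski's integral inequality moves this bound inside the
   integration in the second variable, where p2 = 1 leaves only the L^q2 norm of the
   kernel itself.

   Necessity, for S and T at once. On the box of relative size [eps] around the point
   [xi h = (0, i h)], [rho(z,u)] stays within a small relative distance of
   [rho(z, xi h)], uniformly in z; so the phase of the kernel of T is nearly constant
   and, after a rotation, |T f| is bounded below as |S f| is. Indicators of two such boxes
   give the integrability conditions, and varying the two scales [h] gives the formulas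
   for c1 and c2. Functions [rho^(-(al1+1)/p1)] cut off at [2^-k < rho <= 1] give
   al1 + 1 < p1 (b1 + 1): otherwise k <= C k^(1/p1) for all k. *)

(** Once rho(u) replaces the last imaginary coordinate of u, the kernel depends on the two last
    coordinates linearly and on the others quadratically. The coordinates can therefore be
    integrated out one at a time, each leaving a power of the rest; this is the origin of the exact
    formula. Its constant is kept as an extended real, so that one identity yields finite norms for
    the sufficiency and reports divergence for the necessity.

    The box functions alone do not give al1 + 1 < p1 (b1 + 1). Convergence of the kernel integral,
    combined with the formula for c1, only yields (n+1+al1)/p1 < n+1+b1, which is weaker for p1 > 1;
    in the second variable the same argument yields al2 < b2 at once, because the exponent there is
    1. Hence the functions with the critical exponent in the first variable: rho^(-(al1+1)/p1)
    misses L^p1 near rho = 0 by a logarithm only. *)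

Lemma gt0_powRD (R : realType) (x r s : R) : 0 < x -> x `^ (r + s) = x `^ r * x `^ s.
Proof. by move=> x0; rewrite powRD// (gt_eqF x0) implybT. Qed.

(** * Young's and Jensen's inequalities for extended nonnegative functions *)

Section ge0_integral_tools.
Context d (T : measurableType d) (R : realType).
Variable mu : {measure set T -> \bar R}.
Local Open Scope ereal_scope.
Implicit Types f g phi : T -> \bar R.

(** The integral of a nonnegative function is a supremum over the simple functions below it, and
    these only increase with the function. It serves for integrands built from [intop], whose
    measurability is never established. *)
Lemma ge0_le_integral_nomeas (D : set T) f g :
  (forall x, D x -> 0 <= f x) -> (forall x, D x -> f x <= g x) ->
  \int[mu]_(x in D) f x <= \int[mu]_(x in D) g x.
Proof.
move=> f0 fg.
have g0 x : D x -> 0 <= g x by move=> Dx; exact: le_trans (f0 _ Dx) (fg _ Dx).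
rewrite !ge0_integralE//; apply: le_ereal_sup => _ [h hf <-].
exists h => // x.
apply: le_trans (hf x) _; rewrite !patchE; case: ifPn => // /set_mem; exact: fg.
Qed.

Lemma ge0_integral_setT_patch (D : set T) f g :
  (forall x, D x -> f x = g x) -> (forall x, ~ D x -> g x = 0) ->
  \int[mu]_(x in D) f x = \int[mu]_x g x.
Proof.
move=> fg g0; rewrite integral_mkcond; apply: eq_integral => x _.
rewrite patchE; case: ifPn => [/set_mem/fg //|/negP xD].
by rewrite g0// => /mem_set.
Qed.

Lemma ge0_integral_eq0_ae f : measurable_fun setT f -> (forall x, 0 <= f x) ->
  \int[mu]_x f x = 0 -> ae_eq mu setT f (cst 0).
Proof.
move=> mf f0 If; apply/ae_eq_integral_abs => //.
by rewrite -[RHS]If; apply: eq_integral => x _; rewrite gee0_abs.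
Qed.

(** The tangent line of t^r at t = s lies below the graph. The free parameter [s] is optimised only
    after integration. *)
Lemma young_poweR (r s : R) (t : \bar R) : (1 <= r)%R -> (0 < s)%R -> 0 <= t ->
  t <= (s * (1 - r^-1))%:E + (s `^ (1 - r) / r)%:E * t `^ r.
Proof.
move=> r1 s0; have r0 : (0 < r)%R by lra.
case: t => [t||//]; last first.
  by move=> _; rewrite poweRyr ?gt_eqF// gt0_muley ?lte_fin ?divr_gt0 ?powR_gt0//.
rewrite lee_fin => t0; rewrite poweR_EFin -EFinM -EFinD lee_fin.
move: r1; rewrite le_eqVlt => /predU1P[<-|r1].
  by rewrite !(invr1, subrr) powRr0 powRr1// mulr0 add0r mulr1 mul1r.
have [q q0 qE] : exists2 q : R, (0 < q)%R & (r^-1 + q^-1 = 1 :> R)%R.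
  exists ((1 - r^-1)^-1)%R; last by rewrite invrK; lra.
  by rewrite invr_gt0 subr_gt0 invf_lt1.
have := @conjugate_powR R (t / s `^ (1 - r^-1))%R (s `^ (1 - r^-1))%R r q.
have sne : (s `^ (1 - r^-1) != 0)%R by rewrite gt_eqF ?powR_gt0.
rewrite divr_ge0 ?powR_ge0// => /(_ isT isT r0 q0).
rewrite divfK// => /(_ qE) /le_trans; apply.
have -> : (s `^ (1 - r^-1) `^ q = s)%R.
  rewrite -powRrM -[X in ((X - _) * _)%R]qE [(r^-1 + _)%R]addrC addrK mulVf ?powRr1 ?ltW//.
  by rewrite gt_eqF.
have -> : (q^-1 = 1 - r^-1)%R by lra.
rewrite addrC lerD2l powRM ?invr_ge0 ?powR_ge0// -powR_inv1 ?powR_ge0// -!powRrM.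
rewrite (_ : (1 - r^-1) * (-1 * r) = 1 - r)%R; last by field; rewrite gt_eqF.
by rewrite le_eqVlt; apply/orP; left; apply/eqP; ring.
Qed.

(** Integrating [young_poweR] against phi bounds the left integral for every s, and a good s gives
    the claim. The power r - 1 of the mass replaces a normalisation of phi. *)
Lemma jensen_poweR (D : set T) (mD : measurable D) f (phi : T -> R) (r : R) : (1 <= r)%R ->
  measurable_fun D f -> measurable_fun D phi ->
  (forall x, D x -> 0 <= f x) -> (forall x, D x -> 0 <= phi x)%R ->
  \int[mu]_(x in D) (phi x)%:E < +oo ->
  (\int[mu]_(x in D) (f x * (phi x)%:E)) `^ r <=
  (\int[mu]_(x in D) (phi x)%:E) `^ (r - 1) * \int[mu]_(x in D) (f x `^ r * (phi x)%:E).
Proof.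
move=> r1 mf mphi f0 phi0 Mfin; have r0 : (0 < r)%R by lra.
have mphiE : measurable_fun D (EFin \o phi) by exact/measurable_EFinP.
have mfr : measurable_fun D (fun x => f x `^ r).
  exact: (measurableT_comp (measurable_poweR _)).
set I := \int[mu]_(x in D) (f x * (phi x)%:E).
set A := \int[mu]_(x in D) (f x `^ r * (phi x)%:E).
have : 0 <= \int[mu]_(x in D) (phi x)%:E by apply: integral_ge0 => x /phi0; rewrite lee_fin.
move: Mfin; case ME : (\int[mu]_(x in D) (phi x)%:E) => [M||] // _; rewrite lee_fin => M0.
have A0 : 0 <= A by apply: integral_ge0 => x Dx; rewrite mule_ge0 ?poweR_ge0 ?lee_fin ?phi0.
have I0 : 0 <= I by apply: integral_ge0 => x Dx; rewrite mule_ge0 ?f0 ?lee_fin ?phi0.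
have key s : (0 < s)%R -> I <= (s * (1 - r^-1) * M)%:E + (s `^ (1 - r) / r)%:E * A.
  move=> s0; have c0 : (0 <= s * (1 - r^-1))%R.
    by rewrite mulr_ge0 ?subr_ge0 ?invf_le1// ltW.
  have c1 : (0 <= s `^ (1 - r) / r)%R by rewrite divr_ge0 ?powR_ge0 ?ltW.
  have mphir : measurable_fun D (fun x => f x `^ r * (phi x)%:E) by apply: emeasurable_funM.
  have pr0 x : D x -> 0 <= f x `^ r * (phi x)%:E.
    by move=> Dx; rewrite mule_ge0 ?poweR_ge0 ?lee_fin ?phi0.
  have pe0 x : D x -> 0 <= (phi x)%:E by move=> /phi0; rewrite lee_fin.
  rewrite EFinM -ME /A -(ge0_integralZl mu mD mphir pr0); last by rewrite lee_fin.
  rewrite -(ge0_integralZl mu mD mphiE pe0); last by rewrite lee_fin.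
  have e1 x : D x -> 0 <= (s * (1 - r^-1))%:E * (phi x)%:E.
    by move=> /pe0 ?; rewrite mule_ge0 ?lee_fin.
  have e2 x : D x -> 0 <= (s `^ (1 - r) / r)%:E * (f x `^ r * (phi x)%:E).
    by move=> /pr0 ?; rewrite mule_ge0 ?lee_fin.
  have m1 : measurable_fun D (fun x => (s * (1 - r^-1))%:E * (phi x)%:E).
    exact: measurable_funeM.
  have m2 : measurable_fun D (fun x => (s `^ (1 - r) / r)%:E * (f x `^ r * (phi x)%:E)).
    exact: measurable_funeM.
  rewrite -(ge0_integralD mu mD e1 m1 e2 m2).
  apply: ge0_le_integral_nomeas => x Dx; first by rewrite mule_ge0 ?f0 ?lee_fin ?phi0.
  have := young_poweR r1 s0 (f0 _ Dx); move/lee_wpmul2r => /(_ (phi x)%:E).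
  rewrite lee_fin phi0// => /(_ isT) /le_trans; apply.
  by rewrite ge0_muleDl ?lee_fin ?mule_ge0 ?poweR_ge0 ?lee_fin// -muleA.
(* A weight of mass 0 vanishes almost everywhere, which annihilates [I]. *)
have [M_eq0|M_neq0] := eqVneq M 0%R.
  have : \int[mu]_(x in D) `|(EFin \o phi) x| = 0.
    transitivity (\int[mu]_(x in D) (phi x)%:E); last by rewrite ME M_eq0.
    by apply: eq_integral => x /set_mem /phi0 ?; rewrite gee0_abs ?lee_fin.
  move/(ae_eq_integral_abs mu mD mphiE) => phiae.
  have -> : I = 0.
    rewrite -[RHS](integral0 mu D); apply: ge0_ae_eq_integral => //.
    - by apply: emeasurable_funM.
    - by move=> x Dx; rewrite mule_ge0 ?f0 ?lee_fin ?phi0.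
    - by apply: filterS phiae => x /[apply] /= ->; rewrite mule0.
  by rewrite poweR0r ?gt_eqF// mule_ge0 ?poweR_ge0.
have Mgt0 : (0 < M)%R by rewrite lt_neqAle eq_sym M_neq0.
move: A0 key; case: A => [A||] //; last first.
  move=> _ _; rewrite poweR_EFin gt0_muley ?leey//.
  by rewrite lte_fin powR_gt0.
(* For A = 0 the optimal s degenerates to 0; s = e / M with arbitrarily small e takes its place. *)
rewrite lee_fin le_eqVlt => /predU1P[<-|A0] key.
  suff -> : I = 0 by rewrite poweR0r ?gt_eqF// mule0.
  apply/eqP; rewrite eq_le I0 andbT; apply/lee_addgt0Pr => e e0; rewrite add0e.
  have := key (e / M)%R; rewrite divr_gt0// => /(_ isT) /le_trans; apply.
  rewrite mule0 adde0 lee_fin mulrAC divfK// ger_pMr// gerBl invr_ge0 ltW//.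
(* A minimiser of the bound in [key]; the two terms there add up to s M. *)
set s := ((A / M) `^ r^-1)%R.
have s0 : (0 < s)%R by rewrite powR_gt0 ?divr_gt0.
have sr : (s `^ r = A / M)%R.
  by rewrite -powRrM mulVf ?gt_eqF// powRr1 ?divr_ge0 ?ltW.
have IsM : I <= (s * M)%:E.
  apply: le_trans (key _ s0) _; rewrite -EFinM -EFinD lee_fin.
  have -> : (A = s `^ r * M)%R by rewrite sr divfK.
  rewrite (_ : s `^ (1 - r) / r * (s `^ r * M) = s * M / r)%R; first by lra.
  rewrite (_ : _ * _ = s `^ (1 - r) * s `^ r * M / r)%R; last by ring.
  by rewrite -gt0_powRD// subrK powRr1 // ltW.
apply: le_trans (gt0_ler_poweR (ltW r0) _ _ IsM) _.
- by rewrite in_itv /= I0 leey.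
- by rewrite in_itv /= lee_fin leey andbT mulr_ge0 ?ltW.
rewrite !poweR_EFin -EFinM lee_fin powRM ?(ltW s0)// sr gt0_powRD// powRN powRr1//.
by rewrite le_eqVlt; apply/orP; left; apply/eqP; ring.
Qed.

End ge0_integral_tools.

(** * Minkowski's integral inequality *)

Section minkowski_integral.
Context d1 d2 (X : measurableType d1) (Y : measurableType d2) (R : realType).
Variable mu : {sigma_finite_measure set X -> \bar R}.
Variable nu : {sigma_finite_measure set Y -> \bar R}.
Local Open Scope ereal_scope.

(* Jensen's inequality for the measure [phi nu], applied to [F / phi]. *)
Lemma minkowski_integral (F : X * Y -> \bar R) (phi : Y -> \bar R) (r : R) : (1 <= r)%R ->
  measurable_fun setT F -> measurable_fun setT phi ->
  (forall xy, 0 <= F xy) -> (forall y, 0 <= phi y) ->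
  (forall y, \int[mu]_x (F (x, y) `^ r) <= phi y `^ r) ->
  (forall x y, phi y = 0 -> F (x, y) = 0) ->
  \int[mu]_x ((\int[nu]_y F (x, y)) `^ r) <= (\int[nu]_y phi y) `^ r.
Proof.
move=> r1 mF mphi F0 phi0 Fphi phiF; have r0 : (0 < r)%R by lra.
have [->|/eqP My] := pselect (\int[nu]_y phi y = +oo).
  by rewrite poweRyr ?gt_eqF// leey.
have Mlty : \int[nu]_y phi y < +oo by rewrite ltey.
pose ph y := fine (phi y).
have mph : measurable_fun setT ph by exact: measurableT_comp (fine_measurable _) _.
have ph0 y : (0 <= ph y)%R by exact: fine_ge0.
have ph_le y : (ph y)%:E <= phi y.
  by rewrite /ph; have := phi0 y; case: (phi y) => //= *; rewrite leey.
have M0 : 0 <= \int[nu]_y (ph y)%:E by apply: integral_ge0 => y _; rewrite lee_fin.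
have MM : \int[nu]_y (ph y)%:E <= \int[nu]_y phi y.
  by apply: ge0_le_integral_nomeas => y _ //; rewrite lee_fin.
have Mplty := le_lt_trans MM Mlty.
have phiae : {ae nu, forall y, setT y -> phi y \is a fin_num}.
  apply: integrable_ae => //; apply/integrableP; split=> //.
  by under eq_integral do rewrite gee0_abs//.
(* The inverse of 0 is 0, so [f] is F / phi wherever phi is positive and finite. The weight [w] is
   phi^(1-r) there, so that f^r phi = F^r w. *)
pose f x y := F (x, y) * (ph y)^-1%:E.
pose w y := (((ph y)^-1) `^ r * ph y)%R.
have w0 y : (0 <= w y)%R by rewrite mulr_ge0 ?powR_ge0.
have mphV : measurable_fun setT (fun y => (ph y)^-1%R).
  rewrite (_ : (fun _ => _) = fun y => (ph y `^ (-1))%R).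
    exact: measurableT_comp (measurable_powR _) _.
  by apply/funext => y; rewrite powR_inv1.
have mw : measurable_fun setT w.
  by apply: measurable_funM => //; exact: measurableT_comp (measurable_powR _) _.
have mFx x : measurable_fun setT (fun y => F (x, y)) by exact: measurable_fun_pair2.
have mf x : measurable_fun setT (f x).
  by apply: emeasurable_funM => //; exact/measurable_EFinP.
have IF x : \int[nu]_y F (x, y) = \int[nu]_y (f x y * (ph y)%:E).
  apply: ge0_ae_eq_integral => //.
  - by apply: emeasurable_funM => //; exact/measurable_EFinP.
  - by move=> y _; rewrite !mule_ge0// lee_fin ?invr_ge0.
  - apply: filterS phiae => y /(_ Logic.I) phify _.
    rewrite /f -muleA -EFinM; have [ph_eq0|ph_neq0] := eqVneq (ph y) 0%R.
      by rewrite ph_eq0 mulr0 mule0 phiF// -(fineK phify) -/(ph y) ph_eq0.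
    by rewrite mulVf// mule1.
have frE x y : f x y `^ r * (ph y)%:E = F (x, y) `^ r * (w y)%:E.
  by rewrite /f poweRM ?lee_fin ?invr_ge0// poweR_EFin -muleA -EFinM.
pose G xy := F xy `^ r * (w xy.2)%:E.
have mG : measurable_fun setT G.
  apply: emeasurable_funM; first exact: measurableT_comp (measurable_poweR _) _.
  by apply/measurable_EFinP; exact: measurableT_comp.
have G0 xy : 0 <= G xy by rewrite mule_ge0 ?poweR_ge0// lee_fin.
have step1 : \int[mu]_x ((\int[nu]_y F (x, y)) `^ r) <=
    \int[mu]_x ((\int[nu]_y (ph y)%:E) `^ (r - 1) * \int[nu]_y G (x, y)).
  apply: ge0_le_integral_nomeas => x _; first exact: poweR_ge0.
  rewrite IF; apply: le_trans (jensen_poweR _ r1 _ _ _ _ _) _ => //.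
    by move=> y _; rewrite /f mule_ge0// lee_fin invr_ge0.
  rewrite le_eqVlt; apply/orP; left; apply/eqP; congr (_ * _).
  by apply: eq_integral => y _; rewrite frE.
apply: le_trans step1 _; rewrite ge0_integralZl ?poweR_ge0//; last 2 first.
- exact: measurable_fun_fubini_tonelli_F.
- by move=> x _; exact: integral_ge0.
(* After Tonelli the inner integral of F^r is at most phi^r, and w phi^r = phi. *)
have step2 : \int[mu]_x \int[nu]_y G (x, y) <= \int[nu]_y (ph y)%:E.
  rewrite fubini_tonelli//; apply: ge0_le_integral_nomeas => y _; first exact: integral_ge0.
  rewrite /G /= ge0_integralZr//; last 3 first.
  - apply: measurableT_comp (measurable_poweR _) _.
    exact: measurable_fun_pair1.
  - by move=> x _; exact: poweR_ge0.
  - by rewrite lee_fin.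
  apply: le_trans (lee_wpmul2r _ (Fphi y)) _; first by rewrite lee_fin.
  have [ph_eq0|ph_neq0] := eqVneq (ph y) 0%R; first by rewrite /w ph_eq0 mulr0 mule0.
  have -> : phi y = (ph y)%:E.
    by move: ph_neq0; rewrite /ph; case: (phi y) => //=; rewrite eqxx.
  rewrite poweR_EFin -EFinM lee_fin /w mulrA -powRM ?invr_ge0//.
  by rewrite divff// powR1 mul1r.
apply: le_trans (lee_wpmul2l (poweR_ge0 _ _) step2) _.
move: M0 MM Mplty; case: (\int[nu]_y (ph y)%:E) => [m||] //; rewrite lee_fin => m0 mM _.
apply: (@le_trans _ _ (m%:E `^ r)).
  rewrite !poweR_EFin -EFinM lee_fin; have [->|m_neq0] := eqVneq m 0%R.
    by rewrite mulr0 powR_ge0.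
  by rewrite mulrC mulr_powRB1.
apply: gt0_ler_poweR => //; rewrite ?ltW// in_itv/= ?lee_fin ?m0 ?leey// andbT.
exact: le_trans mM.
Qed.

End minkowski_integral.

(** * Affine changes of variable on the line *)

Section affine_change_of_variable.
Context (R : realType).
Local Notation leb := (@lebesgue_measure R).
Local Open Scope ereal_scope.
Implicit Types f : R -> \bar R.

Lemma measurable_affine (a b : R) : measurable_fun setT (fun x : R => a * x + b)%R.
Proof. by apply: measurable_funD => //; exact: measurable_funM. Qed.

(** Lebesgue measure is determined by its values on half-open intervals, and there a times the
    push-forward agrees with it. *)
Lemma lebesgue_measure_affine (a b : R) (A : set R) : (0 < a)%R -> measurable A ->
  leb A = a%:E * leb ((fun x => a * x + b)%R @^-1` A).
Proof.
move=> a0 mA.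
pose phi : R -> measurableTypeR R := fun x => (a * x + b)%R.
have mphi : measurable_fun setT (phi : measurableTypeR R -> measurableTypeR R).
  exact: measurable_affine.
pose m : {measure set (measurableTypeR R) -> \bar R} :=
  mscale (NngNum (ltW a0)) (pushforward leb (phi : measurableTypeR R -> measurableTypeR R)).
rewrite (@lebesgue_measure_unique R (m mphi) _ A)//.
move=> _ [[c e] _ <-] /=; rewrite /m /mscale /= /pushforward /=.
have -> : phi @^-1` `]c, e] = `]((c - b) / a)%R, ((e - b) / a)%R]%classic.
  apply/seteqP; split => x /=; rewrite !in_itv /= /phi ltr_pdivrMr// ler_pdivlMr// => /andP[h1 h2];
  by apply/andP; split; rewrite mulrC; lra.
rewrite !lebesgue_measure_itv /= !lte_fin ltr_pM2r ?invr_gt0// ltrD2r.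
case: ifPn => _; last by rewrite mule0.
by rewrite -!EFinD -EFinM; congr EFin; field; rewrite gt_eqF.
Qed.

Lemma ge0_integral_affine f (a b : R) : (0 < a)%R ->
  measurable_fun setT f -> (forall x, 0 <= f x) ->
  \int[leb]_x f x = a%:E * \int[leb]_x f (a * x + b)%R.
Proof.
move=> a0 mf f0.
pose phi : R -> measurableTypeR R := fun x => (a * x + b)%R.
have mphi : measurable_fun setT (phi : measurableTypeR R -> measurableTypeR R).
  exact: measurable_affine.
pose m : {measure set (measurableTypeR R) -> \bar R} :=
  mscale (NngNum (ltW a0)) (pushforward leb (phi : measurableTypeR R -> measurableTypeR R)).
transitivity (\int[m mphi]_x f x).
  apply: eq_measure_integral => A mA _; exact: (lebesgue_measure_affine b a0 mA).
rewrite /m ge0_integral_mscale//=; congr (_ * _).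
by rewrite (ge0_integral_pushforward mphi)// preimage_setT.
Qed.

Lemma ge0_integral_translate f (b : R) :
  measurable_fun setT f -> (forall x, 0 <= f x) ->
  \int[leb]_x f (x + b)%R = \int[leb]_x f x.
Proof.
move=> mf f0; rewrite [RHS](@ge0_integral_affine f 1 b)// mul1e.
by apply: eq_integral => x _; rewrite mul1r.
Qed.

Lemma ge0_integral_scale f (a : R) : (0 < a)%R ->
  measurable_fun setT f -> (forall x, 0 <= f x) ->
  \int[leb]_x f x = a%:E * \int[leb]_x f (a * x)%R.
Proof.
move=> a0 mf f0; rewrite (ge0_integral_affine 0 a0)//; congr (_ * _).
by apply: eq_integral => x _; rewrite addr0.
Qed.

Lemma ge0_integral_opp f :
  measurable_fun setT f -> (forall x, 0 <= f x) ->
  \int[leb]_x f (- x)%R = \int[leb]_x f x.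
Proof.
move=> mf f0; transitivity (\int[pushforward leb (-%R : measurableTypeR R -> measurableTypeR R)]_x f x).
  by rewrite ge0_integral_pushforward// preimage_setT.
by apply: eq_measure_integral => A mA _; exact: lebesgue_measureN.
Qed.

End affine_change_of_variable.

(** * Integrals of powers over dyadic ranges *)

Section power_integrals.
Context (R : realType).
Local Notation leb := (@lebesgue_measure R).
Implicit Types t e r : R.

(** Extending powers by 0 to r <= 0 turns integrals over T_B into integrals over the whole space,
    and keeps the addition of exponents valid for every r. *)
Definition ppow t r : R := if 0 < r then r `^ t else 0.

Lemma ppow_ge0 t r : 0 <= ppow t r.
Proof. by rewrite /ppow; case: ifP => // _; exact: powR_ge0. Qed.

Lemma ppowE t r : 0 < r -> ppow t r = r `^ t.
Proof. by rewrite /ppow => ->. Qed.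

Lemma ppow_le0 t r : r <= 0 -> ppow t r = 0.
Proof. by rewrite /ppow leNgt => /negbTE ->. Qed.

Lemma measurable_ppow t : measurable_fun setT (ppow t).
Proof.
rewrite (_ : ppow t = fun r => r `^ t * \1_(`]0, +oo[%classic : set R) r).
  apply: measurable_funM; [exact: measurable_powR|exact: measurable_indic].
apply/funext => r; rewrite /ppow indicE mem_setE /= in_itv /= andbT.
by case: ifP; rewrite ?mulr1 ?mulr0.
Qed.

Lemma ppowM t (a r : R) : 0 < a -> ppow t (a * r) = a `^ t * ppow t r.
Proof.
move=> a0; rewrite /ppow pmulr_rgt0//; case: ifP => r0; last by rewrite mulr0.
by rewrite powRM// ltW.
Qed.

Lemma ppowD t t' r : ppow t r * ppow t' r = ppow (t + t') r.
Proof. by rewrite /ppow; case: ifP => r0; rewrite ?mulr0// gt0_powRD. Qed.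

Lemma ppow_powR t e r : e != 0 -> ppow t r `^ e = ppow (t * e) r.
Proof.
by move=> e0; rewrite /ppow; case: ifP => r0; rewrite ?powR0// powRrM.
Qed.

(** A power is monotone, in a direction depending on the sign of e; the sum of the two endpoint
    values covers both cases. *)
Lemma powR_le_between e (a x b : R) : 0 < a -> a <= x -> x <= b -> x `^ e <= a `^ e + b `^ e.
Proof.
move=> a0 ax xb; have x0 : 0 < x by exact: lt_le_trans ax.
have b0 : 0 < b by exact: lt_le_trans xb.
have [e0|e0] := leP 0 e.
  apply: (@le_trans _ _ (b `^ e)); last by rewrite lerDr powR_ge0.
  by apply: ge0_ler_powR => //; rewrite nnegrE ltW.
apply: (@le_trans _ _ (a `^ e)); last by rewrite lerDl powR_ge0.
rewrite -[e]opprK !(powRN _ (- e)) lef_pV2 ?posrE ?powR_gt0//.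
by apply: ge0_ler_powR => //; rewrite ?oppr_ge0 ?nnegrE ltW.
Qed.

Lemma powR_ge_between e (a x b : R) : 0 < a -> a <= x -> x <= b ->
  (a `^ (- e) + b `^ (- e))^-1 <= x `^ e.
Proof.
move=> a0 ax xb; have x0 : 0 < x by exact: lt_le_trans ax.
rewrite -[e in leRHS]opprK (powRN _ (- e)) lef_pV2 ?posrE ?powR_gt0//; last first.
  by rewrite addr_gt0// powR_gt0// (lt_le_trans x0).
exact: powR_le_between.
Qed.

Local Open Scope ereal_scope.

Definition pint t (a b : R) := \int[leb]_(r in `]a, b]) (ppow t r)%:E.

Lemma measurable_ppowE t (D : set R) : measurable_fun D (fun r => (ppow t r)%:E).
Proof. by apply/measurable_EFinP; exact: measurable_funTS (measurable_ppow t). Qed.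

Lemma pint_scale t (c a b : R) : (0 < c)%R ->
  pint t (c * a) (c * b) = (c `^ (t + 1))%:E * pint t a b.
Proof.
move=> c0; pose g a' b' := (fun r : R => (ppow t r)%:E) \_ `]a', b']%classic.
have gE a' b' : pint t a' b' = \int[leb]_r g a' b' r by exact: integral_mkcond.
have mg a' b' : measurable_fun setT (g a' b').
  by apply/(measurable_restrictT _ _).1 => //; exact: measurable_ppowE.
have g0 a' b' r : 0 <= g a' b' r.
  by rewrite /g patchE; case: ifP; rewrite ?lee_fin ?ppow_ge0.
rewrite !gE (@ge0_integral_scale R (g (c * a)%R (c * b)%R) c c0 (mg _ _) (g0 _ _)).
have -> : (c `^ (t + 1) = c * c `^ t)%R by rewrite (addrC t) gt0_powRD// powRr1// ltW.
rewrite EFinM -muleA; congr (_ * _).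
transitivity (\int[leb]_r ((c `^ t)%:E * g a b r)); last first.
  by apply: ge0_integralZl; [exact: measurableT|exact: mg|move=> r _; exact: g0|rewrite lee_fin powR_ge0].
apply: eq_integral => r _; rewrite /g !patchE !mem_setE /= !in_itv /= ltr_pM2l// ler_pM2l//.
by case: ifP => _; rewrite ?mule0// ppowM// EFinM.
Qed.

Lemma pint_split t (a b c : R) : (a <= b)%R -> (b <= c)%R ->
  pint t a c = pint t a b + pint t b c.
Proof.
move=> ab bc; rewrite /pint -ge0_integral_setU//.
- congr integral; apply/seteqP; split => x /=; rewrite !in_itv /=.
    by move=> /andP[ax xc]; have [xb|bx] := leP x b; [left|right]; rewrite ?ax ?xb ?bx ?xc.
  move=> [/andP[ax xb]|/andP[bx xc]]; first by rewrite ax (le_trans xb).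
  by rewrite xc (le_lt_trans ab).
- exact: measurable_ppowE.
- by move=> x _; rewrite lee_fin ppow_ge0.
- rewrite disj_set2E; apply/eqP/seteqP; split => x //= [].
  by rewrite !in_itv /= => /andP[_ xb] /andP[bx _]; lra.
Qed.

Lemma pint_lty t (a b : R) : (0 < a)%R -> (a <= b)%R -> pint t a b < +oo.
Proof.
move=> a0 ab; apply: (@le_lt_trans _ _ (\int[leb]_(r in `]a, b]) (a `^ t + b `^ t)%:E)).
  apply: ge0_le_integral_nomeas => r; first by rewrite lee_fin ppow_ge0.
  rewrite /= in_itv /= => /andP[ar rb]; rewrite lee_fin ppowE ?(lt_trans a0)//.
  by apply: powR_le_between => //; exact: ltW.
rewrite integral_cst//= lebesgue_measure_itv /=; case: ifP => _; last by rewrite mule0 ltry.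
by rewrite -EFinD -EFinM ltry.
Qed.

Lemma pint_gt0 t (a b : R) : (0 < a)%R -> (a < b)%R -> 0 < pint t a b.
Proof.
move=> a0 ab; have b0 : (0 < b)%R by lra.
apply: (@lt_le_trans _ _ (\int[leb]_(r in `]a, b]) ((a `^ (- t) + b `^ (- t))^-1)%:E)).
  rewrite integral_cst//= lebesgue_measure_itv /= lte_fin ab -EFinD -EFinM lte_fin.
  by rewrite mulr_gt0 ?subr_gt0// invr_gt0 addr_gt0 ?powR_gt0.
apply: ge0_le_integral_nomeas => r.
  by rewrite lee_fin invr_ge0 addr_ge0 ?powR_ge0.
rewrite /= in_itv /= => /andP[ar rb]; rewrite lee_fin ppowE ?(lt_trans a0)//.
by apply: powR_ge_between => //; exact: ltW.
Qed.

Lemma ereal_eqy_of_nat (c : R) (x : \bar R) : (0 < c)%R ->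
  (forall k : nat, (k%:R * c)%:E <= x) -> x = +oo.
Proof.
move=> c0 kx; apply/eqyP => A A0; apply: le_trans (kx (Num.bound (A / c))).
by rewrite lee_fin -ler_pdivrMr// ltW// archi_boundP// divr_ge0// ltW.
Qed.

Section affine_recursion.
Variables (u : nat -> \bar R) (c q : R).
Hypotheses (c0 : (0 < c)%R) (q0 : (0 < q)%R).
Hypothesis u0 : u 0%N = 0.
Hypothesis uS : forall k, u k.+1 = c%:E + q%:E * u k.

(** Splitting off one dyadic layer and rescaling the rest makes the power integrals satisfy this
    recursion, with q = 2^(t+1) towards infinity and q = 2^(-(t+1)) towards 0. Boundedness is thus
    decided by q < 1, without an antiderivative; q = 1 is the critical exponent t = -1. *)
Lemma affine_rec_le k : (q < 1)%R -> u k <= (c / (1 - q))%:E.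
Proof.
move=> q1; elim: k => [|k IH]; first by rewrite u0 lee_fin divr_ge0 ?subr_ge0// ltW.
rewrite uS; have := leeD2l c%:E (lee_wpmul2l (ltW q0 : 0 <= q%:E) IH).
move=> /le_trans; apply.
by rewrite -EFinM -EFinD lee_fin le_eqVlt; apply/orP; left; apply/eqP; field; lra.
Qed.

Lemma affine_rec_ge k : (1 <= q)%R -> (k%:R * c)%:E <= u k.
Proof.
move=> q1; elim: k => [|k IH]; first by rewrite u0 mul0r.
rewrite uS; have := leeD2l c%:E (lee_wpmul2l (ltW q0 : 0 <= q%:E) IH).
apply: le_trans.
rewrite -EFinM -EFinD lee_fin -natr1 mulrDl mul1r addrC lerD2l.
by rewrite ler_peMl// mulr_ge0// ltW.
Qed.

Lemma affine_rec_eq k : q = 1%R -> u k = (k%:R * c)%:E.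
Proof.
move=> q1; elim: k => [|k IH]; first by rewrite u0 mul0r.
by rewrite uS IH q1 mul1e -EFinD -natr1 mulrDl mul1r addrC.
Qed.

End affine_recursion.

Let half_gt0 : (0 < 2^-1 :> R)%R. Proof. by rewrite invr_gt0. Qed.
Let half_lt1 : (2^-1 < 1 :> R)%R. Proof. by rewrite invf_lt1// ltr1n. Qed.

Lemma powR2_lt1 t : (t < 0)%R -> (2 `^ t < 1 :> R)%R.
Proof.
have l2 : (0 < ln 2 :> R)%R by rewrite ln_gt0// ltr1n.
by move=> t0; rewrite /powR gt_eqF//= expR_lt1 pmulr_llt0.
Qed.

Lemma powR2_ge1 t : (0 <= t)%R -> (1 <= 2 `^ t :> R)%R.
Proof. by move=> t0; rewrite -[leLHS](powRr0 2) ler_powR// ler1n. Qed.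

Lemma pint_fine t (a b : R) : (0 < a)%R -> (a < b)%R ->
  exists2 c, (0 < c)%R & pint t a b = c%:E.
Proof.
move=> a0 ab; have := pint_gt0 t a0 ab; have := pint_lty t a0 (ltW ab).
by case: (pint t a b) => [c||] // _; rewrite lte_fin => c0; exists c.
Qed.

Lemma pint_empty t (a : R) : pint t a a = 0.
Proof. by rewrite /pint set_itv_ge ?integral_set0//= bnd_simp ltxx. Qed.

Lemma pint_upS t k :
  pint t 1 (2 ^+ k.+1) = pint t 1 2 + (2 `^ (t + 1))%:E * pint t 1 (2 ^+ k).
Proof.
rewrite (@pint_split t 1 2)//; last 2 first.
- by rewrite ler1n.
- by rewrite exprS ler_peMr// exprn_ege1// ler1n.
by rewrite -pint_scale// mulr1 exprS.
Qed.

Lemma pint_downS t k : pint t (2 ^- k.+1) 1 =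
  pint t 2^-1 1 + ((2^-1) `^ (t + 1))%:E * pint t (2 ^- k) 1.
Proof.
rewrite (@pint_split t _ 2^-1)//; last 2 first.
- by rewrite exprS invfM ler_piMr// invf_le1 ?exprn_gt0// exprn_ege1// ler1n.
- by rewrite invf_le1// ler1n.
by rewrite -pint_scale ?invr_gt0// mulr1 -invfM -exprS addeC.
Qed.

Definition pinty t := \int[leb]_(r in `]1%R, +oo[) (ppow t r)%:E.

Lemma half_powR t : ((2^-1 : R) `^ t = (2 `^ t)^-1)%R.
Proof. by rewrite -powR_inv1// -powRrM mulN1r powRN. Qed.

Lemma pint_up_pinty t k : pint t 1 (2 ^+ k) <= pinty t.
Proof.
apply: ge0_subset_integral => //=; first exact: measurable_ppowE.
- by move=> r _; rewrite lee_fin ppow_ge0.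
- by move=> r /=; rewrite !in_itv /= => /andP[-> _].
Qed.

Lemma pint_down_pint0 t k : pint t (2 ^- k) 1 <= pint t 0 1.
Proof.
apply: ge0_subset_integral => //=; first exact: measurable_ppowE.
- by move=> r _; rewrite lee_fin ppow_ge0.
- move=> r /=; rewrite !in_itv /= => /andP[kr ->]; rewrite andbT.
  by rewrite (lt_trans _ kr)// invr_gt0 exprn_gt0.
Qed.

Lemma pinty_eqy t : (-1 <= t)%R -> pinty t = +oo.
Proof.
move=> t1; have [c c0 cE] := pint_fine t ltr01 (ltr1n R 2).
apply: (ereal_eqy_of_nat c0) => k; apply: le_trans (pint_up_pinty t k).
apply: (@affine_rec_ge (fun k => pint t 1 (2 ^+ k)) c (2 `^ (t + 1))) => //.
- by rewrite expr0 pint_empty.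
- by move=> i; rewrite pint_upS cE.
- by apply: powR2_ge1; lra.
Qed.

Lemma pint0_eqy t : (t <= -1)%R -> pint t 0 1 = +oo.
Proof.
move=> t1; have [c c0 cE] := @pint_fine t 2^-1 1 half_gt0 half_lt1.
apply: (ereal_eqy_of_nat c0) => k; apply: le_trans (pint_down_pint0 t k).
apply: (@affine_rec_ge (fun k => pint t (2 ^- k) 1) c (2^-1 `^ (t + 1))) => //.
- by rewrite expr0 invr1 pint_empty.
- by move=> i; rewrite pint_downS cE.
- by rewrite half_powR -powRN; apply: powR2_ge1; lra.
Qed.

(** Monotone convergence along the intervals ]1, 2^k], with the geometric bound of
    [affine_rec_le]. *)
Lemma pinty_lty t : (t < -1)%R -> pinty t < +oo.
Proof.
move=> t1; have [c c0 cE] := pint_fine t ltr01 (ltr1n R 2).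
have q1 : (2 `^ (t + 1) < 1 :> R)%R.
  by apply: powR2_lt1; lra.
apply: (@le_lt_trans _ _ (c / (1 - 2 `^ (t + 1)))%:E); last exact: ltry.
pose F : (set (measurableTypeR R))^nat := fun k => `]1%R, (2 ^+ k : R)%R]%classic.
have nd : nondecreasing_seq F.
  move=> i j ij; apply/subsetPset => r; rewrite /F /= !in_itv /= => /andP[-> ri].
  by rewrite (le_trans ri)// ler_weXn2l// ler1n.
have mFp i : measurable_fun (F i) (fun r : R => (ppow t r)%:E) by exact: measurable_ppowE.
have Fp0 i x : F i x -> 0 <= (ppow t x)%:E by move=> _; rewrite lee_fin ppow_ge0.
have mF i : measurable (F i) by exact: measurable_itv.
have := ge0_nondecreasing_set_cvg_integral (mu := leb) nd mF mFp Fp0.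
rewrite (_ : \bigcup_i _ = `]1%R, +oo[%classic); last first.
  apply/seteqP; split => r /=; first by move=> [k _]; rewrite /F /= !in_itv /= => /andP[->].
  rewrite in_itv /= andbT => r1; exists (Num.bound r) => //; rewrite /F /= in_itv /= r1 /=.
  have : (r <= (Num.bound r)%:R)%R by rewrite ltW// archi_boundP//; lra.
  by move=> /le_trans; apply; rewrite -natrX ler_nat ltnW// ltn_expl.
move=> cvgF; rewrite /pinty -(cvg_lim _ cvgF)//.
apply: lime_le; first by apply/cvg_ex; eexists; exact: cvgF.
apply: nearW => k; apply: (@affine_rec_le (fun k => pint t 1 (2 ^+ k)) c) => //.
- by rewrite expr0 pint_empty.
- by move=> i; rewrite pint_upS cE.
Qed.

Lemma pint0_lty t : (-1 < t)%R -> pint t 0 1 < +oo.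
Proof.
move=> t1; have [c c0 cE] := @pint_fine t 2^-1 1 half_gt0 half_lt1.
have q1 : (2^-1 `^ (t + 1) < 1 :> R)%R.
  rewrite half_powR -powRN.
  by apply: powR2_lt1; lra.
apply: (@le_lt_trans _ _ (c / (1 - 2^-1 `^ (t + 1)))%:E); last exact: ltry.
pose F : (set (measurableTypeR R))^nat := fun k => `](2 ^- k : R)%R, 1%R]%classic.
have nd : nondecreasing_seq F.
  move=> i j ij; apply/subsetPset => r; rewrite /F /= !in_itv /= => /andP[ri ->].
  by rewrite (le_lt_trans _ ri)// lef_pV2 ?posrE ?exprn_gt0// ler_weXn2l// ler1n.
have mFp i : measurable_fun (F i) (fun r : R => (ppow t r)%:E) by exact: measurable_ppowE.
have Fp0 i x : F i x -> 0 <= (ppow t x)%:E by move=> _; rewrite lee_fin ppow_ge0.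
have mF i : measurable (F i) by exact: measurable_itv.
have := ge0_nondecreasing_set_cvg_integral (mu := leb) nd mF mFp Fp0.
rewrite (_ : \bigcup_i _ = `]0%R, 1%R]%classic); last first.
  apply/seteqP; split => r /=.
    move=> [k _]; rewrite /F /= !in_itv /= => /andP[kr ->]; rewrite andbT.
    by rewrite (lt_trans _ kr)// invr_gt0 exprn_gt0.
  rewrite in_itv /= => /andP[r0 r1]; exists (Num.bound r^-1) => //; rewrite /F /= in_itv /= r1 andbT.
  rewrite -[ltRHS]invrK ltf_pV2 ?posrE ?exprn_gt0 ?invr_gt0//.
  have : (r^-1 <= (Num.bound r^-1)%:R)%R by rewrite ltW// archi_boundP// invr_ge0 ltW.
  by move=> /le_lt_trans; apply; rewrite -natrX ltr_nat ltn_expl.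
move=> cvgF; rewrite /pint -(cvg_lim _ cvgF)//.
apply: lime_le; first by apply/cvg_ex; eexists; exact: cvgF.
apply: nearW => k; apply: (@affine_rec_le (fun k => pint t (2 ^- k) 1) c) => //.
- by rewrite expr0 invr1 pint_empty.
- by move=> i; rewrite pint_downS cE.
Qed.

End power_integrals.

(** * One-dimensional model kernels *)

Section one_dimensional_kernels.
Context (R : realType).
Local Notation leb := (@lebesgue_measure R).
Implicit Types t e r : R.
Local Open Scope ereal_scope.

(** [kap2] and [kap3] are Beta integrals up to normalisation. Only their sign and their range of
    finiteness matter, so no closed form is derived. *)
Definition kap2 e := \int[leb]_s ((1 + s ^+ 2) `^ e)%:E.
Definition kap3 t e := \int[leb]_r (ppow t r * (1 + 2 * r) `^ e)%:E.

Lemma measurable_kap2 (B x e : R) :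
  measurable_fun setT (fun s : R => ((B + (x - s) ^+ 2) `^ e)%:E).
Proof.
apply/measurable_EFinP; apply: measurableT_comp (measurable_powR e) _.
by apply: measurable_funD => //; apply: measurable_funX; exact: measurable_funB.
Qed.

Lemma measurable_kap3 (A t e : R) :
  measurable_fun setT (fun r : R => (ppow t r * (A + 2 * r) `^ e)%:E).
Proof.
apply/measurable_EFinP; apply: measurable_funM; first exact: measurable_ppow.
apply: measurableT_comp (measurable_powR e) _.
by apply: measurable_funD => //; exact: measurable_funM.
Qed.

Lemma kap2E e (B x : R) : (0 < B)%R ->
  \int[leb]_s ((B + (x - s) ^+ 2) `^ e)%:E = (B `^ (e + 2^-1))%:E * kap2 e.
Proof.
move=> B0; have sB : (0 < Num.sqrt B)%R by rewrite sqrtr_gt0.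
rewrite (ge0_integral_affine x sB (measurable_kap2 B x e)); last first.
  by move=> s; rewrite lee_fin powR_ge0.
have -> : (B `^ (e + 2^-1) = Num.sqrt B * B `^ e)%R.
  by rewrite addrC gt0_powRD// powR12_sqrt// ltW.
rewrite EFinM -muleA; congr (_ * _).
rewrite /kap2 -ge0_integralZl//; last 3 first.
- have := measurable_kap2 1 0 e; congr measurable_fun; apply/funext => s.
  by rewrite sub0r sqrrN.
- by move=> s _; rewrite lee_fin powR_ge0.
- by rewrite lee_fin powR_ge0.
apply: eq_integral => s _; rewrite -EFinM; congr EFin; rewrite -powRM ?(ltW B0)//; last first.
  by rewrite addr_ge0// sqr_ge0.
congr (_ `^ e)%R; rewrite (_ : x - _ = - (Num.sqrt B * s))%R; last by ring.
by rewrite sqrrN exprMn sqr_sqrtr ?ltW//; ring.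
Qed.

(** This is the integral over the last real coordinate: it enters only the imaginary part, with
    slope 2. Hence the base B^2 instead of B, and the Jacobian 1/2. *)
Lemma kap1E e (B c : R) : (0 < B)%R ->
  \int[leb]_s ((B ^+ 2 + (c + 2 * s) ^+ 2) `^ e)%:E =
  (B `^ (2 * e + 1))%:E * ((2^-1)%:E * kap2 e).
Proof.
move=> B0; have B20 : (0 < B ^+ 2)%R by rewrite exprn_gt0.
pose f s : \bar R := ((B ^+ 2 + (0 - s) ^+ 2) `^ e)%:E.
have := kap2E e 0 B20; rewrite -/f => kE.
have := @ge0_integral_affine R f 2 c (ltr0Sn _ _) (measurable_kap2 _ _ _).
rewrite kE => fE.
transitivity ((2^-1)%:E * ((B ^+ 2) `^ (e + 2^-1))%:E * kap2 e); last first.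
  have -> : ((B ^+ 2) `^ (e + 2^-1) = B `^ (2 * e + 1))%R.
    by rewrite -powR_mulrn ?(ltW B0)// -powRrM; congr (_ `^ _)%R; field.
  by rewrite -muleA muleCA.
rewrite -muleA fE; last by move=> s; rewrite lee_fin powR_ge0.
rewrite muleA -EFinM mulVf; last by [].
rewrite mul1e; apply: eq_integral => s _.
by rewrite /f sub0r sqrrN (addrC c).
Qed.

Lemma kap3E t e (A D : R) : (0 < A)%R ->
  \int[leb]_s (ppow t (s - D) * (A + 2 * (s - D)) `^ e)%:E =
  (A `^ (t + e + 1))%:E * kap3 t e.
Proof.
move=> A0; pose f r := (ppow t r * (A + 2 * r) `^ e)%:E.
have f0 r : 0 <= f r by rewrite lee_fin mulr_ge0 ?powR_ge0 ?ppow_ge0.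
rewrite (@ge0_integral_translate R f (- D) (measurable_kap3 _ _ _) f0).
rewrite (ge0_integral_scale A0 (measurable_kap3 _ _ _) f0).
have -> : (A `^ (t + e + 1) = A * A `^ (t + e))%R.
  by rewrite (addrC (t + e)%R) [in LHS]gt0_powRD// powRr1// ltW.
rewrite EFinM -muleA; congr (_ * _).
rewrite /kap3 -ge0_integralZl//; last 3 first.
- exact: measurable_kap3.
- by move=> s _; rewrite lee_fin mulr_ge0 ?powR_ge0 ?ppow_ge0.
- by rewrite lee_fin powR_ge0.
apply: eq_integral => s _; rewrite /f -EFinM; congr EFin; rewrite ppowM//.
have [s0|s0] := leP s 0%R; first by rewrite ppow_le0//; ring.
rewrite (_ : A + _ = A * (1 + 2 * s))%R; last by ring.
rewrite powRM ?(ltW A0)//; last by lra.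
by rewrite gt0_powRD//; ring.
Qed.

Lemma ge0_integral_ge_on (C : R) (D : set R) (f g : R -> \bar R) : (0 <= C)%R ->
  measurable D -> measurable_fun setT g -> (forall r, 0 <= f r) -> (forall r, 0 <= g r) ->
  (forall r, D r -> C%:E * g r <= f r) ->
  C%:E * \int[leb]_(r in D) g r <= \int[leb]_r f r.
Proof.
move=> C0 mD mg f0 g0 gf; rewrite -ge0_integralZl//; last exact: measurable_funTS.
rewrite integral_mkcond; apply: ge0_le_integral_nomeas => r _; rewrite patchE; case: ifPn => //.
  by rewrite mule_ge0.
by move=> /set_mem; exact: gf.
Qed.

(** For r > 1 the quotient (1 + r^2) / r^2 stays in [1, 2], so its powers are bounded below for
    either sign of e. Such lower bounds give positivity and divergence at the same time. *)
Lemma kap2_ge e : exists2 C : R, (0 < C)%R & C%:E * pinty (2 * e) <= kap2 e.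
Proof.
exists (1 `^ (- e) + 2 `^ (- e))^-1%R; first by rewrite invr_gt0 addr_gt0 ?powR_gt0.
apply: ge0_integral_ge_on => //.
- exact: measurable_ppowE.
- by move=> r; rewrite lee_fin powR_ge0.
- by move=> r; rewrite lee_fin ppow_ge0.
move=> r; rewrite /= in_itv /= andbT => r1; have r0 : (0 < r)%R by lra.
rewrite -EFinM lee_fin ppowE// powRrM powR_mulrn ?(ltW r0)//.
rewrite (_ : 1 + r ^+ 2 = ((1 + r ^+ 2) / r ^+ 2) * r ^+ 2)%R; last by field; rewrite gt_eqF.
rewrite powRM ?divr_ge0 ?addr_ge0 ?sqr_ge0// ler_wpM2r ?powR_ge0//.
apply: powR_ge_between => //; first by rewrite ler_pdivlMr ?exprn_gt0//; lra.
by rewrite ler_pdivrMr ?exprn_gt0//; nra.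
Qed.

Lemma kap3_gey t e : exists2 C : R, (0 < C)%R & C%:E * pinty (t + e) <= kap3 t e.
Proof.
exists (2 `^ (- e) + 3 `^ (- e))^-1%R; first by rewrite invr_gt0 addr_gt0 ?powR_gt0.
apply: ge0_integral_ge_on => //.
- exact: measurable_ppowE.
- by move=> r; rewrite lee_fin mulr_ge0 ?ppow_ge0 ?powR_ge0.
- by move=> r; rewrite lee_fin ppow_ge0.
move=> r; rewrite /= in_itv /= andbT => r1; have r0 : (0 < r)%R by lra.
rewrite -EFinM lee_fin -ppowD mulrCA ler_wpM2l ?ppow_ge0// ppowE//.
rewrite (_ : 1 + 2 * r = ((1 + 2 * r) / r) * r)%R; last by field; rewrite gt_eqF.
rewrite powRM ?divr_ge0 ?(ltW r0)//; last by lra.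
rewrite ler_wpM2r ?powR_ge0//.
apply: powR_ge_between => //; first by rewrite ler_pdivlMr//; lra.
by rewrite ler_pdivrMr//; lra.
Qed.

Lemma kap3_ge0 t e : exists2 C : R, (0 < C)%R & C%:E * pint t 0 1 <= kap3 t e.
Proof.
exists (1 `^ (- e) + 3 `^ (- e))^-1%R; first by rewrite invr_gt0 addr_gt0 ?powR_gt0.
apply: ge0_integral_ge_on => //.
- exact: measurable_ppowE.
- by move=> r; rewrite lee_fin mulr_ge0 ?ppow_ge0 ?powR_ge0.
- by move=> r; rewrite lee_fin ppow_ge0.
move=> r; rewrite /= in_itv /= => /andP[r0 r1].
rewrite -EFinM lee_fin mulrC ler_wpM2l ?ppow_ge0//.
by apply: powR_ge_between => //; lra.
Qed.

Lemma pinty_gt0 t : 0 < pinty t.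
Proof.
apply: lt_le_trans (pint_up_pinty t 1); rewrite expr1.
by apply: pint_gt0; rewrite ?ltr1n.
Qed.

Lemma kap2_gt0 e : 0 < kap2 e.
Proof.
have [C C0] := kap2_ge e; apply: lt_le_trans.
by rewrite mule_gt0 ?lte_fin ?pinty_gt0.
Qed.

Lemma kap3_gt0 t e : 0 < kap3 t e.
Proof.
have [C C0] := kap3_gey t e; apply: lt_le_trans.
by rewrite mule_gt0 ?lte_fin ?pinty_gt0.
Qed.

Lemma kap2_eqy e : (- 2^-1 <= e)%R -> kap2 e = +oo.
Proof.
move=> e2; have [C C0] := kap2_ge e; rewrite pinty_eqy; last by lra.
by rewrite gt0_muley ?lte_fin// leye_eq => /eqP.
Qed.

Lemma kap3_eqy t e : (-1 <= t + e)%R -> kap3 t e = +oo.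
Proof.
move=> te; have [C C0] := kap3_gey t e; rewrite pinty_eqy//.
by rewrite gt0_muley ?lte_fin// leye_eq => /eqP.
Qed.

Lemma kap3_eqy0 t e : (t <= -1)%R -> kap3 t e = +oo.
Proof.
move=> te; have [C C0] := kap3_ge0 t e; rewrite pint0_eqy//.
by rewrite gt0_muley ?lte_fin// leye_eq => /eqP.
Qed.

Lemma kap2_lty e : (e < - 2^-1)%R -> kap2 e < +oo.
Proof.
(* [h] carries the tail r > 1 and, reflected, the tail r < -1; on [-1, 1] the integrand is at most 1
   because e < 0. *)
move=> e2; pose h := (fun r : R => (ppow (2 * e) r)%:E) \_ `]1%R, +oo[%classic.
have mh : measurable_fun setT h.
  by apply/(measurable_restrictT _ _).1 => //; exact: measurable_ppowE.
have h0 r : 0 <= h r by rewrite /h patchE; case: ifP; rewrite ?lee_fin ?ppow_ge0.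
have mhN : measurable_fun setT (fun r => h (- r)%R) by exact: measurableT_comp.
pose k (r : R) : \bar R := (\1_(`[(-1)%R, 1%R]%classic) r)%:E.
have mk : measurable_fun setT k by apply/measurable_EFinP; exact: measurable_indic.
have k0 r : 0 <= k r by rewrite lee_fin indicE.
have Ih : \int[leb]_r h r = pinty (2 * e) by rewrite /h -integral_mkcond.
have Ik : \int[leb]_r k r = leb `[(-1)%R, 1%R] by rewrite integral_indic// setIT.
have hy : \int[leb]_r h r < +oo by rewrite Ih pinty_lty//; lra.
apply: (@le_lt_trans _ _ (\int[leb]_r (h r + (h (- r)%R + k r)))); last first.
  have I1 : \int[leb]_r (h r + (h (- r)%R + k r)) =
      \int[leb]_r h r + \int[leb]_r (h (- r)%R + k r).
    apply: ge0_integralD; [exact: measurableT|by []|exact: mh|by move=> r _; rewrite adde_ge0|].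
    exact: emeasurable_funD.
  have I2 : \int[leb]_r (h (- r)%R + k r) = \int[leb]_r h (- r)%R + \int[leb]_r k r.
    by apply: ge0_integralD; [exact: measurableT|by []|exact: mhN|by []|exact: mk].
  rewrite I1 I2 (ge0_integral_opp mh h0) Ik lebesgue_measure_itv /= lte_fin.
  have -> : (-1 < 1 :> R)%R by lra.
  by apply: lte_add_pinfty => //; apply: lte_add_pinfty => //; exact: (ltry (1 - -1)%R).
apply: ge0_le_integral_nomeas => r _; first by rewrite lee_fin powR_ge0.
have hr s : (1 < s)%R -> ((1 + s ^+ 2) `^ e)%:E <= h s.
  move=> s1; have s0 : (0 < s)%R by lra.
  rewrite /h patchE mem_setE /= in_itv /= s1 andbT /= lee_fin ppowE// powRrM powR_mulrn ?(ltW s0)//.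
  rewrite -[e]opprK !(powRN _ (- e)) lef_pV2 ?posrE ?powR_gt0 ?addr_gt0 ?exprn_gt0//.
  by apply: ge0_ler_powR; rewrite ?nnegrE; nra.
have [r1|r1] := ltP 1%R r; first by apply: le_trans (hr _ r1) _; rewrite leeDl ?adde_ge0.
have [r2|r2] := ltP r (-1)%R.
  rewrite -sqrrN; apply: le_trans (hr (- r)%R _) _; first by lra.
  by rewrite addeCA leeDl ?adde_ge0.
have -> : k r = 1 by rewrite /k indicE mem_setE /= in_itv /= r1 r2.
rewrite addeA; apply: (@le_trans _ _ 1); last by rewrite leeDr ?adde_ge0.
rewrite lee_fin -[e]opprK (powRN _ (- e)) invf_le1 ?powR_gt0 ?ltr_wpDr ?sqr_ge0//.
rewrite -[leLHS](powRr0 (1 + r ^+ 2)) ler_powR//; last by lra.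
by rewrite lerDl sqr_ge0.
Qed.

Lemma kap3_lty t e : (-1 < t)%R -> (t + e < -1)%R -> kap3 t e < +oo.
Proof.
move=> t1 te.
pose h1 := (fun r : R => (ppow t r)%:E) \_ `]0%R, 1%R]%classic.
pose h2 := (fun r : R => (ppow (t + e) r)%:E) \_ `]1%R, +oo[%classic.
have mh1 : measurable_fun setT h1.
  by apply/(measurable_restrictT _ _).1 => //; exact: measurable_ppowE.
have mh2 : measurable_fun setT h2.
  by apply/(measurable_restrictT _ _).1 => //; exact: measurable_ppowE.
have h10 r : 0 <= h1 r by rewrite /h1 patchE; case: ifP; rewrite ?lee_fin ?ppow_ge0.
have h20 r : 0 <= h2 r by rewrite /h2 patchE; case: ifP; rewrite ?lee_fin ?ppow_ge0.
pose C1 : R := (1 `^ e + 3 `^ e)%R; pose C2 : R := (2 `^ e + 3 `^ e)%R.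
have C10 : (0 <= C1)%R by rewrite addr_ge0 ?powR_ge0.
have C20 : (0 <= C2)%R by rewrite addr_ge0 ?powR_ge0.
have Ih1 : \int[leb]_r h1 r = pint t 0 1 by rewrite /h1 -integral_mkcond.
have Ih2 : \int[leb]_r h2 r = pinty (t + e) by rewrite /h2 -integral_mkcond.
apply: (@le_lt_trans _ _ (\int[leb]_r (C1%:E * h1 r + C2%:E * h2 r))); last first.
  have I1 : \int[leb]_r (C1%:E * h1 r + C2%:E * h2 r) =
      \int[leb]_r (C1%:E * h1 r) + \int[leb]_r (C2%:E * h2 r).
    apply: ge0_integralD; [exact: measurableT|by move=> r _; rewrite mule_ge0| |
      by move=> r _; rewrite mule_ge0|]; exact: measurable_funeM.
  have Z1 : \int[leb]_r (C1%:E * h1 r) = C1%:E * \int[leb]_r h1 r.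
    by apply: ge0_integralZl; [exact: measurableT|exact: mh1|by []|by rewrite lee_fin].
  have Z2 : \int[leb]_r (C2%:E * h2 r) = C2%:E * \int[leb]_r h2 r.
    by apply: ge0_integralZl; [exact: measurableT|exact: mh2|by []|by rewrite lee_fin].
  rewrite I1 Z1 Z2 Ih1 Ih2.
  by rewrite lte_add_pinfty// lte_mul_pinfty ?lee_fin ?pint0_lty ?pinty_lty.
apply: ge0_le_integral_nomeas => r _; first by rewrite lee_fin mulr_ge0 ?ppow_ge0 ?powR_ge0.
have [r0|r0] := leP r 0%R; first by rewrite ppow_le0// mul0r adde_ge0 ?mule_ge0.
have [r1|r1] := leP r 1%R.
  have -> : h1 r = (ppow t r)%:E by rewrite /h1 patchE mem_setE /= in_itv /= r0 r1.
  apply: (@le_trans _ _ (C1%:E * (ppow t r)%:E)); last by rewrite leeDl ?mule_ge0.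
  rewrite -EFinM lee_fin mulrC ler_wpM2r ?ppow_ge0//.
  by apply: powR_le_between => //; lra.
have -> : h2 r = (ppow (t + e) r)%:E by rewrite /h2 patchE mem_setE /= in_itv /= r1.
apply: (@le_trans _ _ (C2%:E * (ppow (t + e) r)%:E)); last by rewrite leeDr ?mule_ge0.
rewrite -EFinM lee_fin -ppowD mulrCA ler_wpM2l ?ppow_ge0// ppowE//.
rewrite (_ : 1 + 2 * r = ((1 + 2 * r) / r) * r)%R; last by field; rewrite gt_eqF.
rewrite powRM ?divr_ge0 ?(ltW r0)//; last by lra.
rewrite ler_wpM2r ?powR_ge0//.
apply: powR_le_between => //; first by rewrite ler_pdivlMr//; lra.
by rewrite ler_pdivrMr//; lra.
Qed.

End one_dimensional_kernels.

(** * Sigma-finite measures on R^k, C^n and C^n x C^n *)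

Section sigma_finite_product.
Context d1 d2 (T1 : measurableType d1) (T2 : measurableType d2) (R : realType).
Variables (m1 : {sigma_finite_measure set T1 -> \bar R})
          (m2 : {sigma_finite_measure set T2 -> \bar R}).

Definition prod_measure : set (T1 * T2) -> \bar R := (m1 \x m2)%E.

HB.instance Definition _ := Measure.on prod_measure.

Lemma sigma_finite_prod_measure : sigma_finite setT prod_measure.
Proof.
have /sigma_finiteP[F [TF ndF Fy]] := sigma_finiteT m1.
have /sigma_finiteP[G [TG ndG Gy]] := sigma_finiteT m2.
exists (fun n => F n `*` G n).
  apply/seteqP; split=> -[x y] // _.
  have : setT x by []. rewrite TF => -[i _ Fix].
  have : setT y by []. rewrite TG => -[j _ Gjy].
  exists (maxn i j) => //; split => /=.
    by move: x Fix; apply/subsetPset/ndF/leq_maxl.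
  by move: y Gjy; apply/subsetPset/ndG/leq_maxr.
move=> k; have [mFk Fky] := Fy k; have [mGk Gky] := Gy k.
split; first exact: measurableX.
by rewrite /prod_measure product_measure1E// lte_mul_pinfty// ge0_fin_numE.
Qed.

HB.instance Definition _ :=
  Measure_isSigmaFinite.Build _ _ _ prod_measure sigma_finite_prod_measure.

End sigma_finite_product.

Section lebn_measure.
Context (R : realType).

(** [lebn] is a bare set function defined by recursion, while the product of measures is a measure
    only once the previous factor is known to be sigma-finite. So a structured measure with the same
    values is built by induction, and its laws are then transferred to [lebn]. *)
Lemma lebn_sigma_finite_measure k :
  exists m : {sigma_finite_measure set (Rn R k) -> \bar R}, (m : set (Rn R k) -> \bar R) = @lebn R k.
Proof.
elim: k => [|k [m mE]].
  pose m0 : {sigma_finite_measure set unit -> \bar R} := (\d_ tt).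
  by exists m0.
pose m' : {sigma_finite_measure set (measurableTypeR R * Rn R k)%type -> \bar R} :=
  prod_measure (@lebesgue_measure R) m.
by exists m'; rewrite /= /m' /= -mE.
Qed.

Variable k : nat.

Let lebn0 : @lebn R k set0 = 0%E.
Proof. by have [m <-] := lebn_sigma_finite_measure k. Qed.

Let lebn_ge0 A : (0 <= @lebn R k A)%E.
Proof. by have [m <-] := lebn_sigma_finite_measure k. Qed.

Let lebn_semi_sigma_additive : semi_sigma_additive (@lebn R k).
Proof.
have [m <-] := lebn_sigma_finite_measure k; exact: measure_semi_sigma_additive.
Qed.

HB.instance Definition _ := isMeasure.Build _ _ _ (@lebn R k)
  lebn0 lebn_ge0 lebn_semi_sigma_additive.

Let lebn_sigma_finite : sigma_finite setT (@lebn R k).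
Proof.
have [m <-] := lebn_sigma_finite_measure k; exact: sigma_finiteT.
Qed.

HB.instance Definition _ := Measure_isSigmaFinite.Build _ _ _ (@lebn R k) lebn_sigma_finite.

End lebn_measure.

Section volC_measure.
Context (R : realType) (n : nat).

HB.instance Definition _ := SigmaFiniteMeasure.copy (@volC R n) (prod_measure (@lebn R n) (@lebn R n)).
HB.instance Definition _ := SigmaFiniteMeasure.copy (@volCC R n) (prod_measure (@volC R n) (@volC R n)).

End volC_measure.


(** * Coordinates, rho, and the modulus of rho(z,u) *)

Section coordinates.
Context (R : realType).

Lemma measurable_coord k i : measurable_fun setT (fun x : Rn R k => Defs.coord x i).
Proof.
elim: k i => [|k IH] [|i] //=.
  exact: measurable_fst.
by apply: (measurableT_comp (IH i)); exact: measurable_snd.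
Qed.

Lemma ge0_integral_lebnS k (f : measurableTypeR R * Rn R k -> \bar R) :
  measurable_fun setT f -> (forall x, (0 <= f x)%E) ->
  (\int[@lebn R k.+1]_x f x = \int[@lebesgue_measure R]_s \int[@lebn R k]_x f (s, x))%E.
Proof.
move=> mf f0.
have := @fubini_tonelli1 _ _ (measurableTypeR R) (Rn R k) R (@lebesgue_measure R) (@lebn R k) f mf f0.
by [].
Qed.

Lemma ge0_integral_lebn0 (f : Rn R 0 -> \bar R) :
  measurable_fun setT f -> (\int[@lebn R 0]_x f x = f tt)%E.
Proof. by move=> mf; rewrite integral_dirac// diracT mul1e. Qed.

End coordinates.

Section cn_coordinates.
Context (R : realType) (n : nat).
Implicit Types z u : Cn R n.

Lemma measurable_xc j : measurable_fun setT (fun z : Cn R n => xc z j).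
Proof.
by have := measurableT_comp (@measurable_coord R n j) (@measurable_fst _ _ (Rn R n) (Rn R n)).
Qed.

Lemma measurable_yc j : measurable_fun setT (fun z : Cn R n => yc z j).
Proof.
by have := measurableT_comp (@measurable_coord R n j) (@measurable_snd _ _ (Rn R n) (Rn R n)).
Qed.

Lemma measurable_rho : measurable_fun setT (@rho R n).
Proof.
apply: measurable_funB; first exact: measurable_yc.
by apply: measurable_sum => j; apply: measurable_funX; exact: measurable_yc.
Qed.

(** The real part of rho(z,u), with y_n and the squares of the y_j collected into rho(z) and rho(u).
    In this form every term is nonnegative on T_B. *)
Definition re2 z u : R := 4^-1 * (\sum_(j < n.-1) ((xc z j - xc u j) ^+ 2 + (yc z j - yc u j) ^+ 2)
   + 2 * rho z + 2 * rho u).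

Definition im2 z u : R := 2^-1 * (\sum_(j < n.-1) (xc z j - xc u j) * (yc z j + yc u j)
   - (xc z n.-1 - xc u n.-1)).

Lemma Re_sum (I : finType) (F : I -> R[i]) :
  complex.Re (\sum_i F i) = \sum_i complex.Re (F i).
Proof. exact: raddf_sum. Qed.

Lemma Im_sum (I : finType) (F : I -> R[i]) :
  complex.Im (\sum_i F i) = \sum_i complex.Im (F i).
Proof. exact: raddf_sum. Qed.

Lemma rho2E z u : rho2 z u = Complex (re2 z u) (im2 z u).
Proof.
rewrite /rho2 [X in _ * (X - _)](_ : _ =
  Complex (\sum_(j < n.-1) ((xc z j - xc u j) ^+ 2 - (yc z j + yc u j) ^+ 2))
          (\sum_(j < n.-1) 2 * ((xc z j - xc u j) * (yc z j + yc u j)))); last first.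
  apply/eqP; rewrite eq_complex Re_sum Im_sum /=; apply/andP; split; apply/eqP.
    by apply: eq_bigr => j _; rewrite /zc /= opprK; ring.
  by apply: eq_bigr => j _; rewrite /zc /= opprK; ring.
rewrite /zc /re2 /im2 /rho /=; apply/eqP; rewrite eq_complex /=; apply/andP; split; apply/eqP.
  rewrite !mulrBr !mul0r.
  have -> : \sum_(j < n.-1) ((xc z j - xc u j) ^+ 2 + (yc z j - yc u j) ^+ 2) =
    \sum_(j < n.-1) ((xc z j - xc u j) ^+ 2 - (yc z j + yc u j) ^+ 2)
    + 2 * \sum_(j < n.-1) yc z j ^+ 2 + 2 * \sum_(j < n.-1) yc u j ^+ 2.
    by rewrite !mulr_sumr -!big_split /=; apply: eq_bigr => j _; ring.
  by ring.
by rewrite -mulr_sumr; field.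
Qed.

Lemma re2_gt0 z u : 0 <= rho z -> 0 <= rho u -> 0 < rho z + rho u -> 0 < re2 z u.
Proof.
move=> z0 u0 zu; rewrite /re2 mulr_gt0 ?invr_gt0// -addrA ltr_wpDl//; last by lra.
by apply: sumr_ge0 => j _; rewrite addr_ge0 ?sqr_ge0.
Qed.

Definition kmod z u : R := cabs (rho2 z u).

Lemma kmodE z u : kmod z u = Num.sqrt (re2 z u ^+ 2 + im2 z u ^+ 2).
Proof. by rewrite /kmod /cabs rho2E. Qed.

Lemma kmod_ge_re z u : `|re2 z u| <= kmod z u.
Proof. by rewrite kmodE -sqrtr_sqr ler_wsqrtr// lerDl sqr_ge0. Qed.

Lemma kmod_gt0 z u : 0 <= rho z -> 0 <= rho u -> 0 < rho z + rho u -> 0 < kmod z u.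
Proof.
by move=> *; apply: lt_le_trans (kmod_ge_re _ _); rewrite normr_gt0 gt_eqF// re2_gt0.
Qed.

(** Exchanging z and u conjugates rho(z,u): the real part is symmetric, the imaginary part changes
    sign. *)
Lemma kmodC z u : kmod z u = kmod u z.
Proof.
rewrite !kmodE (_ : re2 u z = re2 z u); last first.
  rewrite /re2; congr (_ * _); rewrite -!addrA [2 * rho u + _]addrC; congr (_ + _).
  by apply: eq_bigr => j _; ring.
rewrite (_ : im2 u z = - im2 z u) ?sqrrN// /im2 -mulrN opprB addrC opprB; congr (_ * _).
by rewrite -sumrN; congr (_ + _); apply: eq_bigr => j _; ring.
Qed.

Lemma measurable_re2 : measurable_fun setT (fun zu : Cn R n * Cn R n => re2 zu.1 zu.2).
Proof.
have mx1 j : measurable_fun setT (fun zu : Cn R n * Cn R n => xc zu.1 j).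
  by apply: (measurableT_comp (measurable_xc j)); exact: measurable_fst.
have mx2 j : measurable_fun setT (fun zu : Cn R n * Cn R n => xc zu.2 j).
  by apply: (measurableT_comp (measurable_xc j)); exact: measurable_snd.
have my1 j : measurable_fun setT (fun zu : Cn R n * Cn R n => yc zu.1 j).
  by apply: (measurableT_comp (measurable_yc j)); exact: measurable_fst.
have my2 j : measurable_fun setT (fun zu : Cn R n * Cn R n => yc zu.2 j).
  by apply: (measurableT_comp (measurable_yc j)); exact: measurable_snd.
apply: measurable_funM => //; apply: measurable_funD; first apply: measurable_funD.
- apply: measurable_sum => j; apply: measurable_funD; apply: measurable_funX;
  exact: measurable_funB.
- apply: measurable_funM => //; apply: (measurableT_comp measurable_rho); exact: measurable_fst.
- apply: measurable_funM => //; apply: (measurableT_comp measurable_rho); exact: measurable_snd.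
Qed.

Lemma measurable_im2 : measurable_fun setT (fun zu : Cn R n * Cn R n => im2 zu.1 zu.2).
Proof.
have mx1 j : measurable_fun setT (fun zu : Cn R n * Cn R n => xc zu.1 j).
  by apply: (measurableT_comp (measurable_xc j)); exact: measurable_fst.
have mx2 j : measurable_fun setT (fun zu : Cn R n * Cn R n => xc zu.2 j).
  by apply: (measurableT_comp (measurable_xc j)); exact: measurable_snd.
have my1 j : measurable_fun setT (fun zu : Cn R n * Cn R n => yc zu.1 j).
  by apply: (measurableT_comp (measurable_yc j)); exact: measurable_fst.
have my2 j : measurable_fun setT (fun zu : Cn R n * Cn R n => yc zu.2 j).
  by apply: (measurableT_comp (measurable_yc j)); exact: measurable_snd.
apply: measurable_funM => //; apply: measurable_funB; last exact: measurable_funB.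
by apply: measurable_sum => j; apply: measurable_funM; [exact: measurable_funB|exact: measurable_funD].
Qed.

Lemma measurable_kmod : measurable_fun setT (fun zu : Cn R n * Cn R n => kmod zu.1 zu.2).
Proof.
rewrite (_ : (fun _ => _) = fun zu => (re2 zu.1 zu.2 ^+ 2 + im2 zu.1 zu.2 ^+ 2) `^ 2^-1).
  apply: measurableT_comp (measurable_powR _) _.
  by apply: measurable_funD; apply: measurable_funX; [exact: measurable_re2|exact: measurable_im2].
by apply/funext => zu; rewrite kmodE powR12_sqrt// addr_ge0 ?sqr_ge0.
Qed.

Definition wt (a : R) z : R := ppow a (rho z).

Lemma wt_ge0 a z : 0 <= wt a z. Proof. exact: ppow_ge0. Qed.

Lemma measurable_wt a : measurable_fun setT (wt a).
Proof. exact: measurableT_comp (measurable_ppow a) measurable_rho. Qed.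

Lemma measurable_TB : measurable (@TB R n).
Proof.
rewrite (_ : @TB R n = @rho R n @^-1` `]0, +oo[%classic).
  by rewrite -[X in measurable X]setTI; apply: measurable_rho.
by apply/seteqP; split=> z; rewrite /TB /= in_itv /= andbT.
Qed.

Lemma wtE a z : TB z -> wt a z = rho z `^ a. Proof. exact: ppowE. Qed.

Lemma wt_notin a z : ~ TB z -> wt a z = 0.
Proof. by move=> /negP; rewrite -leNgt; exact: ppow_le0. Qed.

End cn_coordinates.

(** * Integrating the kernel one coordinate at a time *)

Section iterated_kernels.
Context (R : realType).
Local Open Scope ereal_scope.
Implicit Types (x y w : nat -> R) (a e A B c D : R).

(** Each quadratic coordinate integrated out by [kap2E] contributes a factor [kap2] and raises the
    exponent of the remaining base by 1/2. [kaps] collects these factors for the real parts of u,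
    [kapt] for the imaginary parts. *)
Fixpoint kaps k e : \bar R :=
  if k is k'.+1 then kap2 (2 * e + 1 + k'%:R / 2) * kaps k' e else (2^-1)%:E * kap2 e.

Fixpoint kapt k a e : \bar R :=
  if k is k'.+1 then kap2 (a + e + 1 + k'%:R / 2) * kapt k' a e else kap3 a e.

Lemma kaps_gt0 k e : 0 < kaps k e.
Proof.
by elim: k => [|k IH] /=; rewrite mule_gt0 ?kap2_gt0// lte_fin invr_gt0.
Qed.

Lemma kapt_gt0 k a e : 0 < kapt k a e.
Proof. by elim: k => [|k IH] /=; rewrite ?mule_gt0 ?kap2_gt0 ?kap3_gt0. Qed.

Lemma kaps_lty k e : (k%:R + 1 < - (2 * e))%R -> kaps k e < +oo.
Proof.
elim: k => [|k IH] /= ke.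
  by rewrite lte_mul_pinfty ?lee_fin ?kap2_lty//; lra.
have k0 : (0 <= k%:R :> R)%R by [].
move: ke; rewrite -natr1 => ke.
rewrite lte_mul_pinfty ?(ltW (kap2_gt0 _))//; last by apply: IH; lra.
by rewrite ge0_fin_numE ?(ltW (kap2_gt0 _))// kap2_lty//; lra.
Qed.

Lemma kapt_lty k a e : (-1 < a)%R -> (a + e + 1 + k%:R / 2 < 0)%R -> kapt k a e < +oo.
Proof.
move=> a1; elim: k => [|k IH] /= ke; first by apply: kap3_lty => //; lra.
move: ke; rewrite -natr1 => ke.
rewrite lte_mul_pinfty ?(ltW (kap2_gt0 _))//; last by apply: IH; lra.
by rewrite ge0_fin_numE ?(ltW (kap2_gt0 _))// kap2_lty//; lra.
Qed.

Lemma kapt_eqy0 k a e : (a <= -1)%R -> kapt k a e = +oo.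
Proof.
move=> a1; elim: k => [|k IH] /=; first exact: kap3_eqy0.
by rewrite IH gt0_muley// kap2_gt0.
Qed.

(** The factor added last diverges already at the boundary value: its exponent a + e + 1 + (k-1)/2
    is then at least -1/2. *)
Lemma kapt_eqy k a e : (0 <= a + e + 1 + k%:R / 2)%R -> kapt k a e = +oo.
Proof.
case: k => [|k] /= ke; first by apply: kap3_eqy; lra.
move: ke; rewrite -natr1 => ke.
by rewrite kap2_eqy ?gt0_mulye ?kapt_gt0//; lra.
Qed.

(** For c = 0 and suitable x, w, B this is (16 |rho(z,u)|^2)^e as a function of the real parts of u.
    The shift c receives the contribution of coordinates that are already fixed. *)
Definition skernel k x w B c e (s : Rn R k.+1) : R :=
  ((B + \sum_(j < k) (x j - Defs.coord s j) ^+ 2) ^+ 2 +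
   (c + 2 * \sum_(j < k) (x j - Defs.coord s j) * w j - 2 * (x k - Defs.coord s k)) ^+ 2) `^ e.

Lemma measurable_skernel k x w B c e : measurable_fun setT (@skernel k x w B c e).
Proof.
have mc j : measurable_fun setT (fun s : Rn R k.+1 => x j - Defs.coord s j)%R.
  by apply: measurable_funB => //; exact: measurable_coord.
apply: measurableT_comp (measurable_powR e) _.
apply: measurable_funD; apply: measurable_funX.
  apply: measurable_funD => //; apply: measurable_sum => j; exact: measurable_funX.
apply: measurable_funB; last exact: measurable_funM.
apply: measurable_funD => //; apply: measurable_funM => //.
by apply: measurable_sum => j; exact: measurable_funM.
Qed.

(** Fixing the first coordinate only enlarges B and moves c. Since the value of the integral does
    not involve c, the cross terms with w drop out, and a one-dimensional integral of a power of B +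
    (x - s)^2 remains. *)
Lemma integral_skernel k x w B c e : (0 < B)%R ->
  \int[@lebn R k.+1]_s (@skernel k x w B c e s)%:E =
  (B `^ (2 * e + 1 + k%:R / 2))%:E * kaps k e.
Proof.
have mk k' x' w' B' c' : measurable_fun setT (fun s => (@skernel k' x' w' B' c' e s)%:E).
  by apply/measurable_EFinP; exact: measurable_skernel.
have k0 k' x' w' B' c' s : 0 <= (@skernel k' x' w' B' c' e s)%:E by rewrite lee_fin powR_ge0.
elim: k x w B c => [|k IH] x w B c B0.
  rewrite (@ge0_integral_lebnS R 0%N _ (mk 0%N x w B c) (k0 0%N x w B c)).
  rewrite /= mul0r addr0 -(kap1E e (c - 2 * x 0%N) B0).
  apply: eq_integral => s _; rewrite ge0_integral_lebn0//; congr EFin.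
  by rewrite /skernel /= !big_ord0 mulr0 !addr0; congr (_ `^ _)%R; ring.
rewrite (@ge0_integral_lebnS R k.+1 _ (mk k.+1 x w B c) (k0 k.+1 x w B c)).
transitivity (\int[@lebesgue_measure R]_s
    (kaps k e * ((B + (x 0%N - s) ^+ 2) `^ (2 * e + 1 + k%:R / 2))%:E)).
  apply: eq_integral => s _.
  rewrite muleC -(IH (x \o succn) (w \o succn) _ (c + 2 * ((x 0%N - s) * w 0%N))%R).
    apply: eq_integral => s' _; congr EFin; rewrite /skernel !big_ord_recl /=.
    by congr (_ `^ _)%R; ring.
  by rewrite ltr_pwDl// sqr_ge0.
rewrite ge0_integralZl//; last 3 first.
- exact: measurable_kap2.
- by move=> s _; rewrite lee_fin powR_ge0.
- by rewrite ltW// kaps_gt0.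
rewrite kap2E//= muleCA [kaps k e * _]muleC; congr (_%:E * _); congr (_ `^ _)%R.
by rewrite -natr1; field.
Qed.

(** For q = 1 and D = 0 this is rho in terms of the imaginary parts; for q = 0 it is the last
    coordinate shifted by D, so one lemma on boxes serves real and imaginary parts. D absorbs the
    squares fixed during an induction. *)
Definition targ k q D (t : Rn R k.+1) : R :=
  Defs.coord t k - D - q * \sum_(j < k) Defs.coord t j ^+ 2.

Lemma measurable_targ k q D : measurable_fun setT (@targ k q D).
Proof.
apply: measurable_funB; first by apply: measurable_funB => //; exact: measurable_coord.
apply: measurable_funM => //; apply: measurable_sum => j; apply: measurable_funX.
exact: measurable_coord.
Qed.

Definition tkernel k y A D a e (t : Rn R k.+1) : R :=
  ppow a (targ 1 D t) *
  (A + \sum_(j < k) (y j - Defs.coord t j) ^+ 2 + 2 * targ 1 D t) `^ e.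

Lemma measurable_tkernel k y A D a e : measurable_fun setT (@tkernel k y A D a e).
Proof.
have mc j : measurable_fun setT (fun s : Rn R k.+1 => y j - Defs.coord s j)%R.
  by apply: measurable_funB => //; exact: measurable_coord.
apply: measurable_funM.
  by have := measurableT_comp (measurable_ppow a) (@measurable_targ k 1 D).
apply: measurableT_comp (measurable_powR e) _.
apply: measurable_funD; last by apply: measurable_funM => //; exact: measurable_targ.
by apply: measurable_funD => //; apply: measurable_sum => j; exact: measurable_funX.
Qed.

Lemma tkernel_ge0 k y A D a e t : (0 <= @tkernel k y A D a e t)%R.
Proof. by rewrite mulr_ge0 ?ppow_ge0 ?powR_ge0. Qed.

Lemma integral_tkernel k y A D a e : (0 < A)%R ->
  \int[@lebn R k.+1]_t (@tkernel k y A D a e t)%:E =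
  (A `^ (a + e + 1 + k%:R / 2))%:E * kapt k a e.
Proof.
have mk k' y' A' D' : measurable_fun setT (fun s => (@tkernel k' y' A' D' a e s)%:E).
  by apply/measurable_EFinP; exact: measurable_tkernel.
have k0 k' y' A' D' s : 0 <= (@tkernel k' y' A' D' a e s)%:E by rewrite lee_fin tkernel_ge0.
elim: k y A D => [|k IH] y A D A0.
  rewrite (@ge0_integral_lebnS R 0%N _ (mk 0%N y A D) (k0 0%N y A D)).
  rewrite /= mul0r addr0 -(kap3E a e D A0).
  apply: eq_integral => s _; rewrite ge0_integral_lebn0//; congr EFin.
  by rewrite /tkernel /targ /= !big_ord0 mulr0 subr0 addr0.
rewrite (@ge0_integral_lebnS R k.+1 _ (mk k.+1 y A D) (k0 k.+1 y A D)).
transitivity (\int[@lebesgue_measure R]_s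
    (kapt k a e * ((A + (y 0%N - s) ^+ 2) `^ (a + e + 1 + k%:R / 2))%:E)).
  apply: eq_integral => s _.
  rewrite muleC -(IH (y \o succn) _ (D + s ^+ 2)%R).
    apply: eq_integral => s' _; congr EFin; rewrite /tkernel /targ !big_ord_recl /=.
    by congr (ppow a _ * _ `^ e)%R; ring.
  by rewrite ltr_pwDl// sqr_ge0.
rewrite ge0_integralZl//; last 3 first.
- exact: measurable_kap2.
- by move=> s _; rewrite lee_fin powR_ge0.
- by rewrite ltW// kapt_gt0.
rewrite kap2E//= muleCA [kapt k a e * _]muleC; congr (_%:E * _); congr (_ `^ _)%R.
by rewrite -natr1; field.
Qed.

Definition near0 A (r : R) : R := (`|r| < A)%R%:R.

Lemma measurable_near0 A : measurable_fun setT (near0 A).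
Proof.
rewrite (_ : near0 A = \1_(`](- A)%R, A[%classic : set R)); first exact: measurable_indic.
by apply/funext => r; rewrite /near0 indicE mem_setE /= in_itv /= ltr_norml.
Qed.

Lemma near0_ge0 A r : (0 <= near0 A r)%R. Proof. exact: ler0n. Qed.

Lemma integral_near0 A : (0 < A)%R ->
  \int[@lebesgue_measure R]_r (near0 A r)%:E = (2 * A)%:E.
Proof.
move=> A0; transitivity (\int[@lebesgue_measure R]_r (\1_(`](- A)%R, A[%classic : set R) r)%:E).
  by apply: eq_integral => r _; rewrite /near0 indicE mem_setE /= in_itv /= ltr_norml.
rewrite integral_indic//= setIT lebesgue_measure_itv /= lte_fin gtrN// -EFinD; congr EFin.
by ring.
Qed.

(** The last of the k+1 coordinates stays free: it is the one that [targ] measures. *)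
Definition boxn k A (t : Rn R k.+1) : R := \prod_(j < k) near0 A (Defs.coord t j).

Lemma boxn_ge0 k A t : (0 <= @boxn k A t)%R.
Proof. by apply: prodr_ge0 => j _; exact: near0_ge0. Qed.

Lemma measurable_boxn k A : measurable_fun setT (@boxn k A).
Proof.
apply: measurable_prod => j _; apply: measurableT_comp (measurable_near0 A) _.
exact: measurable_coord.
Qed.

(** With the first coordinates fixed, [targ] is a translation of the last one, so by translation
    invariance the integral of phi separates from the box. *)
Lemma integral_box k q A D (phi : R -> \bar R) : (0 < A)%R ->
  measurable_fun setT phi -> (forall r, 0 <= phi r) ->
  \int[@lebn R k.+1]_t ((boxn A t)%:E * phi (targ q D t)) =
  ((2 * A) ^+ k)%:E * \int[@lebesgue_measure R]_r phi r.
Proof.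
move=> A0 mphi phi0.
have mb k' D' : measurable_fun setT
    (fun t : Rn R k'.+1 => (boxn A t)%:E * phi (targ q D' t)).
  apply: emeasurable_funM; first by apply/measurable_EFinP; exact: measurable_boxn.
  by have := measurableT_comp mphi (@measurable_targ k' q D').
have b0 k' D' (t : Rn R k'.+1) : 0 <= (boxn A t)%:E * phi (targ q D' t).
  by rewrite mule_ge0 ?lee_fin ?boxn_ge0.
elim: k D => [|k IH] D.
  rewrite (ge0_integral_lebnS (mb _ _) (b0 _ _)) expr0 mul1e.
  rewrite -(ge0_integral_translate (- D) mphi phi0).
  apply: eq_integral => s _; rewrite ge0_integral_lebn0//.
  by rewrite /boxn /targ /= !big_ord0 mul1e mulr0 subr0.
rewrite (ge0_integral_lebnS (mb _ _) (b0 _ _)).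
transitivity (\int[@lebesgue_measure R]_s
   (((2 * A) ^+ k)%:E * \int[@lebesgue_measure R]_r phi r * (near0 A s)%:E)).
  apply: eq_integral => s _; rewrite -(IH (D + q * s ^+ 2)%R) muleC -ge0_integralZl//; last first.
    by rewrite lee_fin near0_ge0.
  apply: eq_integral => s' _; rewrite muleA -EFinM; congr (_%:E * phi _).
    by rewrite /boxn big_ord_recl.
  by rewrite /targ big_ord_recl /=; ring.
rewrite ge0_integralZl//; last 3 first.
- by apply/measurable_EFinP; exact: measurable_near0.
- by move=> s _; rewrite lee_fin near0_ge0.
- by rewrite mule_ge0 ?lee_fin ?exprn_ge0 ?mulr_ge0 ?(ltW A0)// integral_ge0.
by rewrite integral_near0// muleC muleA -EFinM -exprS.
Qed.

End iterated_kernels.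

(** * The exact kernel integral over T_B *)

Section kernel_integrals.
Context (R : realType) (m : nat).
Local Notation n := m.+1.
Local Notation vol := (@volC R n).
Local Open Scope ereal_scope.
Implicit Types z u : Cn R n.

Lemma measurable_kmod_r z : measurable_fun setT (fun u : Cn R n => kmod z u).
Proof.
by have := measurable_fun_pair2 z (@measurable_kmod R n).
Qed.

Lemma measurable_wt_kmod a c z :
  measurable_fun setT (fun u : Cn R n => (wt a u * kmod z u `^ c)%:E).
Proof.
apply/measurable_EFinP; apply: measurable_funM; first exact: measurable_wt.
by have := measurableT_comp (measurable_powR c) (measurable_kmod_r z).
Qed.

Lemma wt_kmod_ge0 a c z u : 0 <= (wt a u * kmod z u `^ c)%:E.
Proof. by rewrite lee_fin mulr_ge0 ?wt_ge0 ?powR_ge0. Qed.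

Lemma ge0_integral_volC (f : Cn R n -> \bar R) : measurable_fun setT f -> (forall u, 0 <= f u) ->
  \int[vol]_u f u = \int[@lebn R n]_t \int[@lebn R n]_s f (s, t).
Proof.
move=> mf f0.
by have := @fubini_tonelli2 _ _ (Rn R n) (Rn R n) R (@lebn R n) (@lebn R n) f mf f0.
Qed.

(** The power of 4 is the factor 1/4 in rho(z,u); the power of 2 comes from the term 2 rho(z) in the
    real part. Integrating the real parts turns the exponent c/2 of the squared modulus into c + 1 +
    m/2. *)
Definition kapJ a c : \bar R :=
  (4 `^ (- c) * 2 `^ (a + (c + 1 + m%:R / 2) + 1 + m%:R / 2))%:E *
  (kaps m (c / 2) * kapt m a (c + 1 + m%:R / 2)).

Lemma kapJ_gt0 a c : 0 < kapJ a c.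
Proof. by rewrite mule_gt0 ?mule_gt0 ?kaps_gt0 ?kapt_gt0// lte_fin mulr_gt0 ?powR_gt0. Qed.

(** For a > -1 the condition a + c + n + 1 < 0 forces c < -n, which suffices for [kaps]; the sharp
    range is that of [kapt]. *)
Lemma kapJ_lty a c : (-1 < a)%R -> (a + c + n%:R + 1 < 0)%R -> kapJ a c < +oo.
Proof.
rewrite -natr1 => a1 ac; have m0 : (0 <= m%:R :> R)%R by [].
have h1 : kaps m (c / 2) < +oo by apply: kaps_lty; lra.
have h2 : kapt m a (c + 1 + m%:R / 2) < +oo by apply: kapt_lty => //; lra.
have s0 := ltW (kaps_gt0 m (c / 2)); have t0 := ltW (kapt_gt0 m a (c + 1 + m%:R / 2)).
rewrite /kapJ lte_mul_pinfty// lte_mul_pinfty// ge0_fin_numE//.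
Qed.

Lemma kapJ_eqy a c : ~ ((-1 < a)%R /\ (a + c + n%:R + 1 < 0)%R) -> kapJ a c = +oo.
Proof.
rewrite -natr1 => nac.
suff h : kapt m a (c + 1 + m%:R / 2) = +oo.
  by rewrite /kapJ h (gt0_muley (kaps_gt0 _ _)) gt0_muley// lte_fin mulr_gt0 ?powR_gt0.
have [a1|a1] := leP a (-1)%R; first exact: kapt_eqy0.
apply: kapt_eqy; rewrite leNgt; apply/negP => h; apply: nac; split => //; lra.
Qed.

Lemma kmod_skernel z u (c : R) :
  (kmod z u `^ c)%R = (4 `^ (- c) *
   @skernel R m (xc z) (fun j => yc z j + yc u j)
     (\sum_(j < m) (yc z j - yc u j) ^+ 2 + 2 * rho z + 2 * rho u) 0 (c / 2) u.1)%R.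
Proof.
rewrite /skernel.
set Q := (X in (_ * X `^ _)%R).
have Q0 : (0 <= Q)%R by rewrite addr_ge0 ?sqr_ge0.
have -> : kmod z u = (4^-1 * Num.sqrt Q)%R.
  rewrite kmodE (_ : _ + _ = 4^-1 ^+ 2 * Q)%R; last first.
    rewrite /Q /re2 /im2 -[m.+1.-1]/m add0r /xc.
    have -> : (\sum_(j < m) ((Defs.coord z.1 j - Defs.coord u.1 j) ^+ 2 + (yc z j - yc u j) ^+ 2) =
      \sum_(j < m) (Defs.coord z.1 j - Defs.coord u.1 j) ^+ 2 + \sum_(j < m) (yc z j - yc u j) ^+ 2)%R.
      by rewrite big_split.
    by field.
  by rewrite sqrtrM ?sqr_ge0// sqrtr_sqr ger0_norm// invr_ge0.
rewrite powRM ?sqrtr_ge0 ?invr_ge0//; congr (_ * _)%R.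
  by rewrite -powR_inv1// -powRrM mulN1r.
by rewrite -powR12_sqrt// -powRrM mulrC.
Qed.

Lemma integral_wt_kmod a c z : (0 < rho z)%R ->
  \int[vol]_u (wt a u * kmod z u `^ c)%:E = (rho z `^ (a + c + n%:R + 1))%:E * kapJ a c.
Proof.
move=> z0; rewrite (ge0_integral_volC (measurable_wt_kmod a c z) (wt_kmod_ge0 a c z)).
pose B (t : Rn R n) : R := (\sum_(j < m) (yc z j - Defs.coord t j) ^+ 2 + 2 * rho z + 2 * targ 1 0 t)%R.
have rhot (s t : Rn R n) : rho ((s, t) : Cn R n) = targ 1 0 t.
  by rewrite /rho /targ /yc /= subr0 mul1r.
have Bpos t : (0 < targ 1 0 t)%R -> (0 < B t)%R.
  move=> t0; rewrite /B -addrA ltr_wpDl//; last by lra.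
  by apply: sumr_ge0 => j _; exact: sqr_ge0.
(* The real parts are integrated first, with the imaginary parts t of u fixed. What they leave is a
   power of B(t), which is the base of [tkernel] with A = 2 rho(z). *)
transitivity (\int[@lebn R n]_t ((4 `^ (- c))%:E * kaps m (c / 2) *
   (@tkernel R m (yc z) (2 * rho z) 0 a (c + 1 + m%:R / 2) t)%:E)).
  apply: eq_integral => t _.
  have [t0|t0] := leP (targ 1 0 t) 0%R.
    rewrite /tkernel (ppow_le0 _ t0) mul0r mule0.
    by rewrite integral0_eq// => s _; rewrite /wt rhot (ppow_le0 _ t0) mul0r.
  transitivity (\int[@lebn R n]_s ((ppow a (targ 1 0 t) * 4 `^ (- c))%:E *
      (@skernel R m (xc z) (fun j => yc z j + Defs.coord t j)%R (B t) 0 (c / 2) s)%:E)).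
    apply: eq_integral => s _; rewrite -EFinM; congr EFin.
    by rewrite kmod_skernel /wt rhot mulrA; congr (_ * _ * skernel _ _ _ _ _ _)%R.
  rewrite ge0_integralZl//; last 3 first.
  - by apply/measurable_EFinP; exact: measurable_skernel.
  - by move=> s _; rewrite lee_fin powR_ge0.
  - by rewrite lee_fin mulr_ge0 ?ppow_ge0 ?powR_ge0.
  rewrite integral_skernel ?Bpos// /tkernel.
  rewrite (_ : 2 * rho z + _ + _ = B t)%R; last by rewrite /B /yc; ring.
  rewrite (_ : 2 * (c / 2) + 1 + _ = c + 1 + m%:R / 2)%R; last by field.
  rewrite muleA -EFinM [RHS]muleAC -EFinM; congr (_%:E * _).
  by ring.
rewrite ge0_integralZl//; last 3 first.
- by apply/measurable_EFinP; exact: measurable_tkernel.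
- by move=> t _; rewrite lee_fin tkernel_ge0.
- by rewrite mule_ge0 ?lee_fin ?powR_ge0// ltW// kaps_gt0.
rewrite integral_tkernel; last by rewrite mulr_gt0.
rewrite powRM ?(ltW z0)// /kapJ EFinM.
rewrite (_ : a + c + n%:R + 1 = a + (c + 1 + m%:R / 2) + 1 + m%:R / 2)%R; last first.
  by rewrite -natr1; field.
set P2 := (2 `^ _)%:E; set Pr := (rho z `^ _)%:E.
rewrite EFinM -/P2 -!muleA [Pr * _]muleCA; congr (_ * _).
rewrite [LHS]muleCA [RHS]muleCA; congr (_ * _).
by rewrite [LHS]muleCA; congr (_ * _).
Qed.

Lemma integral_wt_kmod_l a c u : (0 < rho u)%R ->
  \int[vol]_z (wt a z * kmod z u `^ c)%:E = (rho u `^ (a + c + n%:R + 1))%:E * kapJ a c.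
Proof.
move=> u0; rewrite -(integral_wt_kmod a c u0); apply: eq_integral => z _.
by rewrite kmodC.
Qed.

(** All coordinates are bounded except the last imaginary one, whose role is taken over by
    rho(u). *)
Definition boxC A B u : R := boxn A u.1 * near0 B (xc u m) * boxn A u.2.

Lemma boxC_ge0 A B u : (0 <= boxC A B u)%R.
Proof. by rewrite !mulr_ge0 ?boxn_ge0 ?near0_ge0. Qed.

Lemma measurable_boxC A B : measurable_fun setT (boxC A B).
Proof.
apply: measurable_funM; first apply: measurable_funM.
- by have := measurableT_comp (@measurable_boxn R m A) (@measurable_fst _ _ (Rn R n) (Rn R n)).
- by have := measurableT_comp (measurable_near0 B) (@measurable_xc R n m).
- by have := measurableT_comp (@measurable_boxn R m A) (@measurable_snd _ _ (Rn R n) (Rn R n)).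
Qed.

Lemma integral_boxC A B (phi : R -> \bar R) : (0 < A)%R -> (0 < B)%R ->
  measurable_fun setT phi -> (forall r, 0 <= phi r) ->
  \int[vol]_u ((boxC A B u)%:E * phi (rho u)) =
  ((2 * A) ^+ m * (2 * B) * (2 * A) ^+ m)%:E * \int[@lebesgue_measure R]_r phi r.
Proof.
move=> A0 B0 mphi phi0.
have rhot (s t : Rn R n) : rho ((s, t) : Cn R n) = targ 1 0 t.
  by rewrite /rho /targ /yc /= subr0 mul1r.
rewrite ge0_integral_volC; last 2 first.
- apply: emeasurable_funM; first by apply/measurable_EFinP; exact: measurable_boxC.
  by have := measurableT_comp mphi (@measurable_rho R n).
- by move=> u; rewrite mule_ge0 ?lee_fin ?boxC_ge0.
have bx : \int[@lebn R n]_s ((boxn A s)%:E * (near0 B (targ 0 0 s))%:E) =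
    ((2 * A) ^+ m * (2 * B))%:E.
  rewrite (@integral_box R m 0 A 0 (fun r => (near0 B r)%:E))//.
  - by rewrite integral_near0// -EFinM.
  - by apply/measurable_EFinP; exact: measurable_near0.
  - by move=> r; rewrite lee_fin near0_ge0.
transitivity (\int[@lebn R n]_t (((2 * A) ^+ m * (2 * B))%:E * ((boxn A t)%:E * phi (targ 1 0 t)))).
  apply: eq_integral => t _; rewrite -bx muleC -ge0_integralZl//; last 3 first.
  - apply: emeasurable_funM; apply/measurable_EFinP; first exact: measurable_boxn.
    by have := measurableT_comp (measurable_near0 B) (@measurable_targ R m 0 0).
  - by move=> s _; rewrite mule_ge0 ?lee_fin ?boxn_ge0 ?near0_ge0.
  - by rewrite mule_ge0 ?lee_fin ?boxn_ge0.
  apply: eq_integral => s _; rewrite /boxC rhot /= /xc /=.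
  have -> : targ 0 0 s = Defs.coord s m by rewrite /targ mul0r !subr0.
  by rewrite !EFinM [RHS]muleC muleA.
have mb : measurable_fun setT (fun t : Rn R n => (boxn A t)%:E * phi (targ 1 0 t)).
  apply: emeasurable_funM; first by apply/measurable_EFinP; exact: measurable_boxn.
  by have := measurableT_comp mphi (@measurable_targ R m 1 0).
rewrite ge0_integralZl//; last 2 first.
- by move=> t _; rewrite mule_ge0 ?lee_fin ?boxn_ge0.
- by rewrite lee_fin !mulr_ge0 ?exprn_ge0 ?mulr_ge0 ?ltW.
by rewrite integral_box// muleA -EFinM.
Qed.

End kernel_integrals.

(** * Finiteness almost everywhere and null sections *)

Section almost_everywhere_tools.
Local Open Scope ereal_scope.

Lemma ae_lty_of_integral_poweR d (T : measurableType d) (R : realType)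
    (mu : {measure set T -> \bar R}) (f : T -> \bar R) (r : R) : (0 < r)%R ->
  measurable_fun setT f -> \int[mu]_x (f x `^ r) < +oo ->
  {ae mu, forall x, f x < +oo}.
Proof.
move=> r0 mf If; have mfr : measurable_fun setT (fun x => f x `^ r).
  exact: measurableT_comp (measurable_poweR _) _.
have : mu.-integrable setT (fun x => f x `^ r).
  apply/integrableP; split=> //.
  by under eq_integral do rewrite gee0_abs ?poweR_ge0//.
move=> /(integrable_ae measurableT); apply: filterS => x /(_ Logic.I) fx.
rewrite ltey; apply/eqP => fy; move: fx.
by rewrite fy poweRyr ?gt_eqF.
Qed.

Lemma product_null_of_sections d1 d2 (X : measurableType d1) (Y : measurableType d2) (R : realType)
    (mu : {sigma_finite_measure set X -> \bar R}) (nu : {sigma_finite_measure set Y -> \bar R})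
    (N : set (X * Y)) : measurable N ->
  {ae nu, forall y, {ae mu, forall x, ~ N (x, y)}} -> (mu \x nu) N = 0.
Proof.
move=> mN aeN.
have m1 : measurable_fun setT (fun xy => (\1_N xy : R)%:E).
  by apply/measurable_EFinP; exact: measurable_indic.
have i0 (xy : X * Y) : 0 <= (\1_N xy : R)%:E by rewrite lee_fin indicE.
rewrite -[N]setIT -(integral_indic (mu \x nu) measurableT mN) fubini_tonelli2//.
rewrite -[RHS](integral0 nu setT); apply: ge0_ae_eq_integral => //.
- exact: measurable_fun_fubini_tonelli_G.
- by move=> y _; exact: integral_ge0.
apply: filterS aeN => y aey _.
rewrite -[RHS](integral0 mu setT); apply: ge0_ae_eq_integral => //.
  by have := measurable_fun_pair1 y m1.
by apply: filterS aey => x xN _; rewrite /= indicE memNset.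
Qed.

End almost_everywhere_tools.

(** * Schur test with power weights in the first variable *)

Section schur.
Context (R : realType) (m : nat).
Local Notation n := m.+1.
Local Notation vol := (@volC R n).
Local Open Scope ereal_scope.
Implicit Types z u : Cn R n.

Lemma kapJ_fine (a c : R) : (-1 < a)%R -> (a + c + n%:R + 1 < 0)%R ->
  exists2 k : R, (0 < k)%R & kapJ m a c = k%:E.
Proof.
move=> a1 ac; have := kapJ_gt0 m a c; have := kapJ_lty a1 ac.
by case: (kapJ m a c) => [k||] // _; rewrite lte_fin => k0; exists k.
Qed.

Lemma TB_kmod_gt0 z u : TB z -> TB u -> (0 < kmod z u)%R.
Proof. by rewrite /TB /= => z0 u0; apply: kmod_gt0; lra. Qed.

Lemma measurable_kmod_pow (c : R) :
  measurable_fun setT (fun zu : Cn R n * Cn R n => (kmod zu.1 zu.2 `^ c)%R).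
Proof. by have := measurableT_comp (measurable_powR c) (@measurable_kmod R n). Qed.

Lemma measurable_kmod_pow_r (c : R) z : measurable_fun setT (fun u => (kmod z u `^ c)%R).
Proof. by have := measurable_fun_pair2 z (measurable_kmod_pow c). Qed.

Lemma measurable_wt_fst (e : R) : measurable_fun setT (fun zu : Cn R n * Cn R n => wt e zu.1).
Proof. by have := measurableT_comp (@measurable_wt R n e)
  (@measurable_fst _ _ (Rn R n * Rn R n)%type (Rn R n * Rn R n)%type). Qed.

Lemma measurable_wt_snd (e : R) : measurable_fun setT (fun zu : Cn R n * Cn R n => wt e zu.2).
Proof. by have := measurableT_comp (@measurable_wt R n e)
  (@measurable_snd _ _ (Rn R n * Rn R n)%type (Rn R n * Rn R n)%type). Qed.

(** Jensen for the measure rho(u)^t |rho(z,u)|^(-s) dV(u), whose mass k1 rho(z)^(t-s+n+1) is known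
    exactly. The exponent [al] is split off so that the L^p weight of g becomes visible. *)
Lemma integral_kernel_poweR_le (p b c al t s k1 : R) (g : Cn R n -> R) z :
  (1 < p)%R -> kapJ m t (- s) = k1%:E -> (0 < k1)%R -> TB z ->
  measurable_fun setT g -> (forall u, 0 <= g u)%R ->
  (\int[vol]_u (wt b u * kmod z u `^ (- c) * g u)%:E) `^ p <=
  ((k1 * rho z `^ (t - s + n%:R + 1)) `^ (p - 1))%:E *
  \int[vol]_u (wt (p * (b - t) + t - al) u * kmod z u `^ (p * (s - c) - s) *
               (g u `^ p * wt al u))%:E.
Proof.
move=> p1 k1E k10 Tz mg g0.
pose f u := (wt (b - t) u * kmod z u `^ (s - c) * g u)%:E.
pose phi u := (wt t u * kmod z u `^ (- s))%R.
have mf : measurable_fun setT f.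
  apply/measurable_EFinP; apply: measurable_funM => //; apply: measurable_funM.
    exact: measurable_wt.
  exact: measurable_kmod_pow_r.
have mphi : measurable_fun setT phi.
  by apply: measurable_funM; [exact: measurable_wt|exact: measurable_kmod_pow_r].
have f0 u : 0 <= f u by rewrite lee_fin !mulr_ge0 ?wt_ge0 ?powR_ge0.
have phi0 u : (0 <= phi u)%R by rewrite !mulr_ge0 ?wt_ge0 ?powR_ge0.
have Iphi : \int[vol]_u (phi u)%:E = (k1 * rho z `^ (t - s + n%:R + 1))%:E.
  by rewrite integral_wt_kmod// k1E -EFinM mulrC.
have := @jensen_poweR _ _ _ vol setT measurableT f phi p (ltW p1) mf mphi
  (fun u _ => f0 u) (fun u _ => phi0 u).
rewrite Iphi => /(_ (ltry _)) J.
have -> : \int[vol]_u (wt b u * kmod z u `^ (- c) * g u)%:E = \int[vol]_u (f u * (phi u)%:E).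
  apply: eq_integral => u _; rewrite -EFinM; congr EFin.
  have [Tu|Tu] := pselect (TB u); last by rewrite /phi !wt_notin// !mul0r.
  rewrite /phi (_ : (wt b u = wt (b - t) u * wt t u)%R); last by rewrite ppowD subrK.
  have -> : (kmod z u `^ (- c) = kmod z u `^ (s - c) * kmod z u `^ (- s))%R.
    by rewrite -gt0_powRD ?TB_kmod_gt0//; congr (_ `^ _)%R; ring.
  by ring.
apply: le_trans J _; rewrite poweR_EFin; apply: lee_wpmul2l; first by rewrite lee_fin powR_ge0.
apply: ge0_le_integral_nomeas => u _; first by rewrite mule_ge0 ?poweR_ge0 ?lee_fin.
rewrite poweR_EFin -EFinM lee_fin.
have [Tu|Tu] := pselect (TB u); last by rewrite /phi !wt_notin// !mul0r mulr0.
have k0 := TB_kmod_gt0 Tz Tu; have p0 : (p != 0)%R by rewrite gt_eqF//; lra.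
rewrite !powRM ?mulr_ge0 ?wt_ge0 ?powR_ge0// -powRrM /wt ppow_powR// -/(wt _ u) -/(wt _ u).
rewrite /phi le_eqVlt; apply/orP; left; apply/eqP.
rewrite (_ : p * (b - t) + t - al = (b - t) * p + (t - al))%R; last by ring.
rewrite /wt -ppowD (_ : p * (s - c) - s = (s - c) * p + - s)%R; last by ring.
rewrite gt0_powRD// (_ : ppow t (rho u) = ppow (t - al) (rho u) * ppow al (rho u))%R; last first.
  by rewrite ppowD subrK.
by ring.
Qed.

(** After Jensen, the p-th power of the operator is a positive linear integral of g^p. Minkowski
    with exponent q/p >= 1 then reduces the L^q norm in z to a second exact kernel integral, and the
    formula for c makes all powers of rho cancel. *)
Lemma schur_bound (p q a b c al be : R) :
  (1 < p)%R -> (p <= q)%R -> (al + 1 < p * (b + 1))%R -> (- q * a < be + 1)%R ->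
  c = (n%:R + 1 + a + b + ((n%:R + 1 + be) / q - (n%:R + 1 + al) / p))%R ->
  exists2 C : R, (0 < C)%R & forall g : Cn R n -> R,
    measurable_fun setT g -> (forall u, 0 <= g u)%R ->
    \int[vol]_z ((\int[vol]_u (wt b u * kmod z u `^ (- c) * g u)%:E) `^ q * (wt (q * a + be) z)%:E)
    <= (C%:E * (\int[vol]_u (g u `^ p * wt al u)%:E) `^ p^-1) `^ q.
Proof.
move=> p1 pq alb qa cE.
have p0 : (0 < p)%R by lra.
have q0 : (0 < q)%R by lra.
pose r := (q / p)%R.
have r1 : (1 <= r)%R by rewrite ler_pdivlMr// mul1r.
have r0 : (0 < r)%R by lra.
have rp : (r * p = q)%R by rewrite divfK ?gt_eqF.
(* The Jensen measure needs t > -1, and X > 0 needs (p-1) t < p b - al. There is room between the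
   two exactly because al + 1 < p (b+1); t is the midpoint. *)
have [t t1 tb] : exists2 t : R, (-1 < t)%R & ((p - 1) * t < p * b - al)%R.
  exists ((-1 + (p * b - al) / (p - 1)) / 2)%R.
    have : (-1 < (p * b - al) / (p - 1))%R by rewrite ltr_pdivlMr; lra.
    by lra.
  have h : (-1 < (p * b - al) / (p - 1))%R by rewrite ltr_pdivlMr; lra.
  have h2 : ((p * b - al) / (p - 1) * (p - 1) = p * b - al)%R by rewrite divfK// gt_eqF//; lra.
  by nra.
(* The mass of the Jensen measure is k1 rho(z)^(-d), finite for d > 0. Taking d small keeps A > -1
   below, since - q a < be + 1. *)
have [d d0 dq] : exists2 d : R, (0 < d)%R & (r * ((p - 1) * d) < q * a + be + 1)%R.
  have rp0 : (0 < r * (p - 1))%R by rewrite mulr_gt0//; lra.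
  exists ((q * a + be + 1) / (2 * (r * (p - 1))))%R.
    by apply: divr_gt0; [lra|rewrite mulr_gt0].
  rewrite mulrA; set X := (q * a + be + 1)%R; have X0 : (0 < X)%R by rewrite /X; lra.
  rewrite (_ : r * (p - 1) * _ = X / 2)%R; last by field; rewrite gt_eqF//=; lra.
  by lra.
pose s := (t + n%:R + 1 + d)%R.
have [k1 k10 k1E] : exists2 k : R, (0 < k)%R & kapJ m t (- s) = k%:E.
  by apply: kapJ_fine => //; rewrite /s; lra.
pose A := (q * a + be - r * ((p - 1) * d))%R.
pose S := ((p * (s - c) - s) * r)%R.
pose X := (p * (b - t) + t - al)%R.
have X0 : (0 < X)%R by rewrite /X; lra.
(* This is the homogeneity relation expressed by [cE]. As X r > 0 it makes the second kernel
   integral converge, and its value cancels the weight [wt X u]. *)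
have bal : (A + S + n%:R + 1 + X * r = 0)%R.
  rewrite /A /S /X /s cE -rp; move: (n%:R) => N.
  by field; rewrite !gt_eqF.
have [k2 k20 k2E] : exists2 k : R, (0 < k)%R & kapJ m A S = k%:E.
  apply: kapJ_fine; first by rewrite /A; lra.
  by have : (0 < X * r)%R; [rewrite mulr_gt0|lra].
pose c1 := (k1 `^ ((p - 1) * r))%R.
have c10 : (0 < c1)%R by rewrite powR_gt0.
exists ((c1 * k2) `^ q^-1)%R; first by rewrite powR_gt0// mulr_gt0.
move=> g mg g0; pose gp u := (g u `^ p * wt al u)%R.
have gp0 u : (0 <= gp u)%R by rewrite mulr_ge0 ?powR_ge0 ?wt_ge0.
have mgp : measurable_fun setT gp.
  apply: measurable_funM; last exact: measurable_wt.
  by have := measurableT_comp (measurable_powR p) mg.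
(* The exponent A / r unites the output weight with the factor rho(z)^(-d(p-1)) left by Jensen, so
   that the r-th power of [L] carries rho(z)^A. *)
pose L (zu : Cn R n * Cn R n) := (wt (A / r) zu.1 *
  (wt X zu.2 * kmod zu.1 zu.2 `^ (p * (s - c) - s) * gp zu.2))%:E.
have L0 zu : 0 <= L zu by rewrite lee_fin !mulr_ge0 ?wt_ge0 ?powR_ge0.
have mL : measurable_fun setT L.
  apply/measurable_EFinP; apply: measurable_funM; first exact: measurable_wt_fst.
  apply: measurable_funM; last by have := measurableT_comp mgp (@measurable_snd _ _ (Rn R n * Rn R n)%type (Rn R n * Rn R n)%type); exact.
  by apply: measurable_funM; [exact: measurable_wt_snd|exact: measurable_kmod_pow].
have step1 : \int[vol]_z ((\int[vol]_u (wt b u * kmod z u `^ (- c) * g u)%:E) `^ q *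
    (wt (q * a + be) z)%:E) <= c1%:E * \int[vol]_z ((\int[vol]_u L (z, u)) `^ r).
  rewrite -ge0_integralZl//; last 3 first.
  - have := measurable_fun_fubini_tonelli_F (m2 := vol) L mL L0.
    by move=> mI; exact: measurableT_comp (measurable_poweR _) mI.
  - by move=> z _; exact: poweR_ge0.
  - by rewrite lee_fin ltW.
  apply: ge0_le_integral_nomeas => z _; first by rewrite mule_ge0 ?poweR_ge0 ?lee_fin ?wt_ge0.
  have [Tz|Tz] := pselect (TB z); last first.
    by rewrite (wt_notin _ Tz) mule0 mule_ge0 ?poweR_ge0// lee_fin ltW.
  have := integral_kernel_poweR_le b c al p1 k1E k10 Tz mg g0.
  set I := \int[vol]_u _; set J := \int[vol]_u _ => IJ.
  have J0 : 0 <= J by apply: integral_ge0 => u _; rewrite lee_fin !mulr_ge0 ?wt_ge0 ?powR_ge0.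
  have -> : \int[vol]_u L (z, u) = (wt (A / r) z)%:E * J.
    rewrite -ge0_integralZl//; last 3 first.
    - apply/measurable_EFinP; apply: measurable_funM => //.
      by apply: measurable_funM; [exact: measurable_wt|exact: measurable_kmod_pow_r].
    - by move=> u _; rewrite lee_fin !mulr_ge0 ?wt_ge0 ?powR_ge0.
    - by rewrite lee_fin wt_ge0.
  rewrite poweRM ?lee_fin ?wt_ge0// poweR_EFin /wt ppow_powR ?gt_eqF// divfK ?gt_eqF//.
  rewrite -rp mulrC poweRrM.
  have {}IJ : (I `^ p) `^ r <= (((k1 * rho z `^ (t - s + n%:R + 1)) `^ (p - 1))%:E * J) `^ r.
    apply: gt0_ler_poweR => //; rewrite ?(ltW r0)// in_itv /= leey andbT ?poweR_ge0//.
    by rewrite mule_ge0// lee_fin powR_ge0.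
  apply: le_trans (lee_wpmul2r _ IJ) _; first by rewrite lee_fin ppow_ge0.
  rewrite poweRM ?lee_fin ?powR_ge0// poweR_EFin -powRrM powRM ?powR_ge0 ?(ltW k10)//.
  rewrite muleA -EFinM muleAC -EFinM le_eqVlt; apply/orP; left; apply/eqP; congr (_%:E * _).
  rewrite -/c1 -mulrA; congr (_ * _)%R; rewrite -powRrM -ppowE// ppowD; congr ppow.
  by rewrite /A /s -rp; ring.
have step2 : \int[vol]_z ((\int[vol]_u L (z, u)) `^ r) <=
    (\int[vol]_u ((k2 `^ r^-1)%:E * (gp u)%:E)) `^ r.
  apply: minkowski_integral => //.
  - by apply: measurable_funeM; exact/measurable_EFinP.
  - by move=> u; rewrite mule_ge0 ?lee_fin ?powR_ge0.
  - move=> u; have [Tu|Tu] := pselect (TB u); last first.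
      rewrite integral0_eq ?poweR_ge0// => z _.
      by rewrite /L /= (wt_notin _ Tu) mul0r mul0r mulr0 powR0 ?gt_eqF.
    rewrite (_ : \int[vol]_z _ = ((wt X u * gp u) `^ r)%:E *
      \int[vol]_z (wt A z * kmod z u `^ S)%:E).
      rewrite integral_wt_kmod_l// k2E -!EFinM poweR_EFin lee_fin.
      rewrite !powRM ?powR_ge0 ?wt_ge0 ?gp0//.
      rewrite -(powRrM k2) mulVf ?gt_eqF// powRr1 ?(ltW k20)//.
      rewrite /wt ppow_powR ?gt_eqF// ppowE// le_eqVlt; apply/orP; left; apply/eqP.
      rewrite (_ : X * r = - (A + S + n%:R + 1))%R; last by lra.
      rewrite powRN; field; rewrite gt_eqF ?powR_gt0//.
    rewrite -ge0_integralZl//; last 3 first.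
    - have := measurable_fun_pair1 u (measurable_kmod_pow S) => mk.
      by apply/measurable_EFinP; apply: measurable_funM => //; exact: measurable_wt.
    - by move=> z _; rewrite lee_fin mulr_ge0 ?wt_ge0 ?powR_ge0.
    - by rewrite lee_fin powR_ge0.
    apply: eq_integral => z _; rewrite /L /= -EFinM; congr EFin.
    rewrite !powRM ?mulr_ge0 ?wt_ge0 ?powR_ge0 ?gp0// /wt !ppow_powR ?gt_eqF//.
    by rewrite divfK ?gt_eqF// -powRrM -/S; ring.
  - move=> z u /eqP; rewrite mule_eq0 !eqe gt_eqF ?powR_gt0//= => /eqP gu.
    by rewrite /L /= gu !mulr0.
apply: le_trans step1 _.
apply: le_trans (lee_wpmul2l _ step2) _; first by rewrite lee_fin ltW.
rewrite ge0_integralZl//; last 3 first.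
- exact/measurable_EFinP.
- by move=> u _; rewrite lee_fin.
- by rewrite lee_fin powR_ge0.
have I0 : 0 <= \int[vol]_u (gp u)%:E by apply: integral_ge0 => u _; rewrite lee_fin.
rewrite !poweRM ?lee_fin ?powR_ge0 ?poweR_ge0// !poweR_EFin -!powRrM !mulVf ?gt_eqF//.
rewrite !powRr1 ?mulr_ge0 ?(ltW c10) ?(ltW k20)// muleA -EFinM -poweRrM.
by rewrite (_ : p^-1 * q = r)%R// mulrC.
Qed.

End schur.

(** * Mixed-norm estimates for the positive operator *)

Section mixed_estimate.
Context (R : realType) (m : nat).
Local Notation n := m.+1.
Local Notation vol := (@volC R n).
Local Notation CnM := (Rn R n * Rn R n)%type.
Local Open Scope ereal_scope.
Implicit Types z w u : Cn R n.
Variables (p1 q1 q2 a1 a2 b1 b2 c1 c2 al1 al2 be1 be2 : R).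
Variable F : Cn R n * Cn R n -> R.
Hypotheses (mF : measurable_fun setT F) (F0 : forall x, (0 <= F x)%R).

(** The positive operator acts in two stages: [opH] integrates u at fixed eta, [opG] then integrates
    eta. [opP] is the second stage applied to the slice norms [sliceN], the majorant that Minkowski
    produces. The factors rho^a of the operator are moved into the weights q a + be. *)
Definition sliceN (eta : Cn R n) : \bar R :=
  (\int[vol]_u (F (u, eta) `^ p1 * wt al1 u)%:E) `^ p1^-1.

Definition opH (zeta : Cn R n * Cn R n) : \bar R :=
  \int[vol]_u (wt b1 u * kmod zeta.1 u `^ (- c1) * F (u, zeta.2))%:E.

Definition ker2 w (eta : Cn R n) : R := (wt b2 eta * kmod w eta `^ (- c2))%R.

Definition opG z w : \bar R := \int[vol]_eta ((ker2 w eta)%:E * opH (z, eta)).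

Definition opP w : \bar R := \int[vol]_eta ((ker2 w eta)%:E * sliceN eta).

Lemma ker2_ge0 w eta : (0 <= ker2 w eta)%R.
Proof. by rewrite mulr_ge0 ?wt_ge0 ?powR_ge0. Qed.

Lemma sliceN_ge0 eta : 0 <= sliceN eta. Proof. exact: poweR_ge0. Qed.

Lemma opH_ge0 x : 0 <= opH x.
Proof. by apply: integral_ge0 => u _; rewrite lee_fin !mulr_ge0 ?wt_ge0 ?powR_ge0. Qed.

Lemma opP_ge0 w : 0 <= opP w.
Proof. by apply: integral_ge0 => e _; rewrite mule_ge0 ?sliceN_ge0 ?lee_fin ?ker2_ge0. Qed.

Lemma opG_ge0 z w : 0 <= opG z w.
Proof. by apply: integral_ge0 => e _; rewrite mule_ge0 ?opH_ge0 ?lee_fin ?ker2_ge0. Qed.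

Lemma measurable_sliceN : measurable_fun setT sliceN.
Proof.
pose f (x : Cn R n * Cn R n) := (F x `^ p1 * wt al1 x.1)%:E.
have mf : measurable_fun setT f.
  apply/measurable_EFinP; apply: measurable_funM; last exact: measurable_wt_fst.
  by have := measurableT_comp (measurable_powR p1) mF.
have f0 x : 0 <= f x by rewrite lee_fin mulr_ge0 ?powR_ge0 ?wt_ge0.
have mI := measurable_fun_fubini_tonelli_G (m1 := vol) f mf f0.
by have := measurableT_comp (measurable_poweR p1^-1) mI.
Qed.

Lemma measurable_opH : measurable_fun setT opH.
Proof.
pose f (x : (Cn R n * Cn R n) * Cn R n) :=
  (wt b1 x.2 * kmod x.1.1 x.2 `^ (- c1) * F (x.2, x.1.2))%:E.
have mzz : measurable_fun setT (fun x : (CnM * CnM) * CnM => (x.1.1, x.2)).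
  apply: measurable_fun_pair; last exact: measurable_snd.
  by have := measurableT_comp (@measurable_fst _ _ CnM CnM) (@measurable_fst _ _ (CnM * CnM)%type CnM).
have muz : measurable_fun setT (fun x : (CnM * CnM) * CnM => (x.2, x.1.2)).
  apply: measurable_fun_pair; first exact: measurable_snd.
  by have := measurableT_comp (@measurable_snd _ _ CnM CnM) (@measurable_fst _ _ (CnM * CnM)%type CnM).
have mf : measurable_fun setT f.
  apply/measurable_EFinP; apply: measurable_funM; first apply: measurable_funM.
  - by have := measurableT_comp (@measurable_wt R n b1) (@measurable_snd _ _ (CnM * CnM)%type CnM).
  - by have := measurableT_comp (@measurable_kmod_pow R m (- c1)) mzz.
  - by have := measurableT_comp mF muz.
have f0 x : 0 <= f x by rewrite lee_fin !mulr_ge0 ?powR_ge0 ?wt_ge0.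
by have := measurable_fun_fubini_tonelli_F (m2 := vol) f mf f0.
Qed.

Lemma measurable_ker2 : measurable_fun setT (fun x : Cn R n * Cn R n => ker2 x.1 x.2).
Proof.
by apply: measurable_funM; [exact: measurable_wt_snd|exact: measurable_kmod_pow].
Qed.

Lemma measurable_ker2_r w : measurable_fun setT (ker2 w).
Proof. by have := measurable_fun_pair2 w measurable_ker2. Qed.

Lemma measurable_opP : measurable_fun setT opP.
Proof.
pose f (x : Cn R n * Cn R n) := (ker2 x.1 x.2)%:E * sliceN x.2.
have mf : measurable_fun setT f.
  apply: emeasurable_funM; first by apply/measurable_EFinP; exact: measurable_ker2.
  by have := measurableT_comp measurable_sliceN (@measurable_snd _ _ CnM CnM).
have f0 x : 0 <= f x by rewrite mule_ge0 ?sliceN_ge0 ?lee_fin ?ker2_ge0.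
by have := measurable_fun_fubini_tonelli_F (m2 := vol) f mf f0.
Qed.

Lemma measurable_opG : measurable_fun setT (fun x : Cn R n * Cn R n => opG x.1 x.2).
Proof.
pose f (x : (Cn R n * Cn R n) * Cn R n) := (ker2 x.1.2 x.2)%:E * opH (x.1.1, x.2).
have mzz : measurable_fun setT (fun x : (CnM * CnM) * CnM => (x.1.1, x.2)).
  apply: measurable_fun_pair; last exact: measurable_snd.
  by have := measurableT_comp (@measurable_fst _ _ CnM CnM) (@measurable_fst _ _ (CnM * CnM)%type CnM).
have mwe : measurable_fun setT (fun x : (CnM * CnM) * CnM => (x.1.2, x.2)).
  apply: measurable_fun_pair; last exact: measurable_snd.
  by have := measurableT_comp (@measurable_snd _ _ CnM CnM) (@measurable_fst _ _ (CnM * CnM)%type CnM).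
have mf : measurable_fun setT f.
  apply: emeasurable_funM; last by have := measurableT_comp measurable_opH mzz.
  by apply/measurable_EFinP; have := measurableT_comp measurable_ker2 mwe.
have f0 x : 0 <= f x by rewrite mule_ge0 ?opH_ge0 ?lee_fin ?ker2_ge0.
by have := measurable_fun_fubini_tonelli_F (m2 := vol) f mf f0.
Qed.

Lemma opGE z w : opG z w = \int[@volCC R n]_x
  (wt b1 x.1 * kmod z x.1 `^ (- c1) * F x * ker2 w x.2)%:E.
Proof.
have mf : measurable_fun setT (fun x : Cn R n * Cn R n =>
    (wt b1 x.1 * kmod z x.1 `^ (- c1) * F x * ker2 w x.2)%:E).
  apply/measurable_EFinP; apply: measurable_funM; last first.
    by have := measurableT_comp (measurable_ker2_r w) (@measurable_snd _ _ CnM CnM).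
  apply: measurable_funM => //; apply: measurable_funM; first exact: measurable_wt_fst.
  by have := measurableT_comp (measurable_kmod_pow_r (- c1) z) (@measurable_fst _ _ CnM CnM).
have f0 (x : Cn R n * Cn R n) : 0 <= (wt b1 x.1 * kmod z x.1 `^ (- c1) * F x * ker2 w x.2)%:E.
  by rewrite lee_fin !mulr_ge0 ?powR_ge0 ?wt_ge0.
have := @fubini_tonelli2 _ _ CnM CnM R vol vol _ mf f0; rewrite -/(@volCC R n) => ->.
apply: eq_integral => e _; rewrite /opH /fubini_G muleC -ge0_integralZr//; last 3 first.
- apply/measurable_EFinP; apply: measurable_funM; last by have := measurable_fun_pair1 e mF.
  by apply: measurable_funM; [exact: measurable_wt|exact: measurable_kmod_pow_r].
- by move=> u _; rewrite lee_fin !mulr_ge0 ?wt_ge0 ?powR_ge0.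
- by rewrite lee_fin ker2_ge0.
Qed.

(** Supplies the degenerate hypothesis of [minkowski_integral]: where the majorant vanishes, so does
    the integrand. A slice of norm 0 is zero almost everywhere on T_B. *)
Lemma sliceN_eq0_opH z eta : (0 < p1)%R -> sliceN eta = 0 -> opH (z, eta) = 0.
Proof.
move=> p10; have mFe : measurable_fun setT (fun u => F (u, eta)).
  by have := measurable_fun_pair1 eta mF.
have mf : measurable_fun setT (fun u => (F (u, eta) `^ p1 * wt al1 u)%:E).
  apply/measurable_EFinP; apply: measurable_funM; last exact: measurable_wt.
  by have := measurableT_comp (measurable_powR p1) mFe.
have f0 u : 0 <= (F (u, eta) `^ p1 * wt al1 u)%:E by rewrite lee_fin mulr_ge0 ?powR_ge0 ?wt_ge0.
move=> /poweR_eq0_eq0 => /(_ (integral_ge0 _ (fun u _ => f0 u))).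
move=> /(ge0_integral_eq0_ae mf f0) ae0.
rewrite /opH -[RHS](integral0 vol setT); apply: ge0_ae_eq_integral => //.
- apply/measurable_EFinP; apply: measurable_funM => //.
  by apply: measurable_funM; [exact: measurable_wt|exact: measurable_kmod_pow_r].
- by move=> u _; rewrite lee_fin !mulr_ge0 ?wt_ge0 ?powR_ge0.
apply: filterS ae0 => u /(_ Logic.I) /= [] /eqP; rewrite mulf_eq0 => /orP[/eqP/powR_eq0_eq0 Fu|wu] _.
  by rewrite Fu mulr0.
have -> : wt b1 u = 0%R; last by rewrite !mul0r.
have [Tu|Tu] := pselect (TB u); last exact: wt_notin.
by move: wu; rewrite wtE// gt_eqF ?powR_gt0.
Qed.

Lemma opG_bound (C : R) w : (1 <= q1)%R -> (0 < p1)%R -> (0 < C)%R ->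
  (forall eta, \int[vol]_z (opH (z, eta) `^ q1 * (wt (q1 * a1 + be1) z)%:E) <=
               (C%:E * sliceN eta) `^ q1) ->
  \int[vol]_z (opG z w `^ q1 * (wt (q1 * a1 + be1) z)%:E) <= (C%:E * opP w) `^ q1.
Proof.
move=> q11 p10 C0 schurH; have q10 : (0 < q1)%R by lra.
pose e1 := ((q1 * a1 + be1) / q1)%R.
pose L (x : Cn R n * Cn R n) := (wt e1 x.1)%:E * ((ker2 w x.2)%:E * opH x).
pose phi eta := (ker2 w eta)%:E * (C%:E * sliceN eta).
have mL : measurable_fun setT L.
  apply: emeasurable_funM; first by apply/measurable_EFinP; exact: measurable_wt_fst.
  apply: emeasurable_funM; last exact: measurable_opH.
  apply/measurable_EFinP.
  by have := measurableT_comp (measurable_ker2_r w) (@measurable_snd _ _ CnM CnM).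
have mphi : measurable_fun setT phi.
  apply: emeasurable_funM; first by apply/measurable_EFinP; exact: measurable_ker2_r.
  by apply: measurable_funeM; exact: measurable_sliceN.
have L0 x : 0 <= L x by rewrite !mule_ge0 ?opH_ge0 ?lee_fin ?wt_ge0 ?ker2_ge0.
have phi0 e : 0 <= phi e by rewrite !mule_ge0 ?sliceN_ge0 ?lee_fin ?ker2_ge0 ?ltW.
have mH e : measurable_fun setT (fun z => opH (z, e)).
  by have := measurable_fun_pair1 e measurable_opH.
have Lphi e : \int[vol]_z (L (z, e) `^ q1) <= phi e `^ q1.
  rewrite (_ : \int[vol]_z _ = (ker2 w e `^ q1)%:E *
     \int[vol]_z (opH (z, e) `^ q1 * (wt (q1 * a1 + be1) z)%:E)).
    rewrite /phi poweRM ?lee_fin ?ker2_ge0 ?mule_ge0 ?sliceN_ge0 ?lee_fin ?(ltW C0)//.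
    by rewrite poweR_EFin lee_wpmul2l// lee_fin powR_ge0.
  rewrite -(ge0_integralZl _ measurableT); last 3 first.
  - apply: emeasurable_funM; first by have := measurableT_comp (measurable_poweR q1) (mH e).
    by apply/measurable_EFinP; exact: measurable_wt.
  - by move=> z _; rewrite mule_ge0 ?poweR_ge0 ?lee_fin ?wt_ge0.
  - by rewrite lee_fin powR_ge0.
  apply: eq_integral => z _; rewrite /L !poweRM ?mule_ge0 ?opH_ge0 ?lee_fin ?wt_ge0 ?ker2_ge0//.
  rewrite /= /wt ppow_powR ?gt_eqF// /e1 divfK ?gt_eqF//.
  by rewrite muleC -muleA.
have phiL z e : phi e = 0 -> L (z, e) = 0.
  move=> /eqP; rewrite /phi !mule_eq0 !eqe (gt_eqF C0) /= => /orP[/eqP k0|/eqP N0].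
    by rewrite /L /= k0 mul0e mule0.
  by rewrite /L /= (sliceN_eq0_opH z p10 N0) !mule0.
have := @minkowski_integral _ _ CnM CnM R vol vol L phi q1 q11 mL mphi L0 phi0 Lphi phiL.
have -> : \int[vol]_e phi e = C%:E * opP w.
  rewrite -(ge0_integralZl _ measurableT); last 3 first.
  - apply: emeasurable_funM; last exact: measurable_sliceN.
    by apply/measurable_EFinP; exact: measurable_ker2_r.
  - by move=> e _; rewrite mule_ge0 ?sliceN_ge0 ?lee_fin ?ker2_ge0.
  - by rewrite lee_fin ltW.
  by apply: eq_integral => e _; rewrite /phi muleCA.
apply: le_trans; rewrite le_eqVlt; apply/orP; left; apply/eqP; apply: eq_integral => z _.
have -> : \int[vol]_e L (z, e) = (wt e1 z)%:E * opG z w.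
  rewrite -ge0_integralZl//; last 3 first.
  - apply: emeasurable_funM; last by have := measurable_fun_pair2 z measurable_opH.
    by apply/measurable_EFinP; exact: measurable_ker2_r.
  - by move=> e _; rewrite mule_ge0 ?opH_ge0 ?lee_fin ?ker2_ge0.
  - by rewrite lee_fin wt_ge0.
rewrite poweRM ?opG_ge0 ?lee_fin ?wt_ge0// muleC; congr (_ * _).
by rewrite /= /wt ppow_powR ?gt_eqF// /e1 divfK ?gt_eqF.
Qed.

(** Since p2 = 1, the slice norms enter linearly and no Schur weight has to be chosen. By [bal],
    rho(eta)^b2 times the weighted L^q2 norm in w of |rho(w,eta)|^(-c2) is a constant times
    rho(eta)^al2. *)
Lemma opP_bound (k3 : R) : (1 <= q2)%R -> (0 < k3)%R ->
  kapJ m (q2 * a2 + be2) (- c2 * q2) = k3%:E ->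
  (q2 * a2 + be2 + - c2 * q2 + n%:R + 1 + b2 * q2 = al2 * q2)%R ->
  \int[vol]_w (opP w `^ q2 * (wt (q2 * a2 + be2) w)%:E) <=
  ((k3 `^ q2^-1)%:E * \int[vol]_eta (sliceN eta * (wt al2 eta)%:E)) `^ q2.
Proof.
move=> q21 k30 k3E bal; have q20 : (0 < q2)%R by lra.
pose e2 := ((q2 * a2 + be2) / q2)%R.
pose L (x : Cn R n * Cn R n) := (wt e2 x.1 * ker2 x.1 x.2)%:E * sliceN x.2.
pose phi eta := (k3 `^ q2^-1)%:E * (sliceN eta * (wt al2 eta)%:E).
have mL : measurable_fun setT L.
  apply: emeasurable_funM.
    by apply/measurable_EFinP; apply: measurable_funM; [exact: measurable_wt_fst|exact: measurable_ker2].
  by have := measurableT_comp measurable_sliceN (@measurable_snd _ _ CnM CnM).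
have mNw : measurable_fun setT (fun e => sliceN e * (wt al2 e)%:E).
  apply: emeasurable_funM; first exact: measurable_sliceN.
  by apply/measurable_EFinP; exact: measurable_wt.
have mphi : measurable_fun setT phi by exact: measurable_funeM.
have L0 x : 0 <= L x by rewrite !mule_ge0 ?sliceN_ge0// lee_fin mulr_ge0 ?wt_ge0 ?ker2_ge0.
have phi0 e : 0 <= phi e by rewrite !mule_ge0 ?sliceN_ge0 ?lee_fin ?wt_ge0 ?powR_ge0.
have Lphi e : \int[vol]_w (L (w, e) `^ q2) <= phi e `^ q2.
  have [Te|Te] := pselect (TB e); last first.
    rewrite integral0_eq ?poweR_ge0// => w _.
    by rewrite /L /= /ker2 (wt_notin _ Te) mul0r mulr0 mul0e poweR0r// gt_eqF.
  rewrite (_ : \int[vol]_w _ = (sliceN e `^ q2 * (wt (b2 * q2) e)%:E) *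
     \int[vol]_w (wt (q2 * a2 + be2) w * kmod w e `^ (- c2 * q2))%:E).
    rewrite integral_wt_kmod_l// k3E /phi !poweRM ?mule_ge0 ?sliceN_ge0 ?lee_fin ?wt_ge0 ?powR_ge0//.
    rewrite !poweR_EFin -powRrM mulVf ?gt_eqF// powRr1 ?(ltW k30)//.
    rewrite -muleA [X in _ <= X]muleCA; apply: lee_wpmul2l; first exact: poweR_ge0.
    rewrite muleA -!EFinM lee_fin mulrC ler_wpM2l ?(ltW k30)//.
    rewrite /wt ppow_powR ?gt_eqF// -bal -(ppowE _ Te) ppowD.
    by rewrite (addrC (b2 * q2)%R).
  rewrite -ge0_integralZl//; last 3 first.
  - have := measurable_fun_pair1 e (@measurable_kmod_pow R m (- c2 * q2)) => mk.
    by apply/measurable_EFinP; apply: measurable_funM => //; exact: measurable_wt.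
  - by move=> w _; rewrite lee_fin mulr_ge0 ?wt_ge0 ?powR_ge0.
  - by rewrite mule_ge0 ?poweR_ge0 ?lee_fin ?wt_ge0.
  apply: eq_integral => w _; rewrite /L poweRM ?sliceN_ge0//; last first.
    by rewrite lee_fin mulr_ge0 ?wt_ge0 ?ker2_ge0.
  rewrite muleC -muleA; congr (_ * _); rewrite /= -EFinM; congr EFin.
  rewrite /ker2 !powRM ?mulr_ge0 ?wt_ge0 ?powR_ge0// /wt !ppow_powR ?gt_eqF//.
  by rewrite -powRrM /e2 divfK ?gt_eqF//; ring.
have phiL w e : phi e = 0 -> L (w, e) = 0.
  move=> /eqP; rewrite /phi !mule_eq0 !eqe gt_eqF ?powR_gt0//= => /orP[/eqP N0|wu].
    by rewrite /L /= N0 mule0.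
  have Te : ~ TB e by move=> Te; move: wu; rewrite wtE// gt_eqF ?powR_gt0.
  by rewrite /L /= /ker2 (wt_notin _ Te) mul0r mulr0 mul0e.
have := @minkowski_integral _ _ CnM CnM R vol vol L phi q2 q21 mL mphi L0 phi0 Lphi phiL.
have -> : \int[vol]_e phi e = (k3 `^ q2^-1)%:E * \int[vol]_e (sliceN e * (wt al2 e)%:E).
  rewrite -ge0_integralZl//.
  - by move=> e _; rewrite mule_ge0 ?sliceN_ge0 ?lee_fin ?wt_ge0.
  - by rewrite lee_fin powR_ge0.
apply: le_trans; rewrite le_eqVlt; apply/orP; left; apply/eqP; apply: eq_integral => w _.
have -> : \int[vol]_e L (w, e) = (wt e2 w)%:E * opP w.
  rewrite -(ge0_integralZl _ measurableT); last 3 first.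
  - apply: emeasurable_funM; last exact: measurable_sliceN.
    by apply/measurable_EFinP; exact: measurable_ker2_r.
  - by move=> e _; rewrite mule_ge0 ?sliceN_ge0 ?lee_fin ?ker2_ge0.
  - by rewrite lee_fin wt_ge0.
  by apply: eq_integral => e _; rewrite /L EFinM muleA.
rewrite poweRM ?opP_ge0 ?lee_fin ?wt_ge0// muleC; congr (_ * _).
by rewrite /= /wt ppow_powR ?gt_eqF// /e2 divfK ?gt_eqF.
Qed.

End mixed_estimate.

(** * A common real form for the kernels of S and T *)

Section phased_kernels.
Context (R : realType) (m : nat).
Local Notation n := m.+1.
Implicit Types z w u : Cn R n.

(** The principal argument when the real part is positive. The quotient is written with the power -1
    so that measurability follows from that of powers. *)
Definition argr z u : R := atan (im2 z u * re2 z u `^ (-1)).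

Lemma TB_re2_gt0 z u : TB z -> TB u -> 0 < re2 z u.
Proof. by rewrite /TB /= => z0 u0; apply: re2_gt0; lra. Qed.

Lemma Arg_rho2 z u : 0 < re2 z u -> Arg (rho2 z u) = argr z u.
Proof. by move=> r0; rewrite /Arg rho2E /= r0 /argr powR_inv1// ltW. Qed.

Lemma measurable_argr_r z : measurable_fun setT (argr z).
Proof.
have mre := measurable_fun_pair2 z (@measurable_re2 R n).
have mim := measurable_fun_pair2 z (@measurable_im2 R n).
have matan : measurable_fun setT (@atan R).
  by apply: continuous_measurable_fun => x; exact: continuous_atan.
have mV := measurableT_comp (measurable_powR (-1)) mre.
have mM := measurable_funM mim mV.
by have := measurableT_comp matan mM.
Qed.

Definition kfac (b1 b2 c1 c2 : R) z w (x : Cn R n * Cn R n) : R :=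
  rho x.1 `^ b1 * rho x.2 `^ b2 * kmod z x.1 `^ (- c1) * kmod w x.2 `^ (- c2).

Definition phase (e c1 c2 : R) z w (x : Cn R n * Cn R n) : R :=
  e * (c1 * argr z x.1 + c2 * argr w x.2).

(* [S] is the kernel with [e = 0] and [T] the kernel with [e = 1]. *)
Definition phased (e b1 b2 c1 c2 : R)
    (K : cfun R n -> Cn R n -> Cn R n -> Cn R n * Cn R n -> R[i]) : Prop :=
  forall f z w x, TB z -> TB w -> TB x.1 -> TB x.2 ->
  K f z w x = Complex
    (kfac b1 b2 c1 c2 z w x *
      (complex.Re (f x) * cos (phase e c1 c2 z w x) + complex.Im (f x) * sin (phase e c1 c2 z w x)))
    (kfac b1 b2 c1 c2 z w x *
      (complex.Im (f x) * cos (phase e c1 c2 z w x) - complex.Re (f x) * sin (phase e c1 c2 z w x))).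

Lemma phased_S b1 b2 c1 c2 : phased 0 b1 b2 c1 c2 (@Sintegrand R n b1 b2 c1 c2).
Proof.
move=> f z w x Tz Tw T1 T2; rewrite /Sintegrand /phase mul0r cos0 sin0 /kfac !powRN.
have k1 := powR_gt0 c1 (TB_kmod_gt0 Tz T1); have k2 := powR_gt0 c2 (TB_kmod_gt0 Tw T2).
rewrite -/(kmod z x.1) -/(kmod w x.2); case: (f x) => p q.
move: (kmod z x.1 `^ c1) k1 (kmod w x.2 `^ c2) k2 => k1 k10 k2 k20.
move: (rho x.1 `^ b1) (rho x.2 `^ b2) => r1 r2.
have k0 : k1 * k2 != 0 by rewrite gt_eqF// mulr_gt0.
have y0 : Complex (k1 * k2) 0 != 0 by rewrite eq_complex /= (negbTE k0).
apply: (mulIf y0); rewrite divfK//.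
apply/eqP; rewrite eq_complex /=.
by apply/andP; split; apply/eqP; field; rewrite !gt_eqF.
Qed.

Lemma cpow_inv (v : R[i]) (c : R) : 0 < cabs v -> (cpow v c)^-1 =
  Complex (cabs v `^ (- c) * cos (c * Arg v)) (- (cabs v `^ (- c) * sin (c * Arg v))).
Proof.
move=> v0; have vne : v != 0.
  by apply: contraTneq v0 => ->; rewrite /cabs /= !expr0n addr0 sqrtr0 ltxx.
rewrite /cpow (negbTE vne).
have -> : expR (c * ln (cabs v)) = cabs v `^ c by rewrite /powR gt_eqF.
have k0 := powR_gt0 c v0; rewrite powRN; move: (_ `^ c) k0 => k k0.
have cs := cos2Dsin2 (c * Arg v); move: (cos _) (sin _) cs => C S cs.
set y := _ * Complex C S.
have vy : Complex (k^-1 * C) (- (k^-1 * S)) * y = 1.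
  rewrite /y; apply/eqP; rewrite eq_complex /=; apply/andP; split; apply/eqP.
    by rewrite -cs; field; rewrite gt_eqF.
  by field; rewrite gt_eqF.
have y0 : y != 0.
  by apply/eqP => y0; move: vy; rewrite y0 mulr0 => /eqP; rewrite eq_sym oner_eq0.
by apply: (mulIf y0); rewrite vy mulVf.
Qed.

Lemma phased_T b1 b2 c1 c2 : phased 1 b1 b2 c1 c2 (@Tintegrand R n b1 b2 c1 c2).
Proof.
move=> f z w x Tz Tw T1 T2; rewrite /Tintegrand /phase mul1r.
rewrite invfM !cpow_inv -/(kmod _ _) ?TB_kmod_gt0// !Arg_rho2 ?TB_re2_gt0//.
rewrite cosD sinD /kfac -/(kmod z x.1) -/(kmod w x.2); case: (f x) => p q.
move: (kmod z x.1 `^ (- c1)) (kmod w x.2 `^ (- c2)) (rho x.1 `^ b1) (rho x.2 `^ b2) => k1 k2 r1 r2.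
move: (c1 * argr z x.1) (c2 * argr w x.2) => t1 t2.
move: (cos t1) (sin t1) (cos t2) (sin t2) => C1 S1 C2 S2 /=.
by apply/eqP; rewrite eq_complex /=; apply/andP; split; apply/eqP; ring.
Qed.

Lemma measurable_phase e c1 c2 z w : measurable_fun setT (phase e c1 c2 z w).
Proof.
apply: measurable_funM => //; apply: measurable_funD; apply: measurable_funM => //.
  by have := measurableT_comp (measurable_argr_r z)
    (@measurable_fst _ _ (Rn R n * Rn R n)%type (Rn R n * Rn R n)%type).
by have := measurableT_comp (measurable_argr_r w)
  (@measurable_snd _ _ (Rn R n * Rn R n)%type (Rn R n * Rn R n)%type).
Qed.

Lemma measurable_kfac b1 b2 c1 c2 z w : measurable_fun setT (kfac b1 b2 c1 c2 z w).
Proof.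
have mr b := measurableT_comp (measurable_powR b) (@measurable_rho R n).
apply: measurable_funM; first apply: measurable_funM; first apply: measurable_funM.
- by have := measurableT_comp (mr b1) (@measurable_fst _ _ (Rn R n * Rn R n)%type (Rn R n * Rn R n)%type).
- by have := measurableT_comp (mr b2) (@measurable_snd _ _ (Rn R n * Rn R n)%type (Rn R n * Rn R n)%type).
- by have := measurableT_comp (measurable_kmod_pow_r (- c1) z)
    (@measurable_fst _ _ (Rn R n * Rn R n)%type (Rn R n * Rn R n)%type).
- by have := measurableT_comp (measurable_kmod_pow_r (- c2) w)
    (@measurable_snd _ _ (Rn R n * Rn R n)%type (Rn R n * Rn R n)%type).
Qed.

Lemma kfac_ge0 b1 b2 c1 c2 z w x : 0 <= kfac b1 b2 c1 c2 z w x.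
Proof. by rewrite !mulr_ge0 ?powR_ge0. Qed.

Lemma measurable_TB2 : measurable (@TB R n `*` @TB R n).
Proof. by apply: measurableX; exact: measurable_TB. Qed.

Section phased_integrand.
Variables (e b1 b2 c1 c2 : R) (K : cfun R n -> Cn R n -> Cn R n -> Cn R n * Cn R n -> R[i]).
Hypothesis phK : phased e b1 b2 c1 c2 K.
Variable f : cfun R n.
Hypothesis mRe : measurable_fun (@TB R n `*` @TB R n) (fun x => @complex.Re R (f x)).
Hypothesis mIm : measurable_fun (@TB R n `*` @TB R n) (fun x => @complex.Im R (f x)).

Lemma measurable_phased_Re z w : TB z -> TB w ->
  measurable_fun (@TB R n `*` @TB R n) (fun x => @complex.Re R (K f z w x)).
Proof.
move=> Tz Tw.
have mcos : measurable_fun setT (@cos R) by apply: continuous_measurable_fun; exact: continuous_cos.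
have msin : measurable_fun setT (@sin R) by apply: continuous_measurable_fun; exact: continuous_sin.
have mc := measurable_funTS (measurableT_comp mcos (measurable_phase e c1 c2 z w)).
have ms := measurable_funTS (measurableT_comp msin (measurable_phase e c1 c2 z w)).
have mk := measurable_funTS (measurable_kfac b1 b2 c1 c2 z w).
have mm := measurable_funM (mk _) (measurable_funD (measurable_funM mRe (mc _)) (measurable_funM mIm (ms _))).
apply: (eq_measurable_fun _ _ mm) => x /set_mem [T1 T2] /=.
by rewrite phK.
Qed.

Lemma measurable_phased_Im z w : TB z -> TB w ->
  measurable_fun (@TB R n `*` @TB R n) (fun x => @complex.Im R (K f z w x)).
Proof.
move=> Tz Tw.
have mcos : measurable_fun setT (@cos R) by apply: continuous_measurable_fun; exact: continuous_cos.
have msin : measurable_fun setT (@sin R) by apply: continuous_measurable_fun; exact: continuous_sin.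
have mc := measurable_funTS (measurableT_comp mcos (measurable_phase e c1 c2 z w)).
have ms := measurable_funTS (measurableT_comp msin (measurable_phase e c1 c2 z w)).
have mk := measurable_funTS (measurable_kfac b1 b2 c1 c2 z w).
have mm := measurable_funM (mk _) (measurable_funB (measurable_funM mIm (mc _)) (measurable_funM mRe (ms _))).
apply: (eq_measurable_fun _ _ mm) => x /set_mem [T1 T2] /=.
by rewrite phK.
Qed.

Lemma norm_dot_le (p q c s : R) : c ^+ 2 + s ^+ 2 = 1 ->
  `|p * c + q * s| <= Num.sqrt (p ^+ 2 + q ^+ 2).
Proof.
move=> cs; rewrite -sqrtr_sqr ler_wsqrtr//.
rewrite (_ : p ^+ 2 + q ^+ 2 = (p ^+ 2 + q ^+ 2) * (c ^+ 2 + s ^+ 2)); last by rewrite cs mulr1.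
by have := sqr_ge0 (p * s - q * c); nra.
Qed.

Lemma phased_Re_le z w x : TB z -> TB w -> TB x.1 -> TB x.2 ->
  `|@complex.Re R (K f z w x)| <= kfac b1 b2 c1 c2 z w x * cabs (f x).
Proof.
move=> Tz Tw T1 T2; rewrite phK//= normrM ger0_norm ?kfac_ge0// ler_wpM2l ?kfac_ge0//.
exact/norm_dot_le/cos2Dsin2.
Qed.

Lemma phased_Im_le z w x : TB z -> TB w -> TB x.1 -> TB x.2 ->
  `|@complex.Im R (K f z w x)| <= kfac b1 b2 c1 c2 z w x * cabs (f x).
Proof.
move=> Tz Tw T1 T2; rewrite phK//= normrM ger0_norm ?kfac_ge0// ler_wpM2l ?kfac_ge0//.
rewrite -mulrN /cabs [X in _ <= Num.sqrt X]addrC; apply: norm_dot_le.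
by rewrite sqrrN cos2Dsin2.
Qed.

End phased_integrand.

Definition absx (f : cfun R n) : Cn R n * Cn R n -> R :=
  (fun x => cabs (f x)) \_ (@TB R n `*` @TB R n).

Lemma cabs_ge0 (v : R[i]) : 0 <= cabs v. Proof. exact: sqrtr_ge0. Qed.

Lemma absx_ge0 f x : 0 <= absx f x.
Proof. by rewrite /absx patchE; case: ifP => // _; exact: cabs_ge0. Qed.

Lemma absxE f x : TB x.1 -> TB x.2 -> absx f x = cabs (f x).
Proof. by move=> T1 T2; rewrite /absx patchE mem_set. Qed.

Lemma measurable_absx f :
  measurable_fun (@TB R n `*` @TB R n) (fun x => @complex.Re R (f x)) ->
  measurable_fun (@TB R n `*` @TB R n) (fun x => @complex.Im R (f x)) ->
  measurable_fun setT (absx f).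
Proof.
move=> mRe mIm; apply/(measurable_restrictT _ _).1; first exact: measurable_TB2.
have ms : measurable_fun (@TB R n `*` @TB R n)
    (fun x => @complex.Re R (f x) ^+ 2 + @complex.Im R (f x) ^+ 2).
  by apply: measurable_funD; apply: measurable_funX.
have := measurableT_comp (measurable_powR 2^-1) ms; apply: eq_measurable_fun => x _ /=.
by rewrite powR12_sqrt// addr_ge0 ?sqr_ge0.
Qed.

Local Open Scope ereal_scope.
Local Notation vol := (@volC R n).

Lemma mixnormE (p1 p2 al1 al2 : R) f : mixnorm p1 p2 al1 al2 f =
  (\int[vol]_w ((\int[vol]_z (absx f (z, w) `^ p1 * wt al1 z)%:E) `^ (p2 / p1)
     * (wt al2 w)%:E)) `^ p2^-1.
Proof.
rewrite /mixnorm; congr (_ `^ _); apply: ge0_integral_setT_patch => w Tw; last first.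
  by rewrite (wt_notin _ Tw) mule0.
rewrite (wtE _ Tw); congr (_ `^ _ * _); apply: ge0_integral_setT_patch => z Tz; last first.
  by rewrite (wt_notin _ Tz) mulr0.
by rewrite absxE// wtE.
Qed.

(** [fine] sends infinite values to 0, so the bound holds also where the integral of h is
    infinite. *)
Lemma fine_integral_le d (T : measurableType d) (mu : {measure set T -> \bar R})
    (D : set T) (h : T -> R) (g : T -> \bar R) : measurable D ->
  measurable_fun D h -> (forall x, D x -> `|h x|%:E <= g x) ->
  `|fine (\int[mu]_(x in D) (h x)%:E)|%:E <= \int[mu]_(x in D) g x.
Proof.
move=> mD mh hg.
have mhE : measurable_fun D (fun x => (h x)%:E) by exact/measurable_EFinP.
apply: (@le_trans _ _ `|\int[mu]_(x in D) (h x)%:E|).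
  by case: (\int[mu]_(x in D) (h x)%:E) => [r||] //=; rewrite ?normr0 ?leey.
apply: le_trans (le_abse_integral mu mD mhE) _.
by apply: ge0_le_integral_nomeas.
Qed.

Lemma cabs_le (x y : R) : (cabs (Complex x y) <= `|x| + `|y|)%R.
Proof.
rewrite /cabs /= -[leRHS]ger0_norm ?addr_ge0// -sqrtr_sqr ler_wsqrtr//.
rewrite sqrrD !real_normK ?num_real// -addrA [(_ *+ 2 + _)%R]addrC addrA lerDl.
by rewrite mulrn_wge0// mulr_ge0.
Qed.

Lemma cabsM_real (a : R) (v : R[i]) : (0 <= a)%R -> cabs (Complex a 0 * v)%R = (a * cabs v)%R.
Proof.
case: v => x y a0; rewrite /cabs /= !mul0r subr0 addr0 !exprMn -mulrDr.
by rewrite sqrtrM ?sqr_ge0// sqrtr_sqr ger0_norm.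
Qed.

(** The weight is taken inside the power as rho^(e/q); it is positive on T_B only, hence finiteness
    is concluded only there. *)
Lemma ae_lty_weighted (P : Cn R n -> \bar R) (q e : R) : (0 < q)%R ->
  measurable_fun setT P -> (forall w, 0 <= P w) ->
  \int[vol]_w (P w `^ q * (wt e w)%:E) < +oo ->
  {ae vol, forall w, TB w -> P w < +oo}.
Proof.
move=> q0 mP P0 IP.
have mf : measurable_fun setT (fun w => (wt (e / q) w)%:E * P w).
  by apply: emeasurable_funM => //; apply/measurable_EFinP; exact: measurable_wt.
have : \int[vol]_w (((wt (e / q) w)%:E * P w) `^ q) < +oo.
  rewrite (eq_integral (fun w => P w `^ q * (wt e w)%:E))// => w _.
  rewrite poweRM ?lee_fin ?wt_ge0// muleC; congr (_ * _).
  by rewrite /= /wt ppow_powR ?gt_eqF// divfK ?gt_eqF.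
move=> /(ae_lty_of_integral_poweR q0 mf); apply: filterS => w wP Tw.
rewrite ltey; apply/eqP => Py; move: wP.
by rewrite Py gt0_muley ?ltxx// lte_fin wtE// powR_gt0.
Qed.

End phased_kernels.

Lemma lee_poweR (R : realType) (r : R) (x y : \bar R) :
  0 <= r -> (0 <= x -> x <= y -> x `^ r <= y `^ r)%E.
Proof.
move=> r0 x0 xy; have y0 := le_trans x0 xy.
by apply: gt0_ler_poweR => //; rewrite in_itv /= leey andbT.
Qed.

Lemma ge0_le_integral_sub d (T : measurableType d) (R : realType)
    (mu : {measure set T -> \bar R}) (D : set T) (f g : T -> \bar R) :
  (forall x, D x -> 0 <= f x)%E -> (forall x, 0 <= g x)%E -> (forall x, D x -> f x <= g x)%E ->
  (\int[mu]_(x in D) f x <= \int[mu]_x g x)%E.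
Proof.
move=> f0 g0 fg; rewrite integral_mkcond; apply: ge0_le_integral_nomeas => x _; rewrite patchE.
  by case: ifPn => // /set_mem; exact: f0.
by case: ifPn => // /set_mem; exact: fg.
Qed.

(** * Sufficiency of the conditions *)

Section sufficiency.
Context (R : realType) (m : nat).
Local Notation n := m.+1.
Local Notation vol := (@volC R n).
Local Notation TB2 := (@TB R n `*` @TB R n).
Local Open Scope ereal_scope.
Implicit Types z w u : Cn R n.

Section operator_pointwise.
Variables (e b1 b2 c1 c2 : R) (K : cfun R n -> Cn R n -> Cn R n -> Cn R n * Cn R n -> R[i]).
Hypothesis phK : phased e b1 b2 c1 c2 K.
Variable f : cfun R n.
Hypothesis mRe : measurable_fun TB2 (fun x => @complex.Re R (f x)).
Hypothesis mIm : measurable_fun TB2 (fun x => @complex.Im R (f x)).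

Let G z w := opG b1 b2 c1 c2 (absx f) z w.

Lemma integral_kfac_cabs z w :
  \int[@volCC R n]_(x in TB2) (kfac b1 b2 c1 c2 z w x * cabs (f x))%:E = G z w.
Proof.
rewrite /G opGE; [|exact: measurable_absx|exact: absx_ge0].
apply: ge0_integral_setT_patch => x; last first.
  by move=> xT; rewrite /absx patchE memNset// mulr0 mul0r.
move=> [T1 T2]; rewrite absxE// /ker2 !wtE// /kfac; congr EFin.
move: (_ `^ b1)%R (_ `^ b2)%R (kmod z x.1 `^ _)%R (kmod w x.2 `^ _)%R (cabs _) => r1 r2 k1 k2 v.
by ring.
Qed.

(** The constant 2 comes from estimating the real and the imaginary part separately. *)
Lemma cabs_cint_le z w : TB z -> TB w ->
  (cabs (cint (@volCC R n) TB2 (K f z w)))%:E <= 2%:E * G z w.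
Proof.
move=> Tz Tw; rewrite /cint.
apply: (@le_trans _ _ (`|fine (\int[@volCC R n]_(x in TB2) (@complex.Re R (K f z w x))%:E)|%:E +
  `|fine (\int[@volCC R n]_(x in TB2) (@complex.Im R (K f z w x))%:E)|%:E)).
  by rewrite -EFinD lee_fin cabs_le.
rewrite (_ : 2%:E * G z w = G z w + G z w); last first.
  by rewrite -[in RHS](mul1e (G z w)) -ge0_muleDl ?lee_fin// -EFinD.
rewrite -integral_kfac_cabs; apply: leeD; apply: fine_integral_le => //.
- exact: measurable_TB2.
- exact: (measurable_phased_Re phK).
- by move=> x [T1 T2]; rewrite lee_fin; exact: (phased_Re_le phK).
- exact: measurable_TB2.
- exact: (measurable_phased_Im phK).
- by move=> x [T1 T2]; rewrite lee_fin; exact: (phased_Im_le phK).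
Qed.

Lemma cintegrable_phased z w : TB z -> TB w -> G z w < +oo ->
  cintegrable (@volCC R n) TB2 (K f z w).
Proof.
move=> Tz Tw Gy; split; apply/integrableP; split.
- by apply/measurable_EFinP; exact: (measurable_phased_Re phK).
- apply: le_lt_trans Gy; rewrite -integral_kfac_cabs.
  apply: ge0_le_integral_nomeas => x //= [T1 T2]; rewrite lee_fin.
  exact: (phased_Re_le phK).
- by apply/measurable_EFinP; exact: (measurable_phased_Im phK).
- apply: le_lt_trans Gy; rewrite -integral_kfac_cabs.
  apply: ge0_le_integral_nomeas => x //= [T1 T2]; rewrite lee_fin.
  exact: (phased_Im_le phK).
Qed.

End operator_pointwise.

Lemma bounded_of_conditions (e p1 q1 q2 a1 a2 b1 b2 c1 c2 al1 al2 be1 be2 : R)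
    (K : cfun R n -> Cn R n -> Cn R n -> Cn R n * Cn R n -> R[i]) :
  phased e b1 b2 c1 c2 K -> (1 < p1)%R -> (p1 <= q1)%R -> (p1 <= q2)%R ->
  (al1 + 1 < p1 * (b1 + 1))%R -> (al2 < b2)%R ->
  (- q1 * a1 < be1 + 1)%R -> (- q2 * a2 < be2 + 1)%R ->
  c1 = (n%:R + 1 + a1 + b1 + ((n%:R + 1 + be1) / q1 - (n%:R + 1 + al1) / p1))%R ->
  c2 = (n%:R + 1 + a2 + b2 + ((n%:R + 1 + be2) / q2 - (n%:R + 1 + al2)))%R ->
  bounded_op a1 a2 K p1 1 al1 al2 q1 q2 be1 be2.
Proof.
move=> phK p11 p1q1 p1q2 cb1 cb2 ca1 ca2 c1E c2E.
have q11 : (1 <= q1)%R by lra.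
have q21 : (1 <= q2)%R by lra.
have p10 : (0 < p1)%R by lra.
have q10 : (0 < q1)%R by lra.
have q20 : (0 < q2)%R by lra.
have [C C0 schurC] := schur_bound p11 p1q1 cb1 ca1 c1E.
have bal : (q2 * a2 + be2 + - c2 * q2 + n%:R + 1 + b2 * q2 = al2 * q2)%R.
  by rewrite c2E; move: (n%:R) => N; field; rewrite gt_eqF.
(* By [bal] the exponent that must be negative is (al2 - b2) q2. *)
have [k3 k30 k3E] : exists2 k : R, (0 < k)%R & kapJ m (q2 * a2 + be2) (- c2 * q2) = k%:E.
  apply: kapJ_fine; first by lra.
  by have : (al2 * q2 < b2 * q2)%R; [rewrite ltr_pM2r|lra].
pose kk := (k3 `^ q2^-1)%R.
have kk0 : (0 < kk)%R by rewrite powR_gt0.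
(* The factors are those of [cabs_cint_le], of the Schur test in the first variable, and of the
   kernel norm in the second. *)
exists (2 * C * kk)%R => f [mRe [mIm fy]].
pose F := absx f.
have mF : measurable_fun setT F by exact: measurable_absx.
have F0 x : (0 <= F x)%R by exact: absx_ge0.
pose P w := opP p1 b2 c2 al1 F w.
pose G z w := opG b1 b2 c1 c2 F z w.
have mixE : mixnorm p1 1 al1 al2 f = \int[vol]_eta (sliceN p1 al1 F eta * (wt al2 eta)%:E).
  rewrite mixnormE invr1 poweRe1; last first.
    by apply: integral_ge0 => w _; rewrite mule_ge0 ?poweR_ge0 ?lee_fin ?wt_ge0.
  by apply: eq_integral => w _; rewrite mul1r.
have HP : \int[vol]_w (P w `^ q2 * (wt (q2 * a2 + be2) w)%:E) <=
    (kk%:E * mixnorm p1 1 al1 al2 f) `^ q2.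
  by rewrite mixE; exact: opP_bound.
have schurH eta : \int[vol]_z (opH b1 c1 F (z, eta) `^ q1 * (wt (q1 * a1 + be1) z)%:E) <=
    (C%:E * sliceN p1 al1 F eta) `^ q1.
  have mFe : measurable_fun setT (fun u : Cn R n => F (u, eta)).
    by have := measurable_fun_pair1 eta mF.
  exact: (schurC (fun u => F (u, eta)) mFe (fun u => F0 (u, eta))).
have HG w : \int[vol]_z (G z w `^ q1 * (wt (q1 * a1 + be1) z)%:E) <= (C%:E * P w) `^ q1.
  apply: (opG_bound b2 c2 mF F0 w q11 p10 C0 schurH).
have P0 w : 0 <= P w by exact: opP_ge0.
have G0 z w : 0 <= G z w by exact: opG_ge0.
have mP : measurable_fun setT P by exact: measurable_opP.
have mG : measurable_fun setT (fun x : Cn R n * Cn R n => G x.1 x.2) by exact: measurable_opG.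
split.
  (* Divergence forces [G] to be infinite. Finite norms make [P w] finite for almost every w, then
     [G z w] finite for almost every z, so almost every section of [N0] is null. *)
  pose N0 := TB2 `&` [set x : Cn R n * Cn R n | G x.1 x.2 = +oo].
  have mN0 : measurable N0.
    apply: measurableI; first exact: measurable_TB2.
    have := mG measurableT [set +oo] (emeasurable_set1 _); rewrite setTI.
    by congr measurable.
  apply: (@negligibleS _ _ _ (@volCC R n) N0).
    move=> [z w] /= [[Tz Tw] nint]; split => //=.
    apply/eqP/negPn/negP => Gne; apply: nint.
    apply: (cintegrable_phased phK) => //; rewrite ltey; exact: Gne.
  apply/negligibleP => //.
  apply: (product_null_of_sections (mu := vol) (nu := vol) mN0).
  have Py : {ae vol, forall w, TB w -> P w < +oo}.
    apply: (ae_lty_weighted q20 mP P0); apply: le_lt_trans HP _.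
    by apply: poweR_lty; rewrite lte_mul_pinfty ?lee_fin// ltW.
  apply: filterS Py => w Pw.
  have [Tw|Tw] := pselect (TB w); last first.
    by apply: nearW => z [[_ /=]].
  have mGw : measurable_fun setT (fun z => G z w) by have := measurable_fun_pair1 w mG.
  have : {ae vol, forall z, TB z -> G z w < +oo}.
    apply: (ae_lty_weighted q10 mGw (fun z => G0 z w)); apply: le_lt_trans (HG w) _.
    by apply: poweR_lty; rewrite lte_mul_pinfty ?lee_fin ?(ltW C0)// Pw.
  by apply: filterS => z Gz [[/= Tz _] /= Gy]; move: (Gz Tz); rewrite Gy ltxx.
have mixf0 : 0 <= mixnorm p1 1 al1 al2 f by exact: poweR_ge0.
have inner w : TB w -> \int[vol]_(z in @TB R n)
    (cabs (intop a1 a2 K f (z, w)) `^ q1 * rho z `^ be1)%:E <=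
    ((2 * rho w `^ a2 * C)%:E * P w) `^ q1.
  move=> Tw; apply: (@le_trans _ _ (\int[vol]_z (((2 * rho w `^ a2) `^ q1)%:E *
      (G z w `^ q1 * (wt (q1 * a1 + be1) z)%:E)))).
    rewrite integral_mkcond; apply: ge0_le_integral_nomeas => z _.
      by rewrite patchE; case: ifP => // _; rewrite lee_fin mulr_ge0 ?powR_ge0.
    rewrite patchE; case: ifPn => [/set_mem Tz|_]; last first.
      by rewrite !mule_ge0 ?poweR_ge0 ?lee_fin ?powR_ge0 ?wt_ge0.
    rewrite /intop /= cabsM_real ?mulr_ge0 ?powR_ge0//.
    have := cabs_cint_le phK mRe mIm Tz Tw; rewrite -/F -/(G z w).
    set cc := cabs _ => ccG.
    have cc0 : (0 <= cc)%R by exact: cabs_ge0.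
    have : (cc `^ q1)%:E <= (2 `^ q1)%:E * G z w `^ q1.
      rewrite -!poweR_EFin -poweRM ?lee_fin//.
      by apply: lee_poweR => //; rewrite ltW.
    move=> /(lee_wpmul2l (x := (rho z `^ (q1 * a1 + be1) * rho w `^ (a2 * q1))%:E)).
    rewrite lee_fin mulr_ge0 ?powR_ge0// => /(_ isT).
    rewrite -EFinM => h.
    rewrite [X in X%:E <= _](_ : _ =
      rho z `^ (q1 * a1 + be1) * rho w `^ (a2 * q1) * cc `^ q1)%R; last first.
      rewrite !powRM ?mulr_ge0 ?powR_ge0// -!powRrM (mulrC q1) gt0_powRD//.
      by ring.
    apply: le_trans h _; rewrite (wtE _ Tz) le_eqVlt; apply/orP; left; apply/eqP.
    rewrite powRM ?powR_ge0// -powRrM; set g := G z w `^ q1.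
    rewrite muleA -EFinM [g * _]muleC [RHS]muleA -[in RHS]EFinM; congr (_%:E * _).
    by ring.
  rewrite ge0_integralZl//; last 3 first.
  - apply: emeasurable_funM; last by apply/measurable_EFinP; exact: measurable_wt.
    have mGw : measurable_fun setT (fun z => G z w) by have := measurable_fun_pair1 w mG.
    by have := measurableT_comp (measurable_poweR q1) mGw.
  - by move=> z _; rewrite mule_ge0 ?poweR_ge0 ?lee_fin ?wt_ge0.
  - by rewrite lee_fin powR_ge0.
  apply: le_trans (lee_wpmul2l _ (HG w)) _; first by rewrite lee_fin powR_ge0.
  by rewrite -poweR_EFin -poweRM ?mule_ge0 ?lee_fin ?mulr_ge0 ?powR_ge0 ?(ltW C0)// muleA -EFinM.
rewrite {1}/mixnorm.
apply: (@le_trans _ _ ((((2 * C) `^ q2)%:E *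
    \int[vol]_w (P w `^ q2 * (wt (q2 * a2 + be2) w)%:E)) `^ q2^-1)).
  apply: lee_poweR; first by rewrite invr_ge0 ltW.
    by apply: integral_ge0 => w _; apply: mule_ge0; [exact: poweR_ge0|rewrite lee_fin; exact: powR_ge0].
  rewrite -ge0_integralZl//; last 3 first.
  - apply: emeasurable_funM; last by apply/measurable_EFinP; exact: measurable_wt.
    by have := measurableT_comp (measurable_poweR q2) mP.
  - by move=> w _; rewrite mule_ge0 ?poweR_ge0 ?lee_fin ?wt_ge0.
  - by rewrite lee_fin powR_ge0.
  apply: ge0_le_integral_sub => w.
  - by move=> _; apply: mule_ge0; [exact: poweR_ge0|rewrite lee_fin; exact: powR_ge0].
  - by rewrite !mule_ge0 ?poweR_ge0 ?lee_fin ?powR_ge0 ?wt_ge0.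
  move=> Tw.
  have h : (\int[vol]_(z in @TB R n)
      (cabs (intop a1 a2 K f (z, w)) `^ q1 * rho z `^ be1)%:E) `^ (q2 / q1) <=
      (((2 * rho w `^ a2 * C)%:E * P w) `^ q1) `^ (q2 / q1).
    apply: lee_poweR; last exact: inner.
      by rewrite divr_ge0 ?ltW.
    by apply: integral_ge0 => z _; rewrite lee_fin; apply: mulr_ge0; exact: powR_ge0.
  apply: le_trans (lee_wpmul2r _ h) _; first by rewrite lee_fin powR_ge0.
  have qE : (q1 * (q2 / q1) = q2)%R by field; rewrite gt_eqF.
  rewrite -poweRrM qE poweRM ?lee_fin ?mulr_ge0 ?powR_ge0 ?(ltW C0)//.
  rewrite poweR_EFin (wtE _ Tw) muleAC -EFinM le_eqVlt; apply/orP; left; apply/eqP.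
  rewrite muleC [RHS]muleCA; congr (_ * _).
  rewrite -EFinM; congr EFin; rewrite !powRM ?mulr_ge0 ?powR_ge0 ?(ltW C0)// -powRrM.
  by rewrite gt0_powRD// (mulrC q2); ring.
apply: (@le_trans _ _ ((((2 * C) `^ q2)%:E *
    (kk%:E * mixnorm p1 1 al1 al2 f) `^ q2) `^ q2^-1)).
  apply: lee_poweR; first by rewrite invr_ge0 ltW.
    rewrite mule_ge0 ?lee_fin ?powR_ge0//.
    by apply: integral_ge0 => w _; rewrite mule_ge0 ?poweR_ge0 ?lee_fin ?wt_ge0.
  by apply: lee_wpmul2l => //; rewrite lee_fin powR_ge0.
have kf0 : 0 <= kk%:E * mixnorm p1 1 al1 al2 f by rewrite mule_ge0 ?lee_fin ?(ltW kk0).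
rewrite -poweR_EFin -poweRM ?lee_fin ?mulr_ge0 ?(ltW C0)//.
rewrite -poweRrM mulfV ?gt_eqF// poweRe1; last by rewrite mule_ge0 ?lee_fin ?mulr_ge0 ?(ltW C0).
by rewrite muleA -EFinM.
Qed.

End sufficiency.

(** * Stability of modulus and argument in the right half-plane *)

Section polar_angle.
Context (R : realType).
Implicit Types a b t x d : R.

Lemma sin_atan x : sin (atan x) = x * cos (atan x).
Proof.
have c0 : cos (atan x) != 0.
  rewrite gt_eqF// cos_atan invr_gt0 sqrtr_gt0.
  by have := sqr_ge0 x; lra.
by rewrite -{2}(atanK x) /tan divfK.
Qed.

Lemma polar_cos a b : 0 < a -> Num.sqrt (a ^+ 2 + b ^+ 2) * cos (atan (b / a)) = a.
Proof.
move=> a0; rewrite cos_atan.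
have -> : a ^+ 2 + b ^+ 2 = a ^+ 2 * (1 + (b / a) ^+ 2) by field; rewrite gt_eqF.
rewrite sqrtrM ?sqr_ge0// sqrtr_sqr gtr0_norm// mulfK// gt_eqF// sqrtr_gt0.
by have := sqr_ge0 (b / a); lra.
Qed.

Lemma polar_sin a b : 0 < a -> Num.sqrt (a ^+ 2 + b ^+ 2) * sin (atan (b / a)) = b.
Proof.
by move=> a0; rewrite sin_atan mulrCA polar_cos// divfK// gt_eqF.
Qed.

(** Law of cosines: if C is the cosine of the angle between the two points, then k^2 + k0^2 - 2 k k0
    C is their squared distance, at most 2 d^2 k0^2. With C <= 1 this gives |k - k0| <= k0 / 2, and
    then the lower bound on C. *)
Lemma polar_close a b a0 b0 d : 0 < a -> 0 < a0 -> 0 <= d -> d <= 4^-1 ->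
  `|a - a0| <= d * a0 -> `|b - b0| <= d * a0 ->
  [/\ 2^-1 * Num.sqrt (a0 ^+ 2 + b0 ^+ 2) <= Num.sqrt (a ^+ 2 + b ^+ 2),
      Num.sqrt (a ^+ 2 + b ^+ 2) <= 2 * Num.sqrt (a0 ^+ 2 + b0 ^+ 2) &
      1 - 2 * d ^+ 2 <= cos (atan (b / a) - atan (b0 / a0))].
Proof.
move=> a_gt0 a0_gt0 d0 d4 da db.
have := polar_cos b a_gt0; have := polar_sin b a_gt0.
have := polar_cos b0 a0_gt0; have := polar_sin b0 a0_gt0.
rewrite cosB; have := cos2Dsin2 (atan (b / a)); have := cos2Dsin2 (atan (b0 / a0)).
have k_gt0 : 0 < Num.sqrt (a ^+ 2 + b ^+ 2).
  by rewrite sqrtr_gt0; have := sqr_ge0 b; have := exprn_gt0 2 a_gt0; lra.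
have k0_gt0 : 0 < Num.sqrt (a0 ^+ 2 + b0 ^+ 2).
  by rewrite sqrtr_gt0; have := sqr_ge0 b0; have := exprn_gt0 2 a0_gt0; lra.
move: (Num.sqrt (a ^+ 2 + b ^+ 2)) (Num.sqrt (a0 ^+ 2 + b0 ^+ 2)) k_gt0 k0_gt0 => k k0 k_gt0 k0_gt0.
move: (cos (atan (b / a))) (sin (atan (b / a))) => c s.
move: (cos (atan (b0 / a0))) (sin (atan (b0 / a0))) => c0 s0 cs0 cs bE aE bE' aE'.
have da2 : (a - a0) ^+ 2 <= (d * a0) ^+ 2.
  by rewrite -real_normK ?num_real// ler_pXn2r// nnegrE ?mulr_ge0// ltW.
have db2 : (b - b0) ^+ 2 <= (d * a0) ^+ 2.
  by rewrite -real_normK ?num_real// ler_pXn2r// nnegrE ?mulr_ge0// ltW.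
have a0k0 : a0 ^+ 2 <= k0 ^+ 2.
  rewrite -aE exprMn -[leRHS]mulr1 -cs0; apply: ler_wpM2l; first exact: sqr_ge0.
  by rewrite lerDl sqr_ge0.
pose C := c * c0 + s * s0.
have law : k ^+ 2 + k0 ^+ 2 - 2 * (k * k0 * C) <= 2 * d ^+ 2 * k0 ^+ 2.
  have -> : k ^+ 2 + k0 ^+ 2 - 2 * (k * k0 * C) = (a - a0) ^+ 2 + (b - b0) ^+ 2.
    have kE : k ^+ 2 = k ^+ 2 * (c ^+ 2 + s ^+ 2) by rewrite cs mulr1.
    have k0E : k0 ^+ 2 = k0 ^+ 2 * (c0 ^+ 2 + s0 ^+ 2) by rewrite cs0 mulr1.
    by rewrite kE k0E -aE' -bE' -aE -bE /C; ring.
  apply: (@le_trans _ _ (2 * d ^+ 2 * a0 ^+ 2)); first by rewrite exprMn in da2 db2; lra.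
  by apply: ler_wpM2l => //; rewrite mulr_ge0 ?sqr_ge0.
have C1 : C <= 1.
  by have := sqr_ge0 (c - c0); have := sqr_ge0 (s - s0); rewrite /C; nra.
have kk0 : 0 < k * k0 by exact: mulr_gt0.
have d2 : d ^+ 2 <= 16^-1.
  have : d ^+ 2 <= 4^-1 ^+ 2 by rewrite ler_pXn2r// nnegrE.
  by lra.
have near : (k - k0) ^+ 2 <= (k0 / 2) ^+ 2.
  have h1 : 0 <= k * k0 * (1 - C) by rewrite mulr_ge0 ?(ltW kk0)// subr_ge0.
  have h2 : 0 <= (16^-1 - d ^+ 2) * k0 ^+ 2 by rewrite mulr_ge0 ?sqr_ge0// subr_ge0.
  have h3 := sqr_ge0 k0.
  have -> : (k - k0) ^+ 2 = k ^+ 2 + k0 ^+ 2 - 2 * (k * k0 * C) - 2 * (k * k0 * (1 - C)) by ring.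
  rewrite exprMn; lra.
have : `|k - k0| <= k0 / 2.
  rewrite -(ger0_norm (ltW (divr_gt0 k0_gt0 _)))//.
  by rewrite -ler_sqr ?nnegrE// !real_normK ?num_real.
rewrite ler_norml => /andP[kl ku]; split; [lra|lra|].
rewrite -/C -(ler_pM2l kk0).
(* After multiplication by 2 k k0, what remains to be nonnegative is (k - k0)^2 + 2 d^2 k0 (2 k -
   k0), and 2 k >= k0 is known. *)
have h : 0 <= d ^+ 2 * k0 * (2 * k - k0) by rewrite !mulr_ge0 ?sqr_ge0 ?(ltW k0_gt0)//; lra.
have := sqr_ge0 (k - k0).
nra.
Qed.

Lemma cos_close_angle t : 0 < t -> exists d : R, [/\ 0 < d, d <= 4^-1 &
  forall x y, 1 - 2 * d ^+ 2 <= cos (atan x - atan y) -> `|atan x - atan y| <= t].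
Proof.
(* The minimum with 1 keeps s inside [0, pi], where the cosine decreases; the difference of two
   arctangents also has absolute value below pi. *)
move=> t0; pose s := Num.min t 1.
have s0 : 0 < s by rewrite lt_min t0 ltr01.
have st : s <= t by rewrite ge_min lexx.
have s1 : s <= 1 by rewrite ge_min lexx orbT.
have pi2 := pi_ge2 R.
have cs : cos s < 1.
  rewrite -(@cos0 R) ltr_cos ?in_itv /=; [done|lra|lra].
pose d := Num.min 4^-1 ((1 - cos s) / 2).
have d0 : 0 < d by rewrite lt_min; apply/andP; split; lra.
have d4 : d <= 4^-1 by rewrite ge_min lexx.
have dc : d <= (1 - cos s) / 2 by rewrite ge_min lexx orbT.
exists d; split => // x y h.
rewrite leNgt; apply/negP => tx.
have := atan_ltpi2 x; have := atan_gtNpi2 x; have := atan_ltpi2 y; have := atan_gtNpi2 y.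
move=> y1 y2 x1 x2.
have xpi : `|atan x - atan y| <= pi by rewrite ler_norml; lra.
have : cos `|atan x - atan y| < cos s.
  by rewrite ltr_cos ?in_itv /=; [lra|lra|lra].
rewrite cos_norm => h'.
have : 2 * d ^+ 2 < 1 - cos s by rewrite expr2; nra.
lra.
Qed.

Lemma cos_ge_half : exists2 t : R, 0 < t & forall x, `|x| <= t -> 2^-1 <= cos x.
Proof.
have [l1 l2] : -1 <= 2^-1 :> R /\ 2^-1 < 1 :> R by split; lra.
have h1 : (-1 <= (2^-1 : R)) && ((2^-1 : R) < 1) by rewrite l1 l2.
have h2 : (-1 <= (2^-1 : R)) && ((2^-1 : R) <= 1) by rewrite l1 ltW.
exists (acos 2^-1); first exact: acos_gt0.
have tpi := acos_lepi h2; have t0 := acos_gt0 h1.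
move=> x xt; rewrite -cos_norm leNgt; apply/negP.
rewrite -{1}[2^-1](@acosK R) ?in_itv//= ltr_cos ?in_itv /=.
- by rewrite ltNge xt.
- by rewrite (ltW t0).
- by rewrite normr_ge0 (le_trans xt).
Qed.

End polar_angle.

(** * Reference points and relative closeness of rho(z,u) *)

Section reference_points.
Context (R : realType).

Lemma norm_mul_le (e T x s : R) : 0 <= e -> `|s| <= e * T -> `|x * s| <= e / 2 * (x ^+ 2 + T ^+ 2).
Proof.
move=> e0 sT; rewrite normrM -(real_normK (num_real x)).
apply: (@le_trans _ _ (`|x| * (e * T))); first exact: ler_wpM2l.
by have := mulr_ge0 e0 (sqr_ge0 (`|x| - T)); lra.
Qed.

Lemma sqr_perturb (e T s t : R) : 0 <= e -> e <= 1 -> `|s| <= e * T -> `|t| <= e * T ->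
  `|s * t| <= e * T ^+ 2.
Proof.
move=> e0 e1 sT tT; rewrite normrM.
apply: (@le_trans _ _ ((e * T) * (e * T))); first by apply: ler_pM.
by have := mulr_ge0 (mulr_ge0 e0 (sqr_ge0 T)) (_ : 0 <= 1 - e); rewrite subr_ge0 => /(_ e1); lra.
Qed.

(** The mixed products are absorbed by the arithmetic-geometric mean inequality. The error is then e
    times quantities that the reference real part itself contains. *)
Lemma re_term_close (e T x y s t : R) : 0 <= e -> e <= 1 -> `|s| <= e * T -> `|t| <= e * T ->
  `|(x - s) ^+ 2 + (y - t) ^+ 2 - (x ^+ 2 + y ^+ 2)| <= e * (x ^+ 2 + y ^+ 2) + 4 * (e * T ^+ 2).
Proof.
move=> e0 e1 sT tT.
have := norm_mul_le x e0 sT; have := norm_mul_le y e0 tT.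
have := sqr_perturb e0 e1 sT sT; have := sqr_perturb e0 e1 tT tT.
rewrite !ler_norml => /andP[h1 h2] /andP[h3 h4] /andP[h5 h6] /andP[h7 h8].
by apply/andP; split; lra.
Qed.

Lemma im_term_close (e T x y s t : R) : 0 <= e -> e <= 1 -> `|s| <= e * T -> `|t| <= e * T ->
  `|(x - s) * (y + t) - x * y| <= 2^-1 * (e * (x ^+ 2 + y ^+ 2) + 4 * (e * T ^+ 2)).
Proof.
move=> e0 e1 sT tT.
have := norm_mul_le x e0 tT; have := norm_mul_le y e0 sT.
have := sqr_perturb e0 e1 sT tT.
rewrite !ler_norml => /andP[h1 h2] /andP[h3 h4] /andP[h5 h6].
by apply/andP; split; lra.
Qed.

Fixpoint lastv k (h : R) : Rn R k.+1 :=
  match k return Rn R k.+1 with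
  | 0 => (h, tt)
  | k'.+1 => (0, lastv k' h)
  end.

Lemma coord_lastv k h : Defs.coord (lastv k h) k = h.
Proof. by elim: k. Qed.

Lemma coord_lastv_lt k h j : (j < k)%N -> Defs.coord (lastv k h) j = 0.
Proof. by elim: k j => [|k IH] [|j] //= jk; exact: IH. Qed.

Variable m : nat.
Local Notation n := m.+1.
Implicit Types z u : Cn R n.

Definition xi (h : R) : Cn R n := (lastv m 0, lastv m h).

Lemma xc_xi h (j : 'I_m) : xc (xi h) j = 0. Proof. exact: coord_lastv_lt. Qed.

Lemma yc_xi h (j : 'I_m) : yc (xi h) j = 0. Proof. exact: coord_lastv_lt. Qed.

Lemma xc_xi_last h : xc (xi h) m = 0. Proof. exact: coord_lastv. Qed.

Lemma yc_xi_last h : yc (xi h) m = h. Proof. exact: coord_lastv. Qed.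

Lemma rho_xi h : rho (xi h) = h.
Proof.
rewrite /rho yc_xi_last big1 ?subr0// => j _.
by rewrite yc_xi expr0n.
Qed.

Lemma re2_xi z h : re2 z (xi h) =
  4^-1 * (\sum_(j < m) (xc z j ^+ 2 + yc z j ^+ 2) + 2 * rho z + 2 * h).
Proof.
rewrite /re2 rho_xi; congr (_ * (_ + _ + _)); apply: eq_bigr => j _.
by rewrite xc_xi yc_xi !subr0.
Qed.

Lemma im2_xi z h : im2 z (xi h) = 2^-1 * (\sum_(j < m) xc z j * yc z j - xc z m).
Proof.
rewrite /im2 /=; congr (_ * (_ - _)); last by rewrite xc_xi_last subr0.
by apply: eq_bigr => j _; rewrite xc_xi yc_xi subr0 addr0.
Qed.

(** Both errors are measured against the real part at the reference point, as [polar_close]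
    requires. *)
Definition kclose (d : R) z u xi0 : Prop :=
  `|re2 z u - re2 z xi0| <= d * re2 z xi0 /\ `|im2 z u - im2 z xi0| <= d * re2 z xi0.

(** Uniformity in z: the reference real part is a quarter of S + 2 rho(z) + 2 h, which dominates
    both S and 2 T^2. The factor 2 m + 1 counts an error 4 e T^2 for each of m coordinates and 2 e
    T^2 for the last one. T stays free: it is sqrt h for boxes around [xi h], and 1/eps when h =
    0. *)
Lemma kclose_xi (e h T : R) z u : 0 <= e -> e <= 1 -> T ^+ 2 <= h + rho z ->
  (forall j : 'I_m, `|xc u j| <= e * T) -> (forall j : 'I_m, `|yc u j| <= e * T) ->
  `|xc u m| <= e * T ^+ 2 -> `|rho u - h| <= e * T ^+ 2 ->
  kclose (e * (2 * m%:R + 1)) z u (xi h).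
Proof.
move=> e0 e1 Hz xu yu xum ru.
pose S := \sum_(j < m) (xc z j ^+ 2 + yc z j ^+ 2).
have S0 : 0 <= S by apply: sumr_ge0 => j _; rewrite addr_ge0 ?sqr_ge0.
have sumE : \sum_(j < m) (e * (xc z j ^+ 2 + yc z j ^+ 2) + 4 * (e * T ^+ 2)) =
    e * S + 4 * (e * T ^+ 2) * m%:R.
  by rewrite big_split /= -mulr_sumr sumr_const card_ord mulr_natr.
have re_sum : `|\sum_(j < m) ((xc z j - xc u j) ^+ 2 + (yc z j - yc u j) ^+ 2) - S| <=
    e * S + 4 * (e * T ^+ 2) * m%:R.
  rewrite -sumrB -sumE; apply: le_trans (ler_norm_sum _ _ _) _.
  by apply: ler_sum => j _; exact: re_term_close.
have im_sum : `|\sum_(j < m) (xc z j - xc u j) * (yc z j + yc u j) - \sum_(j < m) xc z j * yc z j| <=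
    2^-1 * (e * S + 4 * (e * T ^+ 2) * m%:R).
  rewrite -sumrB -sumE mulr_sumr; apply: le_trans (ler_norm_sum _ _ _) _.
  by apply: ler_sum => j _; exact: im_term_close.
have key : e * S + 4 * (e * T ^+ 2) * m%:R + 2 * (e * T ^+ 2) <=
    4 * (e * (2 * m%:R + 1) * re2 z (xi h)).
  rewrite re2_xi -/S.
  have := mulr_ge0 (mulr_ge0 e0 (ler0n R m)) S0.
  have := mulr_ge0 (mulr_ge0 e0 (ler0n R m)) (_ : 0 <= h + rho z - T ^+ 2).
  have := mulr_ge0 e0 (_ : 0 <= h + rho z - T ^+ 2).
  rewrite subr_ge0 => /(_ Hz) h1 /(_ Hz) h2 h3; lra.
move: re_sum im_sum ru xum key; rewrite /kclose im2_xi.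
set D := e * _ * _.
rewrite {1}re2_xi /re2 /im2 /= -/S.
move: (\sum_(j < m) _) (\sum_(j < m) _) (\sum_(j < m) _) => A B B'.
move: (4 * (e * T ^+ 2) * m%:R) (e * T ^+ 2) (e * S) => q1 q2 q3.
move: (xc z m) (xc u m) (rho u) (rho z) => a b ru rz.
rewrite !ler_norml => /andP[h1 h2] /andP[h3 h4] /andP[h5 h6] /andP[h7 h8] key.
by split; apply/andP; split; lra.
Qed.

End reference_points.

(** * Tensor products and their mixed norms *)

Section product_functions.
Context (R : realType) (m : nat).
Local Notation n := m.+1.
Local Notation vol := (@volC R n).
Local Notation TB2 := (@TB R n `*` @TB R n).
Local Notation CnM := (Rn R n * Rn R n)%type.
Local Open Scope ereal_scope.
Implicit Types z w u : Cn R n.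

Lemma measurable_tensor (A B : Cn R n -> R) : measurable_fun setT A -> measurable_fun setT B ->
  measurable_fun setT (fun x : Cn R n * Cn R n => (A x.1 * B x.2)%R).
Proof.
move=> mA mB; apply: measurable_funM.
  by have := measurableT_comp mA (@measurable_fst _ _ CnM CnM).
by have := measurableT_comp mB (@measurable_snd _ _ CnM CnM).
Qed.

Lemma ge0_integral_tensor (A B : Cn R n -> R) : measurable_fun setT A -> measurable_fun setT B ->
  (forall z, 0 <= A z)%R -> (forall z, 0 <= B z)%R ->
  \int[@volCC R n]_x (A x.1 * B x.2)%:E = \int[vol]_z (A z)%:E * \int[vol]_w (B w)%:E.
Proof.
move=> mA mB A0 B0; rewrite (fubini_tonelli1 (m1 := vol) (m2 := vol)); last 2 first.
- by apply/measurable_EFinP; exact: measurable_tensor.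
- by move=> x; rewrite lee_fin mulr_ge0.
rewrite muleC -ge0_integralZl//; last 3 first.
- exact/measurable_EFinP.
- by move=> z _; rewrite lee_fin.
- by apply: integral_ge0 => w _; rewrite lee_fin.
apply: eq_integral => z _; rewrite /fubini_F [RHS]muleC -ge0_integralZl//.
- exact/measurable_EFinP.
- by move=> w _; rewrite lee_fin.
- by rewrite lee_fin.
Qed.

Lemma mixnorm_le (p1 p2 al1 al2 : R) (f g : cfun R n) : (0 < p1)%R -> (0 < p2)%R ->
  (forall z w, TB z -> TB w -> (cabs (f (z, w)) <= cabs (g (z, w)))%R) ->
  mixnorm p1 p2 al1 al2 f <= mixnorm p1 p2 al1 al2 g.
Proof.
move=> p10 p20 fg; rewrite /mixnorm; apply: lee_poweR; first by rewrite invr_ge0 ltW.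
  by apply: integral_ge0 => w _; apply: mule_ge0; [exact: poweR_ge0|rewrite lee_fin; exact: powR_ge0].
apply: ge0_le_integral_nomeas => w Tw.
  by apply: mule_ge0; [exact: poweR_ge0|rewrite lee_fin; exact: powR_ge0].
apply: lee_wpmul2r; first by rewrite lee_fin powR_ge0.
apply: lee_poweR; first by rewrite divr_ge0// ltW.
  by apply: integral_ge0 => z _; rewrite lee_fin mulr_ge0 ?powR_ge0.
apply: ge0_le_integral_nomeas => z Tz; first by rewrite lee_fin mulr_ge0 ?powR_ge0.
rewrite lee_fin; apply: ler_wpM2r; first exact: powR_ge0.
by apply: ge0_ler_powR; rewrite ?nnegrE ?cabs_ge0 ?(ltW p10)//; exact: fg.
Qed.

Lemma cabs_real (r : R) : (0 <= r)%R -> cabs (Complex r 0%R) = r.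
Proof. by move=> r0; rewrite /cabs /= expr0n addr0 sqrtr_sqr ger0_norm. Qed.

Definition tensor (A B : Cn R n -> R) : cfun R n := fun x => Complex (A x.1 * B x.2)%R 0%R.

Lemma mixnorm_tensor (p1 p2 al1 al2 : R) (A B : Cn R n -> R) : (0 < p1)%R -> (0 < p2)%R ->
  measurable_fun setT A -> measurable_fun setT B ->
  (forall z, 0 <= A z)%R -> (forall z, 0 <= B z)%R ->
  mixnorm p1 p2 al1 al2 (tensor A B) =
  (\int[vol]_z (A z `^ p1 * wt al1 z)%:E) `^ p1^-1 * (\int[vol]_w (B w `^ p2 * wt al2 w)%:E) `^ p2^-1.
Proof.
move=> p10 p20 mA mB A0 B0; rewrite mixnormE.
set IA := \int[vol]_z (A z `^ p1 * _)%:E.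
set IB := \int[vol]_w (B w `^ p2 * _)%:E.
have IA0 : 0 <= IA.
  by apply: integral_ge0 => z _; rewrite lee_fin mulr_ge0 ?powR_ge0 ?wt_ge0.
have IB0 : 0 <= IB.
  by apply: integral_ge0 => z _; rewrite lee_fin mulr_ge0 ?powR_ge0 ?wt_ge0.
have -> : \int[vol]_w ((\int[vol]_z (absx (tensor A B) (z, w) `^ p1 * wt al1 z)%:E) `^ (p2 / p1)
    * (wt al2 w)%:E) = IA `^ (p2 / p1) * IB.
  rewrite -(ge0_integralZl _ measurableT); last 3 first.
  - apply/measurable_EFinP; apply: measurable_funM; last exact: measurable_wt.
    by have := measurableT_comp (measurable_powR p2) mB.
  - by move=> z _; rewrite lee_fin mulr_ge0 ?powR_ge0 ?wt_ge0.
  - exact: poweR_ge0.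
  apply: eq_integral => w _.
  have [Tw|Tw] := pselect (TB w); last first.
    by rewrite (wt_notin al2 Tw); move: (\int[vol]_z _) => Iz; rewrite mulr0 !mule0.
  have -> : \int[vol]_z (absx (tensor A B) (z, w) `^ p1 * wt al1 z)%:E = (B w `^ p1)%:E * IA.
    rewrite -(ge0_integralZl _ measurableT); last 3 first.
    - apply/measurable_EFinP; apply: measurable_funM; last exact: measurable_wt.
      by have := measurableT_comp (measurable_powR p1) mA.
    - by move=> z _; rewrite lee_fin mulr_ge0 ?powR_ge0 ?wt_ge0.
    - by rewrite lee_fin powR_ge0.
    apply: eq_integral => z _.
    have [Tz|Tz] := pselect (TB z); last by rewrite (wt_notin _ Tz) !mulr0 mule0.
    rewrite absxE// /tensor cabs_real ?mulr_ge0//= -EFinM; congr EFin.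
    by rewrite powRM// mulrA; congr (_ * _)%R; rewrite mulrC.
  rewrite poweRM; [|by rewrite lee_fin powR_ge0|exact: IA0].
  rewrite poweR_EFin -powRrM.
  have -> : (p1 * (p2 / p1) = p2)%R by field; rewrite gt_eqF.
  by rewrite muleAC -EFinM muleC.
rewrite poweRM ?poweR_ge0// -poweRrM; congr (_ `^ _ * _).
by field; rewrite !gt_eqF.
Qed.

End product_functions.

(** * Lower bound for an integral with nearly constant phase *)

Section operator_lower_bound.
Context (R : realType) (m : nat).
Local Notation n := m.+1.
Local Notation vol := (@volC R n).
Local Notation TB2 := (@TB R n `*` @TB R n).
Local Open Scope ereal_scope.
Implicit Types z w u : Cn R n.
Variables (e b1 b2 c1 c2 : R) (K : cfun R n -> Cn R n -> Cn R n -> Cn R n * Cn R n -> R[i]).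
Hypothesis phK : phased e b1 b2 c1 c2 K.

(* The integral is rotated by the reference phase [t]. *)
Lemma cabs_cint_ge (g : Cn R n * Cn R n -> R) z w (t I : R) : TB z -> TB w ->
  measurable_fun setT g -> (forall x, 0 <= g x)%R ->
  (forall x, TB x.1 -> TB x.2 -> g x != 0%R -> (2^-1 <= cos (phase e c1 c2 z w x - t))%R) ->
  \int[@volCC R n]_(x in TB2) (kfac b1 b2 c1 c2 z w x * g x)%:E = I%:E ->
  (I / 2 <= cabs (cint (@volCC R n) TB2 (K (fun x => Complex (g x) 0%R) z w)))%R.
Proof.
move=> Tz Tw mg g0 gt IE; set f := fun x => Complex (g x) 0%R.
have mRe : measurable_fun TB2 (fun x => @complex.Re R (f x)) by exact: measurable_funTS.
have mIm : measurable_fun TB2 (fun x => @complex.Im R (f x)) by exact: measurable_cst.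
have [iRe iIm] : cintegrable (@volCC R n) TB2 (K f z w).
  apply: (cintegrable_phased phK mRe mIm Tz Tw).
  rewrite -(integral_kfac_cabs b1 b2 c1 c2 mRe mIm z w).
  rewrite (eq_integral (fun x => (kfac b1 b2 c1 c2 z w x * g x)%:E)) ?IE ?ltry//.
  by move=> x _; rewrite /f cabs_real.
set A := fine (\int[@volCC R n]_(x in TB2) (@complex.Re R (K f z w x))%:E).
set B := fine (\int[@volCC R n]_(x in TB2) (@complex.Im R (K f z w x))%:E).
have AE : \int[@volCC R n]_(x in TB2) (@complex.Re R (K f z w x))%:E = A%:E.
  by rewrite /A fineK//; apply: integrable_fin_num iRe; exact: measurable_TB2.
have BE : \int[@volCC R n]_(x in TB2) (@complex.Im R (K f z w x))%:E = B%:E.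
  by rewrite /B fineK//; apply: integrable_fin_num iIm; exact: measurable_TB2.
(* The right side is the real part of exp(i t) (A + i B). Under the integral the rotation replaces
   the phase by its difference from t, whose cosine is at least 1/2 where g does not vanish. *)
have rot : (I / 2)%:E <= (A * cos t + B * - sin t)%:E.
  rewrite EFinD !EFinM -AE -BE -IE muleC.
  rewrite [(_ * (cos t)%:E)]muleC [(_ * (- sin t)%:E)]muleC.
  have mT := @measurable_TB2 R m.
  rewrite -(integralZl mT iRe) -(integralZl mT iIm).
  rewrite -(integralD mT (integrableZl mT _ iRe) (integrableZl mT _ iIm)).
  rewrite -ge0_integralZl//; last 2 first.
  - apply/measurable_EFinP; apply: measurable_funM; apply: measurable_funTS => //.
    exact: measurable_kfac.
  - by move=> x _; rewrite lee_fin mulr_ge0 ?kfac_ge0.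
  apply: ge0_le_integral_nomeas => x [T1 T2].
    by rewrite -EFinM lee_fin mulr_ge0// mulr_ge0// kfac_ge0.
  rewrite -!EFinM -EFinD lee_fin phK//= !mul0r addr0 sub0r.
  have -> : (cos t * (kfac b1 b2 c1 c2 z w x * (g x * cos (phase e c1 c2 z w x))) +
    - sin t * (kfac b1 b2 c1 c2 z w x * - (g x * sin (phase e c1 c2 z w x))) =
    kfac b1 b2 c1 c2 z w x * g x * cos (phase e c1 c2 z w x - t))%R.
    rewrite cosB; move: (kfac _ _ _ _ _ _ _) (cos (phase _ _ _ _ _ _)) (sin (phase _ _ _ _ _ _)).
    by move=> k c s; ring.
  have [->|gx0] := eqVneq (g x) 0%R; first by rewrite !(mulr0, mul0r).
  have kg0 : (0 <= kfac b1 b2 c1 c2 z w x * g x)%R by rewrite mulr_ge0 ?kfac_ge0.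
  by rewrite [leLHS]mulrC; apply: (ler_wpM2l kg0); exact: gt.
apply: (@le_trans _ _ (A * cos t + B * - sin t)%R); first by rewrite -lee_fin.
apply: le_trans (ler_norm _) _.
by rewrite /cint -/A -/B; apply: norm_dot_le; rewrite sqrrN cos2Dsin2.
Qed.

End operator_lower_bound.

(** * Testing the operator near a reference point *)

Section test_functions.
Context (R : realType) (m : nat).
Local Notation n := m.+1.
Local Notation vol := (@volC R n).
Local Notation TB2 := (@TB R n `*` @TB R n).
Local Open Scope ereal_scope.
Implicit Types z w u : Cn R n.

Lemma kmod_close (d : R) z u xi0 : (0 <= d)%R -> (d <= 4^-1)%R ->
  (0 < re2 z u)%R -> (0 < re2 z xi0)%R -> kclose d z u xi0 ->
  ((2^-1 * kmod z xi0 <= kmod z u) /\ (kmod z u <= 2 * kmod z xi0))%R.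
Proof.
move=> d0 d4 u0 x0 [h1 h2]; rewrite !kmodE.
by have [k1 k2 _] := polar_close u0 x0 d0 d4 h1 h2.
Qed.

Lemma phase_close (e c1 c2 : R) : exists d : R, [/\ (0 < d)%R, (d <= 4^-1)%R &
  forall z w xi1 xi2 (x : Cn R n * Cn R n), TB z -> TB w -> TB x.1 -> TB x.2 ->
  (0 < re2 z xi1)%R -> (0 < re2 w xi2)%R -> kclose d z x.1 xi1 -> kclose d w x.2 xi2 ->
  (2^-1 <= cos (phase e c1 c2 z w x - phase e c1 c2 z w (xi1, xi2)))%R].
Proof.
have [t t0 tcos] := @cos_ge_half R.
(* If each argument moves by at most s, the phase moves by at most |e| (|c1| + |c2|) s <= t; the
   added 1 keeps the denominator positive. *)
pose s := (t / (`|e| * (`|c1| + `|c2|) + 1))%R.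
have ec0 : (0 < `|e| * (`|c1| + `|c2|) + 1)%R by rewrite ltr_wpDl// mulr_ge0// addr_ge0.
have s0 : (0 < s)%R by rewrite divr_gt0.
have [d [d0 d4 dang]] := cos_close_angle s0.
have arg z u xi0 : (0 < re2 z u)%R -> (0 < re2 z xi0)%R -> kclose d z u xi0 ->
    (`|argr z u - argr z xi0| <= s)%R.
  move=> u0 x0 [h1 h2]; rewrite /argr !powR_inv1 ?(ltW u0) ?(ltW x0)//.
  by apply: dang; have [_ _] := polar_close u0 x0 (ltW d0) d4 h1 h2.
exists d; split => // z w xi1 xi2 x Tz Tw T1 T2 r1 r2 cl1 cl2.
apply: tcos.
have := arg _ _ _ (TB_re2_gt0 Tz T1) r1 cl1; have := arg _ _ _ (TB_re2_gt0 Tw T2) r2 cl2.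
rewrite /phase /=; move: (argr z x.1) (argr z xi1) (argr w x.2) (argr w xi2) => A A0 B B0 hB hA.
have -> : (e * (c1 * A + c2 * B) - e * (c1 * A0 + c2 * B0) =
  e * (c1 * (A - A0) + c2 * (B - B0)))%R by ring.
rewrite normrM; apply: (@le_trans _ _ (`|e| * ((`|c1| + `|c2|) * s)))%R.
  apply: ler_wpM2l => //; apply: le_trans (ler_normD _ _) _; rewrite !normrM mulrDl.
  by apply: lerD; apply: ler_wpM2l.
rewrite mulrA /s mulrA ler_pdivrMr//.
by rewrite [leRHS]mulrDr mulr1 (mulrC t) lerDl ltW.
Qed.

(** A lower bound for x^(-c) on [1/2, 2] that holds for either sign of c. *)
Definition lowc (c : R) : R := (2^-1 `^ c + 2 `^ c)^-1.

Lemma lowc_gt0 c : (0 < lowc c)%R.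
Proof. by rewrite invr_gt0 addr_gt0// powR_gt0. Qed.

Lemma powR_lowc (c k k0 : R) : (0 < k0)%R -> (2^-1 * k0 <= k)%R -> (k <= 2 * k0)%R ->
  (lowc c * k0 `^ (- c) <= k `^ (- c))%R.
Proof.
move=> k00 h1 h2; have h0 : (0 < 2^-1 * k0)%R by rewrite mulr_gt0.
apply: le_trans _ (powR_ge_between (- c) h0 h1 h2).
by rewrite opprK !powRM ?(ltW k00)// -mulrDl invfM powRN.
Qed.

(** The profile of the output on D, with the kernel frozen at [xi0]. *)
Definition lowf (D : set (Cn R n)) xi0 (a c : R) z : R := \1_D z * (wt a z * kmod z xi0 `^ (- c)).

Lemma lowf_ge0 D xi0 a c z : (0 <= lowf D xi0 a c z)%R.
Proof. by rewrite !mulr_ge0 ?powR_ge0 ?wt_ge0. Qed.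

Lemma measurable_lowf D xi0 a c : measurable D -> measurable_fun setT (lowf D xi0 a c).
Proof.
move=> mD; apply: measurable_funM; first exact: measurable_indic.
apply: measurable_funM; first exact: measurable_wt.
by have := measurable_fun_pair1 xi0 (@measurable_kmod_pow R m (- c)).
Qed.

Section slice.
Variables (d b c M : R) (g : Cn R n -> R) (D : set (Cn R n)) (xi0 : Cn R n).
Hypotheses (d0 : (0 <= d)%R) (d4 : (d <= 4^-1)%R).
Hypotheses (mg : measurable_fun setT g) (g0 : forall u, (0 <= g u)%R).
Hypothesis (gTB : forall u, g u != 0%R -> TB u).
Hypothesis DTB : D `<=` @TB R n.
Hypothesis Dre : forall z, D z -> (0 < re2 z xi0)%R.
Hypothesis Dclose : forall z u, D z -> g u != 0%R -> kclose d z u xi0.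
Hypothesis ME : \int[vol]_u (g u * wt b u)%:E = M%:E.

Definition slicef z u : R := (g u * (wt b u * kmod z u `^ (- c)))%R.

Lemma slicef_ge0 z u : (0 <= slicef z u)%R.
Proof. by rewrite !mulr_ge0 ?wt_ge0 ?powR_ge0. Qed.

Lemma measurable_slicef z : measurable_fun setT (slicef z).
Proof.
apply: measurable_funM => //; apply: measurable_funM; first exact: measurable_wt.
exact: measurable_kmod_pow_r.
Qed.

Lemma slice_bound z : D z -> exists2 J : R, \int[vol]_u (slicef z u)%:E = J%:E &
  (lowc c * kmod z xi0 `^ (- c) * M <= J)%R.
Proof.
move=> Dz; have k0 : (0 < kmod z xi0)%R.
  by apply: lt_le_trans (kmod_ge_re _ _); rewrite normr_gt0 gt_eqF ?Dre.
have mgw : measurable_fun setT (fun u => (g u * wt b u)%:E).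
  by apply/measurable_EFinP; apply: measurable_funM => //; exact: measurable_wt.
have gw0 u : 0 <= (g u * wt b u)%:E by rewrite lee_fin mulr_ge0 ?wt_ge0.
have cl u : g u != 0%R -> ((2^-1 * kmod z xi0 <= kmod z u) /\ (kmod z u <= 2 * kmod z xi0))%R.
  move=> gu; apply: (kmod_close d0 d4) => //; [|exact: Dre|exact: Dclose].
  by apply: TB_re2_gt0; [exact: DTB|exact: gTB].
(* The upper estimate of the kernel shows that the slice integral is finite, hence a real number. *)
pose U := ((2^-1 * kmod z xi0) `^ (- c) + (2 * kmod z xi0) `^ (- c))%R.
have U0 : (0 <= U)%R by rewrite addr_ge0 ?powR_ge0.
have IZ (r : R) : (0 <= r)%R -> \int[vol]_u (r%:E * (g u * wt b u)%:E) = (r * M)%:E.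
  by move=> r0; rewrite ge0_integralZl// ME.
have Iy : \int[vol]_u (slicef z u)%:E < +oo.
  apply: (@le_lt_trans _ _ (U * M)%:E); last exact: ltry.
  rewrite -(IZ _ U0); apply: ge0_le_integral_nomeas => u _; first by rewrite lee_fin slicef_ge0.
  rewrite -EFinM lee_fin /slicef.
  have [->|gu] := eqVneq (g u) 0%R; first by rewrite !mul0r mulr0.
  rewrite mulrA [leRHS]mulrC; apply: ler_wpM2l; first by rewrite mulr_ge0 ?wt_ge0.
  have [h1 h2] := cl u gu; apply: powR_le_between => //.
  by rewrite mulr_gt0.
have I0 : 0 <= \int[vol]_u (slicef z u)%:E.
  by apply: integral_ge0 => u _; rewrite lee_fin slicef_ge0.
exists (fine (\int[vol]_u (slicef z u)%:E)); first by rewrite fineK// ge0_fin_numE.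
rewrite -lee_fin fineK ?ge0_fin_numE// -IZ; last by rewrite mulr_ge0 ?powR_ge0 ?(ltW (lowc_gt0 c)).
apply: ge0_le_integral_nomeas => u _.
  by rewrite -EFinM lee_fin !mulr_ge0 ?powR_ge0 ?wt_ge0 ?(ltW (lowc_gt0 c)).
rewrite -EFinM lee_fin /slicef.
have [->|gu] := eqVneq (g u) 0%R; first by rewrite !mul0r mulr0.
rewrite mulrCA; apply: ler_wpM2l => //; rewrite mulrC; apply: ler_wpM2l; first exact: wt_ge0.
by have [h1 h2] := cl u gu; exact: powR_lowc.
Qed.

End slice.

Section test_inequality.
Variables (e p1 q1 q2 a1 a2 b1 b2 c1 c2 al1 al2 be1 be2 C d : R).
Variable K : cfun R n -> Cn R n -> Cn R n -> Cn R n * Cn R n -> R[i].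
Hypothesis phK : phased e b1 b2 c1 c2 K.
Hypotheses (p10 : (0 < p1)%R) (q10 : (0 < q1)%R) (q20 : (0 < q2)%R).
Hypothesis HC : forall f : cfun R n, inLp p1 1 al1 al2 f ->
  mixnorm q1 q2 be1 be2 (intop a1 a2 K f) <= C%:E * mixnorm p1 1 al1 al2 f.
Hypotheses (d0 : (0 <= d)%R) (d4 : (d <= 4^-1)%R).
Hypothesis dphase : forall z w xi1 xi2 (x : Cn R n * Cn R n), TB z -> TB w -> TB x.1 -> TB x.2 ->
  (0 < re2 z xi1)%R -> (0 < re2 w xi2)%R -> kclose d z x.1 xi1 -> kclose d w x.2 xi2 ->
  (2^-1 <= cos (phase e c1 c2 z w x - phase e c1 c2 z w (xi1, xi2)))%R.

(** Seen from every point of D, the support of g is so close to [xi0] that the kernel is nearly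
    constant on it. The pairs used are a small box with D = T_B, and a large slab with D far from
    the boundary. *)
Record admissible (g : Cn R n -> R) (D : set (Cn R n)) (xi0 : Cn R n) : Prop := Admissible {
  adm_meas : measurable_fun setT g;
  adm_ge0 : forall u, (0 <= g u)%R;
  adm_TB : forall u, g u != 0%R -> TB u;
  adm_dom : measurable D;
  adm_domTB : D `<=` @TB R n;
  adm_re : forall z, D z -> (0 < re2 z xi0)%R;
  adm_close : forall z u, D z -> g u != 0%R -> kclose d z u xi0 }.

Variables (g1 g2 : Cn R n -> R) (D1 D2 : set (Cn R n)) (xi1 xi2 : Cn R n).
Hypotheses (adm1 : admissible g1 D1 xi1) (adm2 : admissible g2 D2 xi2).
Variables (M1 M2 N1 N2 : R).
Hypotheses (M1E : \int[vol]_u (g1 u * wt b1 u)%:E = M1%:E)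
  (M2E : \int[vol]_u (g2 u * wt b2 u)%:E = M2%:E)
  (N1E : \int[vol]_u (g1 u `^ p1 * wt al1 u)%:E = N1%:E)
  (N2E : \int[vol]_u (g2 u * wt al2 u)%:E = N2%:E).

Let kap := (lowc c1 * lowc c2 * M1 * M2 / 2)%R.

Let M10 : (0 <= M1)%R.
Proof.
rewrite -lee_fin -M1E; apply: integral_ge0 => u _.
by rewrite lee_fin mulr_ge0 ?wt_ge0 ?(adm_ge0 adm1).
Qed.

Let M20 : (0 <= M2)%R.
Proof.
rewrite -lee_fin -M2E; apply: integral_ge0 => u _.
by rewrite lee_fin mulr_ge0 ?wt_ge0 ?(adm_ge0 adm2).
Qed.

Let kap0 : (0 <= kap)%R.
Proof. by rewrite divr_ge0// !mulr_ge0// ltW ?lowc_gt0. Qed.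

Lemma intop_tensor_ge z w : TB z -> TB w ->
  (kap * lowf D1 xi1 a1 c1 z * lowf D2 xi2 a2 c2 w <=
   cabs (intop a1 a2 K (tensor g1 g2) (z, w)))%R.
Proof.
move=> Tz Tw.
have [Dz|Dz] := pselect (D1 z); last first.
  by rewrite {1}/lowf indicE memNset// mul0r mulr0 mul0r cabs_ge0.
have [Dw|Dw] := pselect (D2 w); last first.
  by rewrite {2}/lowf indicE memNset// mul0r mulr0 cabs_ge0.
case: adm1 => mg1 g10 g1T mD1 D1T D1re D1cl; case: adm2 => mg2 g20 g2T mD2 D2T D2re D2cl.
have [J1 J1E J1ge] := slice_bound c1 d0 d4 mg1 g10 g1T D1T D1re D1cl M1E Dz.
have [J2 J2E J2ge] := slice_bound c2 d0 d4 mg2 g20 g2T D2T D2re D2cl M2E Dw.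
have IE : \int[@volCC R n]_(x in TB2) (kfac b1 b2 c1 c2 z w x * (g1 x.1 * g2 x.2))%:E = (J1 * J2)%:E.
  rewrite EFinM -J1E -J2E -ge0_integral_tensor.
  - apply: ge0_integral_setT_patch => x.
      move=> [T1 T2]; rewrite /slicef !wtE// /kfac; congr EFin.
      move: (_ `^ b1)%R (_ `^ b2)%R (kmod z x.1 `^ _)%R (kmod w x.2 `^ _)%R (g1 _) (g2 _).
      by move=> r1 r2 k1 k2 v1 v2; ring.
    move=> xT; rewrite /slicef.
    have [g1x|g1x] := eqVneq (g1 x.1) 0%R; first by rewrite g1x !mul0r.
    have [g2x|g2x] := eqVneq (g2 x.2) 0%R; first by rewrite g2x mul0r mulr0.
    by case: xT; split; [exact: g1T|exact: g2T].
  - exact: measurable_slicef.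
  - exact: measurable_slicef.
  - exact: slicef_ge0.
  - exact: slicef_ge0.
have J := @cabs_cint_ge _ _ _ _ _ _ _ K phK (fun x => g1 x.1 * g2 x.2)%R z w
  (phase e c1 c2 z w (xi1, xi2)) (J1 * J2)%R Tz Tw.
have {}J : (J1 * J2 / 2 <= cabs (cint (@volCC R n) TB2 (K (tensor g1 g2) z w)))%R.
  apply: J => //; first exact: measurable_tensor.
    by move=> x; rewrite mulr_ge0.
  move=> x T1 T2; rewrite mulf_eq0 negb_or => /andP[g1x g2x].
  by apply: dphase => //; [exact: D1re|exact: D2re|exact: D1cl|exact: D2cl].
rewrite /intop cabsM_real ?mulr_ge0 ?powR_ge0//.
move: J; rewrite [(z, w).1]/= [(z, w).2]/=.
set cc := cabs _ => J.
rewrite /lowf !indicE (mem_set Dz) (mem_set Dw) !mul1r (wtE _ Tz) (wtE _ Tw).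
have k10 := mulr_ge0 (mulr_ge0 (ltW (lowc_gt0 c1)) (powR_ge0 (kmod z xi1) (- c1))) M10.
have k20 := mulr_ge0 (mulr_ge0 (ltW (lowc_gt0 c2)) (powR_ge0 (kmod w xi2) (- c2))) M20.
have JJ := ler_pM k10 k20 J1ge J2ge.
have := ler_wpM2l (mulr_ge0 (powR_ge0 (rho z) a1) (powR_ge0 (rho w) a2)) J.
apply: le_trans; move: JJ (powR_ge0 (rho z) a1) (powR_ge0 (rho w) a2); rewrite /kap.
move: (rho z `^ a1)%R (rho w `^ a2)%R (kmod z xi1 `^ _)%R (kmod w xi2 `^ _)%R (lowc c1) (lowc c2).
move=> r1 r2 k1 k2 l1 l2 JJ r10 r20.
by have := ler_wpM2l (mulr_ge0 r10 r20) JJ; lra.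
Qed.

(** The output on a tensor product dominates a tensor product of profiles, and mixed norms of tensor
    products factor. The profile integrals may be infinite on the left while the right side is
    finite, and this is how convergence is deduced. *)
Lemma test_inequality :
  kap%:E * ((\int[vol]_z (lowf D1 xi1 a1 c1 z `^ q1 * wt be1 z)%:E) `^ q1^-1 *
            (\int[vol]_z (lowf D2 xi2 a2 c2 z `^ q2 * wt be2 z)%:E) `^ q2^-1)
  <= (C * (N1 `^ p1^-1 * N2))%:E.
Proof.
have mL1 := measurable_lowf xi1 a1 c1 (adm_dom adm1).
have mL2 := measurable_lowf xi2 a2 c2 (adm_dom adm2).
have L10 := lowf_ge0 D1 xi1 a1 c1; have L20 := lowf_ge0 D2 xi2 a2 c2.
have N20 : (0 <= N2)%R.
  rewrite -lee_fin -N2E; apply: integral_ge0 => u _.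
  by rewrite lee_fin mulr_ge0 ?wt_ge0 ?(adm_ge0 adm2).
have fE : mixnorm p1 1 al1 al2 (tensor g1 g2) = (N1 `^ p1^-1 * N2)%:E.
  rewrite mixnorm_tensor//; [|exact: adm_meas adm1|exact: adm_meas adm2|exact: adm_ge0 adm1|exact: adm_ge0 adm2].
  rewrite N1E invr1 (eq_integral (fun u => (g2 u * wt al2 u)%:E)); last first.
    by move=> u _; rewrite powRr1 ?(adm_ge0 adm2).
  by rewrite N2E poweRe1 ?lee_fin// poweR_EFin EFinM.
have fL : inLp p1 1 al1 al2 (tensor g1 g2).
  split; first by apply: measurable_funTS; apply: measurable_tensor; [exact: adm_meas adm1|exact: adm_meas adm2].
  by split; [exact: measurable_cst|rewrite fE ltry].
have := HC fL; rewrite fE -EFinM; apply: le_trans.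
pose A z := (kap * lowf D1 xi1 a1 c1 z)%R.
have A0 z : (0 <= A z)%R by rewrite mulr_ge0.
have mA : measurable_fun setT A by rewrite /A; apply: measurable_funM; [exact: measurable_cst|exact: mL1].
apply: (@le_trans _ _ (mixnorm q1 q2 be1 be2 (tensor A (lowf D2 xi2 a2 c2)))).
  rewrite mixnorm_tensor// muleA; apply: lee_wpmul2r; first exact: poweR_ge0.
  have -> : \int[vol]_z (A z `^ q1 * wt be1 z)%:E =
      (kap `^ q1)%:E * \int[vol]_z (lowf D1 xi1 a1 c1 z `^ q1 * wt be1 z)%:E.
    rewrite -ge0_integralZl//; last 3 first.
    - apply/measurable_EFinP; apply: measurable_funM; last exact: measurable_wt.
      by have := measurableT_comp (measurable_powR q1) mL1.
    - by move=> z _; rewrite lee_fin mulr_ge0 ?powR_ge0 ?wt_ge0.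
    - by rewrite lee_fin powR_ge0.
    by apply: eq_integral => z _; rewrite /A powRM// -EFinM mulrA.
  rewrite poweRM ?lee_fin ?powR_ge0//; last first.
    by apply: integral_ge0 => z _; rewrite lee_fin mulr_ge0 ?powR_ge0 ?wt_ge0.
  by rewrite poweR_EFin -powRrM mulfV ?gt_eqF// powRr1.
apply: mixnorm_le => // z w Tz Tw.
rewrite /tensor cabs_real; first exact: intop_tensor_ge.
exact: mulr_ge0 (A0 z) (L20 w).
Qed.

End test_inequality.

End test_functions.

(** * Box test functions at scale h *)

Section test_families.
Context (R : realType) (m : nat).
Local Notation n := m.+1.
Local Notation vol := (@volC R n).
Local Notation leb := (@lebesgue_measure R).
Local Open Scope ereal_scope.
Implicit Types z w u : Cn R n.

Lemma near0_neq0 (A r : R) : near0 A r != 0%R -> (`|r| < A)%R.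
Proof. by rewrite /near0 pnatr_eq0 eqb0 negbK. Qed.

Lemma boxn_neq0 k (A : R) (t : Rn R k.+1) (j : 'I_k) :
  boxn A t != 0%R -> (`|Defs.coord t j| < A)%R.
Proof. by move=> /prodf_neq0 /(_ j isT) /near0_neq0. Qed.

Lemma boxC_neq0 (A B : R) u : boxC A B u != 0%R ->
  [/\ forall j : 'I_m, (`|xc u j| < A)%R, forall j : 'I_m, (`|yc u j| < A)%R & (`|xc u m| < B)%R].
Proof.
rewrite /boxC !mulf_eq0 !negb_or => /andP[/andP[h1 h2] h3]; split.
- by move=> j; exact: boxn_neq0 h1.
- by move=> j; exact: boxn_neq0 h3.
- exact: near0_neq0.
Qed.

Lemma boxC_bool (A B : R) u : boxC A B u = 0%R \/ boxC A B u = 1%R.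
Proof.
have bn (t : Rn R m.+1) : boxn A t = 0%R \/ boxn A t = 1%R.
  rewrite /boxn; elim/big_ind: _ => //; first by right.
    by move=> x y [->|->] [->|->]; rewrite ?mul0r ?mulr0 ?mulr1; [left|left|left|right].
  by move=> j _; rewrite /near0; case: (_ < _)%R; [right|left].
have nb (r : R) : near0 B r = 0%R \/ near0 B r = 1%R.
  by rewrite /near0; case: (_ < _)%R; [right|left].
rewrite /boxC; case: (bn u.1) => ->; case: (bn u.2) => ->; case: (nb (xc u m)) => ->;
  by rewrite ?mul0r ?mulr0 ?mulr1; do ?[by left|by right].
Qed.

Lemma boxC_powR (A B p : R) u : (0 < p)%R -> (boxC A B u `^ p = boxC A B u)%R.
Proof. by move=> p0; case: (boxC_bool A B u) => ->; rewrite ?powR1// powR0// gt_eqF. Qed.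

(* The first n-1 coordinates scale as [sqrt h], the last one and [rho] as [h]. *)
Definition cbump (eps h : R) u : R :=
  boxC (eps * Num.sqrt h) (eps * h) u * near0 (eps * h) (rho u - h).

Lemma cbump_ge0 eps h u : (0 <= cbump eps h u)%R.
Proof. by rewrite mulr_ge0 ?boxC_ge0 ?near0_ge0. Qed.

Lemma measurable_cbump eps h : measurable_fun setT (cbump eps h).
Proof.
apply: measurable_funM; first exact: measurable_boxC.
have mr : measurable_fun setT (fun u : Cn R n => rho u - h)%R.
  by apply: measurable_funB; [exact: measurable_rho|exact: measurable_cst].
by have := measurableT_comp (measurable_near0 (eps * h)) mr.
Qed.

Lemma cbump_powR eps h p u : (0 < p)%R -> (cbump eps h u `^ p = cbump eps h u)%R.
Proof.
move=> p0; rewrite /cbump powRM ?boxC_ge0 ?near0_ge0// boxC_powR//; congr (_ * _)%R.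
by rewrite /near0; case: (_ < _)%R; rewrite ?powR1// powR0// gt_eqF.
Qed.

Lemma cbump_TB (eps h : R) u : (0 < h)%R -> (eps <= 1)%R -> cbump eps h u != 0%R -> TB u.
Proof.
move=> h0 e1; rewrite /cbump mulf_eq0 negb_or => /andP[_ /near0_neq0].
rewrite ltr_norml => /andP[h1 _]; rewrite /TB /=.
by have := mulr_ge0 (ltW h0) (_ : 0 <= 1 - eps)%R; rewrite subr_ge0 => /(_ e1); lra.
Qed.

Lemma cbump_close (eps h : R) z u : (0 <= eps)%R -> (eps <= 1)%R -> (0 < h)%R -> TB z ->
  cbump eps h u != 0%R -> kclose (eps * (2 * m%:R + 1)) z u (xi m h).
Proof.
move=> e0 e1 h0 Tz; rewrite /cbump mulf_eq0 negb_or => /andP[/boxC_neq0[h1 h2 h3] /near0_neq0 h4].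
have sE : (Num.sqrt h ^+ 2 = h)%R by rewrite sqr_sqrtr// ltW.
apply: (@kclose_xi _ _ _ _ (Num.sqrt h)) => //; rewrite ?sE.
- by rewrite lerDl ltW.
- by move=> j; exact: ltW.
- by move=> j; exact: ltW.
- exact: ltW.
- exact: ltW.
Qed.

Definition cbumpc (eps b : R) : \bar R := \int[leb]_r (near0 eps (r - 1) * ppow b r)%:E.

Lemma measurable_cbumpc (eps h c b : R) : measurable_fun setT (fun r : R => (near0 eps (h * r - c) * ppow b r)%:E).
Proof.
apply/measurable_EFinP; apply: measurable_funM; last exact: measurable_ppow.
by have := measurableT_comp (measurable_near0 eps) (measurable_affine h (- c)).
Qed.

(** For eps <= 1/2 the variable r stays in [1/2, 2], where every power lies between positive
    constants. *)
Lemma cbumpc_fine (eps b : R) : (0 < eps)%R -> (eps <= 2^-1)%R ->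
  exists2 k : R, (0 < k)%R & cbumpc eps b = k%:E.
Proof.
move=> e0 e2.
have mn : measurable_fun setT (fun r : R => (near0 eps (r - 1))%:E).
  apply/measurable_EFinP.
  have := measurableT_comp (measurable_near0 eps) (measurable_affine 1 (- 1 : R)).
  by apply: eq_measurable_fun => r _ /=; rewrite mul1r.
have n0 r : 0 <= (near0 eps (r - 1))%:E by rewrite lee_fin near0_ge0.
have nI : \int[leb]_r (near0 eps (r - 1))%:E = (2 * eps)%:E.
  rewrite -integral_near0// -[RHS](ge0_integral_translate (-1))//.
  - by apply/measurable_EFinP; exact: measurable_near0.
  - by move=> r; rewrite lee_fin near0_ge0.
have half r : near0 eps (r - 1) != 0%R -> (2^-1 <= r)%R /\ (r <= 2)%R.
  by move=> /near0_neq0; rewrite ltr_norml => /andP[h1 h2]; split; lra.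
have r0 : (0 < 2^-1 :> R)%R by [].
have lo : ((2^-1 `^ (- b) + 2 `^ (- b))^-1 * (2 * eps))%:E <= cbumpc eps b.
  rewrite EFinM -nI -ge0_integralZl//.
  apply: ge0_le_integral_nomeas => r _.
    by rewrite -EFinM lee_fin mulr_ge0 ?near0_ge0 ?invr_ge0 ?addr_ge0 ?powR_ge0.
  rewrite -EFinM lee_fin mulrC.
  have [->|nr] := eqVneq (near0 eps (r - 1)) 0%R; first by rewrite !mul0r.
  have [h1 h2] := half r nr; apply: ler_wpM2l; first exact: near0_ge0.
  by rewrite ppowE ?(lt_le_trans r0 h1)//; exact: powR_ge_between.
have up : cbumpc eps b <= ((2^-1 `^ b + 2 `^ b) * (2 * eps))%:E.
  rewrite EFinM -nI -ge0_integralZl//.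
  apply: ge0_le_integral_nomeas => r _.
    by rewrite lee_fin mulr_ge0 ?near0_ge0 ?ppow_ge0.
  rewrite -EFinM lee_fin [leRHS]mulrC.
  have [->|nr] := eqVneq (near0 eps (r - 1)) 0%R; first by rewrite !mul0r.
  have [h1 h2] := half r nr; apply: ler_wpM2l; first exact: near0_ge0.
  by rewrite ppowE ?(lt_le_trans r0 h1)//; exact: powR_le_between.
move: lo up; case: (cbumpc eps b) => [k||] // lo _; exists k => //.
apply: lt_le_trans (lo : (_ <= k)%R); rewrite !mulr_gt0// invr_gt0 addr_gt0 ?powR_gt0//.
Qed.

(** The count of powers of h: 2 m coordinates at scale sqrt h, the last real coordinate and rho at
    scale h, and the weight h^b, which makes n + 1 + b. *)
Lemma integral_cbump (eps h b : R) : (0 < eps)%R -> (0 < h)%R ->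
  \int[vol]_u (cbump eps h u * wt b u)%:E =
  (h `^ (n%:R + 1 + b) * ((2 * eps) ^+ m * (2 * eps) * (2 * eps) ^+ m))%:E * cbumpc eps b.
Proof.
move=> e0 h0; have s0 : (0 < Num.sqrt h)%R by rewrite sqrtr_gt0.
have eh0 : (0 < eps * h)%R by rewrite mulr_gt0.
pose phi r := (near0 (eps * h) (r - h) * ppow b r)%:E.
have mphi : measurable_fun setT phi.
  have := measurable_cbumpc (eps * h) 1 h b; apply: eq_measurable_fun => r _.
  by rewrite mul1r.
have phi0 r : 0 <= phi r by rewrite lee_fin mulr_ge0 ?near0_ge0 ?ppow_ge0.
transitivity (\int[vol]_u ((boxC (eps * Num.sqrt h) (eps * h) u)%:E * phi (rho u))).
  by apply: eq_integral => u _; rewrite /phi -EFinM /cbump /wt mulrA.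
rewrite integral_boxC//; last by rewrite mulr_gt0.
rewrite (ge0_integral_scale h0 mphi phi0).
have -> : \int[leb]_r phi (h * r)%R = (h `^ b)%:E * cbumpc eps b.
  rewrite -ge0_integralZl//; last 3 first.
  - have := measurable_cbumpc eps 1 1 b; apply: eq_measurable_fun => r _.
    by rewrite mul1r.
  - by move=> r _; rewrite lee_fin mulr_ge0 ?near0_ge0 ?ppow_ge0.
  - by rewrite lee_fin powR_ge0.
  apply: eq_integral => r _; rewrite /phi -EFinM ppowM//; congr EFin.
  have -> : near0 (eps * h) (h * r - h) = near0 eps (r - 1).
    rewrite /near0 -[in X in (h * r - X)%R](mulr1 h) -mulrBr normrM gtr0_norm// (mulrC eps).
    by rewrite ltr_pM2l.
  by rewrite mulrCA.
rewrite !muleA -!EFinM; congr (_%:E * _).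
have -> : (h `^ (n%:R + 1 + b) = h ^+ m * h * h * h `^ b)%R.
  rewrite gt0_powRD//; congr (_ * _)%R.
  rewrite -natr1 -addrA gt0_powRD// powR_mulrn ?(ltW h0)// -mulrA; congr (_ * _)%R.
  by rewrite gt0_powRD// powRr1// ltW.
have -> : (h ^+ m = Num.sqrt h ^+ m * Num.sqrt h ^+ m)%R.
  by rewrite -exprMn -expr2 sqr_sqrtr// ltW.
rewrite !exprMn; move: (Num.sqrt h ^+ m)%R (eps ^+ m)%R (2 ^+ m)%R (h `^ b)%R => x1 x2 x3 x4.
by ring.
Qed.

Lemma integral_cbump_fine (eps b : R) : (0 < eps)%R -> (eps <= 2^-1)%R ->
  exists2 k : R, (0 < k)%R & forall h, (0 < h)%R ->
    \int[vol]_u (cbump eps h u * wt b u)%:E = (k * h `^ (n%:R + 1 + b))%:E.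
Proof.
move=> e0 e2; have [k k0 kE] := cbumpc_fine b e0 e2.
exists ((2 * eps) ^+ m * (2 * eps) * (2 * eps) ^+ m * k)%R.
  by rewrite !mulr_gt0 ?exprn_gt0 ?mulr_gt0.
move=> h h0; rewrite integral_cbump// kE -EFinM; congr EFin; ring.
Qed.

(** Because D is all of T_B, the profile norm is again an exact kernel integral, now at the point
    [xi h] with rho = h. *)
Lemma integral_lowf_TB (h a c q be : R) : (0 < h)%R -> (0 < q)%R ->
  \int[vol]_z (lowf (@TB R n) (xi m h) a c z `^ q * wt be z)%:E =
  (h `^ (a * q + be + - c * q + n%:R + 1))%:E * kapJ m (a * q + be) (- c * q).
Proof.
move=> h0 q0; rewrite -[in RHS](rho_xi m h) -integral_wt_kmod_l ?rho_xi//.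
apply: eq_integral => z _; congr EFin.
have [Tz|Tz] := pselect (TB z); last by rewrite !(wt_notin _ Tz) mulr0 mul0r.
rewrite /lowf indicE mem_set// mul1r !(wtE _ Tz) powRM ?powR_ge0// -!powRrM.
by rewrite gt0_powRD// mulrAC.
Qed.

End test_families.

(** * Comparison of powers and the logarithmic case *)

Section power_growth.
Context (R : realType).

Lemma powR_bounded_eq0 (s C : R) : (forall h, 0 < h -> h `^ s <= C) -> s = 0.
Proof.
move=> H; apply/eqP/negPn/negP => s0.
have A0 : 0 < `|C| + 1 by rewrite ltr_wpDl.
(* This h satisfies h^s = |C| + 1 whichever sign s has. *)
have := H ((`|C| + 1) `^ s^-1) (powR_gt0 _ A0).
rewrite -powRrM mulVf// powRr1 ?(ltW A0)//.
by have := ler_norm C; lra.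
Qed.

(** The inequality holds both as h tends to 0 and as h tends to infinity, which rules out either
    strict order of the exponents. *)
Lemma powR_dominated (x y c C : R) : 0 < c ->
  (forall h, 0 < h -> c * h `^ x <= C * h `^ y) -> x = y.
Proof.
move=> c0 H; apply/subr0_eq/(@powR_bounded_eq0 _ (C / c)) => h h0.
rewrite ler_pdivlMr// mulrC gt0_powRD// powRN mulrA ler_pdivrMr ?powR_gt0//.
exact: H.
Qed.

Lemma nat_powR_unbounded (t C : R) : 0 < t ->
  ~ (forall k : nat, (0 < k)%N -> k%:R `^ t <= C).
Proof.
move=> t0 H; pose k := (Num.bound (`|C| `^ t^-1)).+1.
have kb : `|C| `^ t^-1 < k%:R.
  apply: lt_trans (archi_boundP (powR_ge0 _ _)) _; by rewrite ltr_nat.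
have := H k isT; apply/negP; rewrite -ltNge; apply: le_lt_trans (ler_norm C) _.
have := @gt0_ltr_powR _ t t0 (`|C| `^ t^-1) k%:R.
by rewrite !nnegrE powR_ge0 ler0n -powRrM mulVf ?gt_eqF// powRr1// => /(_ isT isT kb).
Qed.

Local Open Scope ereal_scope.

Lemma pint_le_exp (t t' a : R) : (0 < a)%R -> (t <= t')%R -> pint t' a 1 <= pint t a 1.
Proof.
move=> a0 tt'; apply: ge0_le_integral_nomeas => r; first by rewrite lee_fin ppow_ge0.
rewrite /= in_itv /= => /andP[ar r1]; have r0 := lt_trans a0 ar.
by rewrite lee_fin !ppowE//; apply: ger_powR => //; rewrite r0.
Qed.

(** At the critical exponent all dyadic layers have the same mass, so the integral grows linearly in
    their number. *)
Lemma pintN1 : exists2 c : R, (0 < c)%R & forall k, pint (-1) (2 ^- k) 1 = (k%:R * c)%:E.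
Proof.
have h2 : (2^-1 < 1 :> R)%R by rewrite invf_lt1// ltr1n.
have h0 : (0 < 2^-1 :> R)%R by [].
have [c c0 cE] := pint_fine (-1) h0 h2.
exists c => // k; apply: (@affine_rec_eq _ (fun k => pint (-1) (2 ^- k) 1) c 1) => //.
  by rewrite expr0 invr1 pint_empty.
by move=> j; rewrite pint_downS cE addNr powRr0.
Qed.

Definition slab (k : nat) (t r : R) : R := \1_(`](2 ^- k)%R, 1%R]%classic) r * ppow t r.

Lemma slab_ge0 k t r : (0 <= slab k t r)%R.
Proof. by rewrite mulr_ge0 ?ppow_ge0. Qed.

Lemma measurable_slab k t : measurable_fun setT (slab k t).
Proof. by apply: measurable_funM; [exact: measurable_indic|exact: measurable_ppow]. Qed.

Lemma slab_neq0 k t r : slab k t r != 0%R -> (0 < r)%R /\ (r <= 1)%R.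
Proof.
rewrite /slab indicE mem_setE mulf_eq0 negb_or pnatr_eq0 eqb0 negbK => /andP[] /=.
by rewrite in_itv /= => /andP[r0 r1] _; split => //; apply: lt_trans r0; rewrite invr_gt0 exprn_gt0.
Qed.

Lemma slabM k t t' r : (slab k t r * ppow t' r = slab k (t + t') r)%R.
Proof. by rewrite /slab -mulrA ppowD. Qed.

Lemma slab_powR k t p r : (0 < p)%R -> (slab k t r `^ p = slab k (t * p) r)%R.
Proof.
move=> p0; rewrite /slab powRM ?ppow_ge0// ppow_powR ?gt_eqF//; congr (_ * _)%R.
by rewrite indicE; case: (_ \in _); rewrite ?powR1// powR0// gt_eqF.
Qed.

Lemma integral_slab k t : \int[@lebesgue_measure R]_r (slab k t r)%:E = pint t (2 ^- k) 1.
Proof.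
apply/esym; apply: ge0_integral_setT_patch => r Dr; rewrite /slab indicE.
  by rewrite mem_set// mul1r.
by rewrite memNset// mul0r.
Qed.

End power_growth.

(** * Slab test functions seen from a distant region *)

Section slabs.
Context (R : realType) (m : nat).
Local Notation n := m.+1.
Local Notation vol := (@volC R n).
Local Open Scope ereal_scope.
Implicit Types z w u : Cn R n.

Definition bslab (k : nat) (t : R) u : R := boxC 1 1 u * slab k t (rho u).

Lemma bslab_ge0 k t u : (0 <= bslab k t u)%R.
Proof. by rewrite mulr_ge0 ?boxC_ge0 ?slab_ge0. Qed.

Lemma measurable_bslab k t : measurable_fun setT (bslab k t).
Proof.
apply: measurable_funM; first exact: measurable_boxC.
by have := measurableT_comp (measurable_slab k t) (@measurable_rho R n).
Qed.

Lemma bslab_powR k t p u : (0 < p)%R -> (bslab k t u `^ p = bslab k (t * p) u)%R.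
Proof. by move=> p0; rewrite /bslab powRM ?boxC_ge0 ?slab_ge0// boxC_powR// slab_powR. Qed.

Lemma integral_bslab k t b : \int[vol]_u (bslab k t u * wt b u)%:E =
  (2 ^+ m * 2 * 2 ^+ m)%:E * pint (t + b) (2 ^- k) 1.
Proof.
transitivity (\int[vol]_u ((boxC 1 1 u)%:E * (slab k (t + b) (rho u))%:E)).
  apply: eq_integral => u _; rewrite -EFinM; congr EFin.
  by rewrite /bslab /wt -mulrA slabM.
rewrite (@integral_boxC R m 1%R 1%R (fun r => (slab k (t + b) r)%:E))//.
- by rewrite integral_slab !mulr1.
- by apply/measurable_EFinP; exact: measurable_slab.
- by move=> r; rewrite lee_fin slab_ge0.
Qed.

(** From rho(z) >= eps^(-2), a set of size 1 with 0 < rho <= 1 has relative size eps whatever k is.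
    The reference point [xi 0] may therefore lie on the boundary of T_B, and T = 1/eps. *)
Lemma bslab_close (eps : R) k t z u : (0 < eps)%R -> (eps <= 1)%R -> (eps^-1 ^+ 2 <= rho z)%R ->
  bslab k t u != 0%R -> kclose (eps * (2 * m%:R + 1)) z u (xi m 0).
Proof.
move=> e0 e1 rz; rewrite /bslab mulf_eq0 negb_or => /andP[/boxC_neq0[h1 h2 h3] /slab_neq0[h4 h5]].
have eE : (eps * eps^-1 = 1)%R by rewrite mulfV// gt_eqF.
have ie1 : (1 <= eps^-1)%R by rewrite invf_ge1.
have eE2 : (1 <= eps * eps^-1 ^+ 2)%R by rewrite expr2 mulrA eE mul1r.
apply: (@kclose_xi _ _ _ _ eps^-1); rewrite ?(ltW e0)// ?eE ?add0r//.
- by move=> j; exact: ltW.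
- by move=> j; exact: ltW.
- exact: le_trans (ltW h3) eE2.
- by rewrite subr0 ger0_norm ?(ltW h4)//; exact: le_trans h5 eE2.
Qed.

Lemma measurable_rho_ge (T : R) : measurable [set z : Cn R n | (T <= rho z)%R].
Proof.
have := @measurable_rho R n measurableT `[T, +oo[%classic (measurable_itv _).
by rewrite setTI; congr measurable; apply/seteqP; split => z /=; rewrite in_itv /= andbT.
Qed.

(** If the integral were 0, the profile would vanish almost everywhere on the region; but a box
    function at height 2 T with eps = 1/2 is supported there and has positive mass. *)
Lemma integral_lowf_gt0 (T a c q be : R) xi0 : (0 < T)%R -> (0 < q)%R ->
  (forall z, (T <= rho z)%R -> (0 < re2 z xi0)%R) ->
  0 < \int[vol]_z (lowf [set z | (T <= rho z)%R] xi0 a c z `^ q * wt be z)%:E.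
Proof.
move=> T0 q0 Tre; set D := [set z | _].
have mD : measurable D by exact: measurable_rho_ge.
pose f z := (lowf D xi0 a c z `^ q * wt be z)%:E.
have mf : measurable_fun setT f.
  apply/measurable_EFinP; apply: measurable_funM; last exact: measurable_wt.
  by have := measurableT_comp (measurable_powR q) (measurable_lowf xi0 a c mD).
have f0 z : 0 <= f z by rewrite lee_fin mulr_ge0 ?powR_ge0 ?wt_ge0.
have If0 : 0 <= \int[vol]_z f z by exact: integral_ge0.
rewrite -/(f _) lt_neqAle; apply/andP; split; last exact: If0.
apply/eqP => /esym I0.
have ae0 := ge0_integral_eq0_ae mf f0 I0.
have h2 : (2^-1 <= 2^-1 :> R)%R by [].
have e0 : (0 < 2^-1 :> R)%R by [].
have [k k0 kE] := @integral_cbump_fine R m 2^-1 0 e0 h2.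
have T20 : (0 < 2 * T)%R by rewrite mulr_gt0.
have := kE _ T20; rewrite (ae_eq_integral (cst 0))//.
- rewrite integral_cst//= mul0e => /eqP; rewrite eq_sym eqe mulf_eq0.
  by rewrite !gt_eqF// powR_gt0.
- apply/measurable_EFinP; apply: measurable_funM; last exact: measurable_wt.
  exact: measurable_cbump.
apply: filterS ae0 => u fu _; move: (fu Logic.I); rewrite /f /=.
have [->|bu] := eqVneq (cbump 2^-1%R (2 * T)%R u) 0%R; first by rewrite mul0r.
have Du : D u.
  move: bu; rewrite /cbump mulf_eq0 negb_or => /andP[_ /near0_neq0].
  by rewrite ltr_norml => /andP[h _]; rewrite /D /=; lra.
have Tu : TB u by rewrite /TB /=; exact: lt_le_trans T0 Du.
move=> /eqP; rewrite eqe mulf_eq0 gt_eqF /=.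
  by rewrite (wtE _ Tu) gt_eqF// powR_gt0.
rewrite powR_gt0// /lowf indicE mem_set// mul1r mulr_gt0// ?(wtE _ Tu) powR_gt0//.
by apply: lt_le_trans (kmod_ge_re _ _); rewrite normr_gt0 gt_eqF ?Tre.
Qed.

End slabs.

(** * Necessity of the conditions *)

Section necessity.
Local Open Scope ereal_scope.

Lemma conditions_of_bounded (R : realType) (m : nat)
    (e p1 q1 q2 a1 a2 b1 b2 c1 c2 al1 al2 be1 be2 : R)
    (K : cfun R m.+1 -> Cn R m.+1 -> Cn R m.+1 -> Cn R m.+1 * Cn R m.+1 -> R[i]) :
  phased e b1 b2 c1 c2 K -> (1 < p1)%R -> (0 < q1)%R -> (0 < q2)%R ->
  bounded_op a1 a2 K p1 1 al1 al2 q1 q2 be1 be2 ->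
  (al1 + 1 < p1 * (b1 + 1) /\ al2 < b2 /\
   - q1 * a1 < be1 + 1 /\ - q2 * a2 < be2 + 1 /\
   c1 = m.+1%:R + 1 + a1 + b1 + ((m.+1%:R + 1 + be1) / q1 - (m.+1%:R + 1 + al1) / p1) /\
   c2 = m.+1%:R + 1 + a2 + b2 + ((m.+1%:R + 1 + be2) / q2 - (m.+1%:R + 1 + al2)))%R.
Proof.
move=> phK p11 q10 q20 [C HC0].
have p10 : (0 < p1)%R by lra.
have HC f fL := (HC0 f fL).2.
have [d [d0 d4 dphase]] := @phase_close R m e c1 c2.
have m0 : (0 < 2 * m%:R + 1 :> R)%R by rewrite ltr_wpDl// mulr_ge0.
(* This cancels the factor 2 m + 1 of [kclose_xi], so that the boxes are within relative distance
   d. *)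
pose eps := (d / (2 * m%:R + 1))%R.
have e0 : (0 < eps)%R by rewrite divr_gt0.
have ed : (eps * (2 * m%:R + 1) = d)%R by rewrite divfK// gt_eqF.
have e4 : (eps <= 4^-1)%R.
  by have := mulr_ge0 (ltW e0) (ler0n R m); lra.
have e2 : (eps <= 2^-1)%R by lra.
have e1 : (eps <= 1)%R by lra.
have adm h : (0 < h)%R -> admissible d (@cbump R m eps h) (@TB R m.+1) (xi m h).
  move=> h0; split.
  - exact: measurable_cbump.
  - exact: cbump_ge0.
  - by move=> u; exact: cbump_TB.
  - exact: measurable_TB.
  - by [].
  - by move=> z Tz; apply: re2_gt0; rewrite ?rho_xi; move: Tz; rewrite /TB /=; lra.
  - by move=> z u Tz bu; rewrite -ed; apply: cbump_close => //; exact: ltW.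
have [kb1 kb10 kb1E] := @integral_cbump_fine R m eps b1 e0 e2.
have [kb2 kb20 kb2E] := @integral_cbump_fine R m eps b2 e0 e2.
have [ka1 ka10 ka1E] := @integral_cbump_fine R m eps al1 e0 e2.
have [ka2 ka20 ka2E] := @integral_cbump_fine R m eps al2 e0 e2.
have ka1E' h : (0 < h)%R ->
    \int[@volC R m.+1]_u (cbump eps h u `^ p1 * wt al1 u)%:E = (ka1 * h `^ (m.+1%:R + 1 + al1))%:E.
  by move=> h0; rewrite -ka1E//; apply: eq_integral => u _; rewrite cbump_powR.
(* The exponents of h in the profile integrals; their negativity is also the convergence condition
   at infinity. *)
pose s1 := (a1 * q1 + be1 + - c1 * q1 + m.+1%:R + 1)%R.
pose s2 := (a2 * q2 + be2 + - c2 * q2 + m.+1%:R + 1)%R.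
have ineq h1 h2 (h10 : (0 < h1)%R) (h20 : (0 < h2)%R) :=
  test_inequality phK p10 q10 q20 HC (ltW d0) d4 dphase (adm h1 h10) (adm h2 h20)
    (kb1E h1 h10) (kb2E h2 h20) (ka1E' h1 h10) (ka2E h2 h20).
have lc1 := lowc_gt0 c1; have lc2 := lowc_gt0 c2.
(* One test with both scales equal to 1: all other factors are positive and the right side is
   finite, so neither constant can be infinite. *)
have [k1y k2y] : kapJ m (a1 * q1 + be1) (- c1 * q1) < +oo /\ kapJ m (a2 * q2 + be2) (- c2 * q2) < +oo.
  have := ineq 1%R 1%R ltr01 ltr01; rewrite !integral_lowf_TB// !powR1 !mul1e !mulr1.
  have := kapJ_gt0 m (a1 * q1 + be1) (- c1 * q1); have := kapJ_gt0 m (a2 * q2 + be2) (- c2 * q2).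
  move: (kapJ m _ _) (kapJ m _ _) => k2 k1 k20 k10.
  set kap := (_ / 2)%R; set rhs := (C * _)%R.
  have kap0 : 0 < kap%:E by rewrite lte_fin divr_gt0// !mulr_gt0.
  have k1p := poweR_gt0 q1^-1 k10; have k2p := poweR_gt0 q2^-1 k20.
  have q1n : (q1^-1 != 0)%R by rewrite gt_eqF ?invr_gt0.
  have q2n : (q2^-1 != 0)%R by rewrite gt_eqF ?invr_gt0.
  move=> h; split; rewrite ltey; apply/eqP => ky; move: h; rewrite ky poweRyr//.
    by rewrite gt0_mulye// gt0_muley.
  by rewrite gt0_muley// gt0_muley.
have [E1 S1] : (-1 < a1 * q1 + be1)%R /\ (s1 < 0)%R.
  by apply: contrapT => /kapJ_eqy ky; move: k1y; rewrite ky.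
have [E2 S2] : (-1 < a2 * q2 + be2)%R /\ (s2 < 0)%R.
  by apply: contrapT => /kapJ_eqy ky; move: k2y; rewrite ky.
have [k1 k10 k1E] := kapJ_fine E1 S1.
have [k2 k20 k2E] := kapJ_fine E2 S2.
have ineqR h1 h2 : (0 < h1)%R -> (0 < h2)%R ->
  (lowc c1 * lowc c2 * (kb1 * h1 `^ (m.+1%:R + 1 + b1)) * (kb2 * h2 `^ (m.+1%:R + 1 + b2)) / 2 *
   ((h1 `^ (s1 / q1) * k1 `^ q1^-1) * (h2 `^ (s2 / q2) * k2 `^ q2^-1)) <=
   C * ((ka1 `^ p1^-1 * h1 `^ ((m.+1%:R + 1 + al1) / p1)) * (ka2 * h2 `^ (m.+1%:R + 1 + al2))))%R.
  move=> h10 h20; have := ineq h1 h2 h10 h20.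
  rewrite !integral_lowf_TB// k1E k2E -!EFinM ?poweR_EFin -?EFinM lee_fin.
  rewrite !powRM ?powR_ge0 ?(ltW k10) ?(ltW k20) ?(ltW ka10)// -!powRrM.
  by [].
pose c0 := (lowc c1 * lowc c2 * kb1 * kb2 / 2 * (k1 `^ q1^-1 * k2 `^ q2^-1))%R.
have c00 : (0 < c0)%R by rewrite !mulr_gt0 ?powR_gt0 ?invr_gt0.
(* The second scale is fixed at 1 and the first runs over all h > 0. *)
have eq1 : (m.+1%:R + 1 + b1 + s1 / q1 = (m.+1%:R + 1 + al1) / p1)%R.
  apply: (@powR_dominated _ _ _ c0 (C * (ka1 `^ p1^-1 * ka2)) c00) => h h0.
  have := ineqR h 1%R h0 ltr01; rewrite !powR1 (gt0_powRD (m.+1%:R + 1 + b1) (s1 / q1) h0) /c0.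
  move: (_ `^ _)%R (_ `^ _)%R (_ `^ _)%R (_ `^ _)%R (_ `^ _)%R (_ `^ _)%R => x1 x2 x3 x4 x5 x6.
  by clear; lra.
have eq2 : (m.+1%:R + 1 + b2 + s2 / q2 = m.+1%:R + 1 + al2)%R.
  apply: (@powR_dominated _ _ _ c0 (C * (ka1 `^ p1^-1 * ka2)) c00) => h h0.
  have := ineqR 1%R h ltr01 h0; rewrite !powR1 (gt0_powRD (m.+1%:R + 1 + b2) (s2 / q2) h0) /c0.
  move: (_ `^ _)%R (_ `^ _)%R (_ `^ _)%R (_ `^ _)%R (_ `^ _)%R (_ `^ _)%R => x1 x2 x3 x4 x5 x6.
  by clear; lra.
split; last first.
  split.
    (* [eq2] identifies s2 / q2 with al2 - b2. *)
    have : (s2 / q2 < 0)%R by rewrite pmulr_llt0 ?invr_gt0.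
    by move: eq2; move: (s2 / q2)%R => x; clear; lra.
  split; first by move: E1; clear; lra.
  split; first by move: E2; clear; lra.
  split.
    have -> : (c1 = a1 + (m.+1%:R + 1 + be1) / q1 - s1 / q1)%R.
      by rewrite /s1; move: (m.+1%:R) => N; field; rewrite gt_eqF.
    by move: eq1; move: (s1 / q1)%R ((_ + be1) / q1)%R ((_ + al1) / p1)%R => x y y'; clear; lra.
  have -> : (c2 = a2 + (m.+1%:R + 1 + be2) / q2 - s2 / q2)%R.
    by rewrite /s2; move: (m.+1%:R) => N; field; rewrite gt_eqF.
  by move: eq2; move: (s2 / q2)%R ((_ + be2) / q2)%R => x y; clear; lra.
rewrite ltNge; apply/negP => bad.
(* With this s the p1-th power of the slab norm has integrand r^(-1), hence is proportional to k. By
   [bad] the exponent in the mass against rho^b1 is at most -1, so that mass grows at least like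
   k. *)
pose s := ((al1 + 1) / p1)%R.
have bs : (- s + b1 <= -1)%R.
  by have : (b1 + 1 <= s)%R; [rewrite /s ler_pdivlMr// mulrC|clear; lra].
pose D := [set z : Cn R m.+1 | (eps^-1 ^+ 2 <= rho z)%R].
have T0 : (0 < eps^-1 ^+ 2)%R by rewrite exprn_gt0// invr_gt0.
have Dre z : (eps^-1 ^+ 2 <= rho z)%R -> (0 < re2 z (xi m 0))%R.
  by move=> Dz; have rz := lt_le_trans T0 Dz; apply: re2_gt0; rewrite ?rho_xi ?addr0 ?(ltW rz).
have admk k : admissible d (@bslab R m k (- s)) D (xi m 0).
  split.
  - exact: measurable_bslab.
  - exact: bslab_ge0.
  - by move=> u; rewrite /bslab mulf_eq0 negb_or => /andP[_ /slab_neq0[]].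
  - exact: measurable_rho_ge.
  - by move=> z Dz; rewrite /TB /=; exact: lt_le_trans T0 Dz.
  - exact: Dre.
  - by move=> z u Dz gu; rewrite -ed; exact: bslab_close gu.
have [c cc0 cE] := pintN1 R.
pose bx : R := (2 ^+ m * 2 * 2 ^+ m)%R.
have bx0 : (0 < bx)%R by rewrite !mulr_gt0 ?exprn_gt0.
have NE k : \int[@volC R m.+1]_u (bslab k (- s) u `^ p1 * wt al1 u)%:E = (bx * (k%:R * c))%:E.
  rewrite (eq_integral (fun u => (bslab k (- s * p1) u * wt al1 u)%:E)); last first.
    by move=> u _; rewrite bslab_powR.
  have sE : (- s * p1 + al1 = -1)%R by rewrite /s; field; rewrite gt_eqF.
  by rewrite integral_bslab sE cE -EFinM.
have W0 := integral_lowf_gt0 a1 c1 be1 T0 q10 Dre.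
have h20 : (0 < 1 :> R)%R by [].
pose W := (\int[@volC R m.+1]_z (lowf D (xi m 0) a1 c1 z `^ q1 * wt be1 z)%:E) `^ q1^-1.
have Wp : 0 < W by exact: poweR_gt0.
have step k : (0 < k)%N -> exists2 x : R, (k%:R * c <= x)%R &
    (lowc c1 * lowc c2 * (bx * x) * kb2 / 2)%:E * (W * (k2 `^ q2^-1)%:E) <=
    (C * ((bx * (k%:R * c)) `^ p1^-1 * ka2))%:E.
  move=> k0; have a0 : (0 < 2 ^- k :> R)%R by rewrite invr_gt0 exprn_gt0.
  have ak1 : (2 ^- k < 1 :> R)%R.
    by rewrite invf_lt1 ?exprn_gt0// exprn_egt1// ?ltr1n// -lt0n.
  have [x x0 xE] := pint_fine (- s + b1) a0 ak1.
  exists x; first by rewrite -lee_fin -cE -xE; exact: pint_le_exp.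
  have ME : \int[@volC R m.+1]_u (bslab k (- s) u * wt b1 u)%:E = (bx * x)%:E.
    by rewrite integral_bslab xE EFinM.
  have := test_inequality phK p10 q10 q20 HC (ltW d0) d4 dphase (admk k) (adm 1%R h20)
    ME (kb2E 1%R h20) (NE k) (ka2E 1%R h20).
  by rewrite integral_lowf_TB// k2E !powR1 mul1e !mulr1 poweR_EFin.
(* The instance k = 1 bounds [W] by a finite quantity. *)
have [y y0 WE] : exists2 y : R, (0 < y)%R & W = y%:E.
  have [x x0] := step 1%N isT.
  clear step; case: W Wp => [y||] // y0; first by move=> _; exists y.
  rewrite gt0_mulye ?lte_fin ?powR_gt0// gt0_muley// lte_fin divr_gt0// !mulr_gt0//.
  by apply: lt_le_trans x0; rewrite mul1r.
pose A := (lowc c1 * lowc c2 * bx * kb2 / 2 * (y * k2 `^ q2^-1) * c)%R.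
have A0 : (0 < A)%R by rewrite !mulr_gt0 ?powR_gt0 ?invr_gt0.
have t0 : (0 < 1 - p1^-1)%R by rewrite subr_gt0 invf_lt1.
(* Dividing k <= C k^(1/p1) by k^(1/p1) leaves the positive power 1 - 1/p1 of k, bounded for all
   k. *)
apply: (@nat_powR_unbounded _ _ ((C * ((bx * c) `^ p1^-1 * ka2)) / A) t0) => k k0.
have kR : (0 < k%:R :> R)%R by rewrite ltr0n.
rewrite ler_pdivlMr// gt0_powRD// powRr1 ?(ltW kR)// powRN mulrAC ler_pdivrMr ?powR_gt0//.
have [x xk] := step k k0; rewrite WE -!EFinM lee_fin.
have -> : ((bx * (k%:R * c)) `^ p1^-1 = k%:R `^ p1^-1 * (bx * c) `^ p1^-1)%R.
  have bc0 := ltW (mulr_gt0 bx0 cc0).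
  have -> : (bx * (k%:R * c) = k%:R * (bx * c))%R by exact: mulrCA.
  by rewrite (powRM _ (ltW kR) bc0).
have := ler_wpM2l (ltW (_ : 0 < lowc c1 * lowc c2 * bx * kb2 / 2 * (y * k2 `^ q2^-1))%R) xk.
rewrite !mulr_gt0 ?powR_gt0 ?invr_gt0// => /(_ isT).
rewrite /A; move: (lowc c1) (lowc c2) (_ `^ _)%R (_ `^ _)%R (_ `^ _)%R => l1 l2 x1 x2 x3.
by clear; lra.
Qed.

End necessity.

(** * Equivalence for S and T through the common conditions *)

Theorem theorem6p3 (R : realType) (n : nat) (n_gt0 : (0 < n)%N)
  (p1 q1 q2 : R) (a1 a2 b1 b2 c1 c2 al1 al2 be1 be2 : R) :
  1 < p1 -> p1 <= Num.min q1 q2 ->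
  -1 < al1 -> -1 < al2 -> -1 < be1 -> -1 < be2 ->
  let lam1 := (n%:R + 1 + be1) / q1 - (n%:R + 1 + al1) / p1 in
  let lam2 := (n%:R + 1 + be2) / q2 - (n%:R + 1 + al2) in
  [<-> bounded_op a1 a2 (@Sintegrand R n b1 b2 c1 c2) p1 1 al1 al2 q1 q2 be1 be2;
       bounded_op a1 a2 (@Tintegrand R n b1 b2 c1 c2) p1 1 al1 al2 q1 q2 be1 be2;
       al1 + 1 < p1 * (b1 + 1) /\ al2 < b2 /\
       - q1 * a1 < be1 + 1 /\ - q2 * a2 < be2 + 1 /\
       c1 = n%:R + 1 + a1 + b1 + lam1 /\ c2 = n%:R + 1 + a2 + b2 + lam2].
Proof.
case: n n_gt0 => [//|m] _ p11; rewrite le_min => /andP[p1q1 p1q2] _ _ _ _ lam1 lam2.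
have q10 : 0 < q1 by lra.
have q20 : 0 < q2 by lra.
tfae.
- move=> /(conditions_of_bounded (phased_S b1 b2 c1 c2) p11 q10 q20).
  move=> [cb1 [cb2 [ca1 [ca2 [c1E c2E]]]]].
  exact: (bounded_of_conditions (phased_T b1 b2 c1 c2) p11 p1q1 p1q2 cb1 cb2 ca1 ca2 c1E c2E).
- exact: (conditions_of_bounded (phased_T b1 b2 c1 c2) p11 q10 q20).
- move=> [cb1 [cb2 [ca1 [ca2 [c1E c2E]]]]].
  exact: (bounded_of_conditions (phased_S b1 b2 c1 c2) p11 p1q1 p1q2 cb1 cb2 ca1 ca2 c1E c2E).
Qed.
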